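(* Let $p(\cdot),q(\cdot)\in\mathcal{P}$ satisfy $1<p_-\le p_+<\infty$ and $1<q_-\le q_+<\infty$, and assume that $\ell^{q(\cdot)}(L^{p(\cdot)})$, equipped with $\|\cdot\|_{\ell^{q(\cdot)}(L^{p(\cdot)})}$, is a Banach space. Then $\ell^{q(\cdot)}(L^{p(\cdot)})$ is uniformly convex.
   Context: Exponents: $\mathcal{P}$ is the set of measurable functions $p(\cdot):\mathbb{R}^n\to[1,\infty]$; $p_-=\operatorname{ess\,inf}p$, $p_+=\operatorname{ess\,sup}p$ (similarly $q_\pm$). Variable Lebesgue space: with $\Omega_\infty=\{x:p(x)=\infty\}$ and $\Omega_0=\mathbb{R}^n\setminus\Omega_\infty$, put $\varrho_{p(\cdot)}(f)=\int_{\Omega_0}|f(x)|^{p(x)}dx+\|f\|_{L^\infty(\Omega_\infty)}$; $L^{p(\cdot)}=L^{p(\cdot)}(\mathbb{R}^n)$ is the set of measurable $f$ with $\varrho_{p(\cdot)}(f/\lambda)<\infty$ for some $\lambda>0$, and $\|f\|_{p(\cdot)}=\inf\{\lambda>0:\varrho_{p(\cdot)}(f/\lambda)\le1\}$. Mixed space: for a sequence $f=(f_\nu)_{\nu\ge1}$ with $f_\nu\in L^{p(\cdot)}$, put $\varrho_{\ell^{q(\cdot)}(L^{p(\cdot)})}(f)=\sum_{\nu=1}^\infty\inf\{\lambda_\nu>0:\varrho_{p(\cdot)}(f_\nu/\lambda_\nu^{1/q(\cdot)})\le1\}$ (convention $\lambda^{1/\infty}=1$). When $q_+<\infty$ this equals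 $\sum_\nu\||f_\nu|^{q(\cdot)}\|_{p(\cdot)/q(\cdot)}$. The space $\ell^{q(\cdot)}(L^{p(\cdot)})$ is the set of such $f$ with $\varrho_{\ell^{q(\cdot)}(L^{p(\cdot)})}(f/\lambda)<\infty$ for some $\lambda>0$, with (quasi-)norm $\|f\|_{\ell^{q(\cdot)}(L^{p(\cdot)})}=\inf\{\mu>0:\varrho_{\ell^{q(\cdot)}(L^{p(\cdot)})}(f/\mu)\le1\}$. A Banach space $X$ is uniformly convex if for every $\varepsilon\in(0,2]$ there is $\delta>0$ such that $\|\frac{x+y}{2}\|\le1-\delta$ whenever $\|x\|=\|y\|=1$ and $\|x-y\|\ge\varepsilon$. *)

(* Defs.v *)
From HB Require Import structures.
From mathcomp Require Import all_boot all_order all_algebra.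
From mathcomp Require Import all_classical all_reals all_analysis.
From mathcomp Require Import measurable_realfun ess_sup_inf.

Set Implicit Arguments.
Unset Strict Implicit.
Unset Printing Implicit Defensive.
Import Order.TTheory GRing.Theory Num.Theory.
Import numFieldNormedType.Exports.
Local Open Scope classical_set_scope.
Local Open Scope ring_scope.

(** The Lebesgue outer measure is the infimum of the total volumes of countable covers
    by closed boxes, and Lebesgue-measurable sets are its Caratheodory-measurable
    sets (so null sets are all measurable).  The dimension is [n.+1]: in dimension 0 every box has volume 1, and
    the empty set would not get outer measure 0. *)

Section lebesgue_Rn.
Context (R : realType) (n : nat).
Local Open Scope ereal_scope.

Definition box (c : 'rV[R]_n.+1 * 'rV[R]_n.+1) : set 'rV[R]_n.+1 :=
  [set x | forall i, c.1 ord0 i <= x ord0 i <= c.2 ord0 i]%R.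

Definition box_vol (c : 'rV[R]_n.+1 * 'rV[R]_n.+1) : R :=
  (\prod_(i < n.+1) (c.2 ord0 i - c.1 ord0 i))%R.

Definition box_cover (X : set 'rV[R]_n.+1) :
    set (nat -> 'rV[R]_n.+1 * 'rV[R]_n.+1) :=
  [set c : nat -> 'rV[R]_n.+1 * 'rV[R]_n.+1 |
           (forall k i, (c k).1 ord0 i <= (c k).2 ord0 i)%R /\
           X `<=` \bigcup_k box (c k)].

Definition lebesgue_outer (X : set 'rV[R]_n.+1) : \bar R :=
  ereal_inf [set \sum_(k <oo) (box_vol (c k))%:E | c in box_cover X].

Let box_vol_ge0 X (c : nat -> 'rV[R]_n.+1 * 'rV[R]_n.+1) k :
  box_cover X c -> 0 <= (box_vol (c k))%:E.
Proof.
by move=> [ab _]; rewrite lee_fin prodr_ge0// => i _; rewrite subr_ge0.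
Qed.

Let lebesgue_outer_ge0 X : 0 <= lebesgue_outer X.
Proof.
apply: le_ereal_inf_tmp => _ [c cX <-].
by apply: nneseries_ge0 => k _ _; exact: box_vol_ge0 cX.
Qed.

Let lebesgue_outer0 : lebesgue_outer set0 = 0.
Proof.
apply/eqP; rewrite eq_le lebesgue_outer_ge0 andbT.
apply: ereal_inf_lbound; exists (fun=> (0%R, 0%R)); first by split.
by apply: eseries0 => k _ _; rewrite /box_vol /= big_ord_recl subrr mul0r.
Qed.

Let le_lebesgue_outer : {homo lebesgue_outer : A B / A `<=` B >-> A <= B}.
Proof.
move=> A B AB; apply/ereal_inf_le_tmp => _ [c [cab cB] <-].
by exists c => //; split => //; exact: subset_trans AB cB.
Qed.

Let lebesgue_outer_sigma_subadditive : sigma_subadditive lebesgue_outer.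
Proof.
move=> A; have [[i ioo]|] := pselect (exists i, lebesgue_outer (A i) = +oo).
  rewrite (eseries_pinfty _ _ ioo) ?leey// => m _.
  by rewrite -ltNye (lt_le_trans _ (lebesgue_outer_ge0 _)).
rewrite -forallNE => Aoo.
suff add2e (e : {posnum R}) :
    lebesgue_outer (\bigcup_m A m) <=
    \sum_(i <oo) lebesgue_outer (A i) + e%:num%:E.
  by apply/lee_addgt0Pr => _/posnumP[].
rewrite (le_trans _ (epsilon_trick _ _ _))//.
pose P m (B : nat -> 'rV[R]_n.+1 * 'rV[R]_n.+1) := box_cover (A m) B /\
  \sum_(k <oo) (box_vol (B k))%:E <=
    lebesgue_outer (A m) + (e%:num / (2 ^ m.+1)%:R)%:E.
have [G PG] : {G : nat -> nat -> _ & forall m, P m (G m)}.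
  apply: (@choice _ _ P) => m; rewrite /P.
  have Afin : lebesgue_outer (A m) \is a fin_num.
    by rewrite ge0_fin_numE// ltey; apply/eqP/Aoo.
  have en1 : (0 < e%:num / (2 ^ m.+1)%:R)%R by [].
  have [x [B AB xS] lex] := lb_ereal_inf_adherent en1 Afin.
  by exists B; split => //; rewrite xS; exact/ltW.
pose V (ij : nat * nat) := (box_vol (G ij.1 ij.2))%:E.
have V_ge0 ij : 0 <= V ij by exact: box_vol_ge0 (PG ij.1).1.
apply: (@le_trans _ _ (\esum_(i in setT) V i)).
  apply: ereal_inf_lbound => /=.
  have /card_esym/ppcard_eqP[f] := card_nat2.
  exists (fun k => G (f k).1 (f k).2).
    split=> [k i|]; first exact: (PG (f k).1).1.1.
    move=> t [i _ Ait]; have [j _ Bijt] := (PG i).1.2 _ Ait.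
    by exists (f^-1%FUN (i, j)) => //=; rewrite invK ?inE.
  rewrite -(esum_pred_image V _ xpredT) ?[fun=> _]set_true//.
  by rewrite image_eq.
rewrite (_ : esum _ _ = \sum_(i <oo) \sum_(j <oo) V (i, j)); last first.
  pose J : nat -> set (nat * nat) := fun i => [set (i, j) | j in setT].
  rewrite (_ : setT = \bigcup_k J k); last first.
    by rewrite predeqE => -[a b]; split => // _; exists a => //; exists b.
  rewrite esum_bigcupT //=; last first.
    apply/trivIsetP => i j _ _ ij.
    rewrite predeqE => -[k m] /=; split => //= -[] [_] _ [<-{k} _].
    by move=> [m' _] [] /esym/eqP; rewrite (negbTE ij).
  rewrite -(image_id [set: nat]) -fun_true esum_pred_image//; last first.
    by move=> k _; exact: esum_ge0.
  apply: eq_eseriesr => /= j _.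
  rewrite -(esum_pred_image V (pair j) predT)//=; last first.
    by move=> ? ? _ _; exact: (@can_inj _ _ _ snd).
  by congr esum; rewrite predeqE => -[a b]; split; move=> [i _ <-]; exists i.
apply: lee_nneseries => [m _|m _]; last exact: (PG m).2.
by move=> _; apply: nneseries_ge0 => k _ _; exact: V_ge0.
Qed.

HB.instance Definition _ := isOuterMeasure.Build R 'rV[R]_n.+1 lebesgue_outer
  lebesgue_outer0 lebesgue_outer_ge0 le_lebesgue_outer
  lebesgue_outer_sigma_subadditive.

Definition Rn := caratheodory_type lebesgue_outer.

HB.instance Definition _ := Measurable.on Rn.

Definition lebesgue_Rn (A : set Rn) : \bar R := lebesgue_outer A.

HB.instance Definition _ := isMeasure.Build _ Rn R lebesgue_Rn
  (@caratheodory_measure0 R _ lebesgue_outer)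
  (@caratheodory_measure_ge0 R _ lebesgue_outer)
  (@caratheodory_measure_sigma_additive R _ lebesgue_outer).

End lebesgue_Rn.

(** Infima are taken in [\bar R], where the infimum of the empty set is
    [+oo]. *)

Section variable_exponents.
Context d (T : measurableType d) (R : realType).
Variable mu : {measure set T -> \bar R}.
Local Open Scope ereal_scope.

Definition exponent (p : T -> \bar R) : Prop :=
  measurable_fun [set: T] p /\ (forall x, 1 <= p x).

Definition Omega_infty (p : T -> \bar R) : set T := [set x | p x = +oo].
Definition Omega_0 (p : T -> \bar R) : set T := ~` Omega_infty p.

Definition modular_Lp (p : T -> \bar R) (f : T -> R) : \bar R :=
  \int[mu]_(x in Omega_0 p) (`|f x| `^ fine (p x))%:E
  + Lnorm mu +oo (EFin \o (f \_ (Omega_infty p))).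

Definition in_Lp (p : T -> \bar R) (f : T -> R) : Prop :=
  measurable_fun [set: T] f /\
  exists2 l : R, (0 < l)%R & modular_Lp p (fun x => f x / l)%R < +oo.

(** [l ^ (1/q)] for [l > 0], with [l ^ (1/oo) = 1] *)
Definition root_exponent (l : R) (q : \bar R) : R :=
  if q is r%:E then l `^ r^-1 else 1%R.

Definition modular_lqLp (p q : T -> \bar R) (f : nat -> T -> R) : \bar R :=
  \sum_(nu <oo) ereal_inf [set l%:E | l in
    [set l : R | (0 < l)%R /\
       modular_Lp p (fun x => f nu x / root_exponent l (q x))%R <= 1]].

Definition lqLp (p q : T -> \bar R) : set (nat -> T -> R) :=
  [set f | (forall nu, in_Lp p (f nu)) /\
     exists2 l : R, (0 < l)%R &
       modular_lqLp p q (fun nu x => f nu x / l)%R < +oo].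

Definition norm_lqLp (p q : T -> \bar R) (f : nat -> T -> R) : \bar R :=
  ereal_inf [set m%:E | m in
    [set m : R | (0 < m)%R /\
       modular_lqLp p q (fun nu x => f nu x / m)%R <= 1]].

Definition seq_ae_eq (f g : nat -> T -> R) : Prop :=
  forall nu, \forall x \ae mu, f nu x = g nu x.

End variable_exponents.

(** The elements of a function space are classes modulo equality almost
    everywhere, which are handled through representatives: [S] is the set of
    representatives in the ambient vector space [V], [eqv] the identification
    and [N] the norm, so that definiteness reads [N x = 0 <-> eqv x 0]. *)

Section banach.
Context (R : realType) (V : lmodType R).
Local Open Scope ereal_scope.

Record banach_space (S : set V) (eqv : V -> V -> Prop) (N : V -> \bar R)
    : Prop := BanachSpace {
  banach_zero : S 0%R ;
  banach_add : forall x y, S x -> S y -> S (x + y)%R ;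
  banach_scale : forall (a : R) x, S x -> S (a *: x)%R ;
  banach_norm_ge0 : forall x, S x -> 0 <= N x ;
  banach_norm_fin : forall x, S x -> N x < +oo ;
  banach_norm_eq0 : forall x, S x -> (N x = 0 <-> eqv x 0%R) ;
  banach_normZ : forall (a : R) x, S x -> N (a *: x)%R = `|a|%:E * N x ;
  banach_normD : forall x y, S x -> S y -> N (x + y)%R <= N x + N y ;
  banach_complete : forall u : nat -> V, (forall k, S (u k)) ->
    (forall e : R, (0 < e)%R -> exists K, forall j k,
       (K <= j)%N -> (K <= k)%N -> N (u j - u k)%R < e%:E) ->
    exists2 x, S x & forall e : R, (0 < e)%R -> exists K, forall k,
       (K <= k)%N -> N (u k - x)%R < e%:E }.

Definition uniformly_convex (S : set V) (N : V -> \bar R) : Prop :=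
  forall e : R, (0 < e <= 2)%R ->
  exists2 delta : R, (0 < delta)%R &
    forall x y, S x -> S y -> N x = 1 -> N y = 1 -> e%:E <= N (x - y)%R ->
      N (2^-1 *: (x + y))%R <= (1 - delta)%:E.

End banach.

(* Main.v *)
(** Write [K = 1 / q] and let the level of [f] be the least [l] such that the
    dilation [f / l ^ K] satisfies [\int |f / l ^ K| ^ P <= 1]; the modular of the
    mixed space is the sum of the levels.  The triangle inequality, tested on
    [(f, g, 0, ...)] and [(g, f, 0, ...)], makes the level midpoint convex.

    For an affine [h], let [W l = h l ^ p * l ^ (- p k)] and let [Z] be a primitive
    of [l ^ (c - 1)].  As a function of [Z], [W] is convex wherever the quadratic
    [(p - 1) r ^ 2 + (1 - 2 k - c) r + k (1 - k)] is nonnegative at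
    [r = l h' / h - k].  If the discriminant were positive on two sets of positive
    measure with opposite signs of the linear coefficient, then suitably weighted
    affine families on the two sets would violate the midpoint convexity of the
    level.  Hence a single constant [c] makes the discriminant nonpositive at
    almost all points that an integrable function can see.

    With this common [c] the pointwise convexity inequalities between the levels
    [a], [1] and [2 - a] carry the same weights at every point, so they can be
    integrated.  They are strict, and compactness of the range of the exponents
    makes the gap uniform; when [a] is near [1] the uniform convexity of the powers
    is used instead.  So the level is uniformly convex, the modular inherits
    this by summation, and norm and modular are comparable near the unit sphere. *)

Require Import Defs.
From mathcomp Require Import all_boot all_order all_algebra.
From mathcomp Require Import all_classical all_reals all_analysis.
From mathcomp Require Import measurable_realfun ess_sup_inf ring lra.
Import Order.TTheory GRing.Theory Num.Theory.
Import numFieldNormedType.Exports.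
Local Open Scope classical_set_scope.
Local Open Scope ring_scope.
Set Implicit Arguments.
Unset Strict Implicit.
Unset Printing Implicit Defensive.

(** For constant exponents the level is the [q]-th power of the [L^p] norm. In general it plays the
    role of the norm of [|f|^q] in the space of exponent [p/q], which may be below 1, so its
    convexity is not automatic. Values and level have to vary together: when the levels are [a] and
    [2 - a], the functions are compared after two different dilations. A pointwise inequality for
    the midpoint survives integration only if its weights are the same at all points, although [P]
    and [K] vary; measuring the level in the coordinate [Z] makes the weights depend on [c] and [a]
    alone. At a point [x] the admissible [c] form an interval centred at [1 - 2 K x], of half-width
    [2 sqrt ((P x - 1) K x (1 - K x))]. A common [c] is a one-dimensional Helly statement: intervals
    that are pairwise not separated have a common point. Separation has to be excluded on sets of
    positive measure, and this is what the triangle inequality provides, so the Banach hypothesis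
    becomes pointwise information on the exponents. *)

Section chord.
Context {R : realType}.
Implicit Types (W V Z z v : R -> R) (b m a x y : R).

(** [V] is the derivative of [W] with respect to [Z], so monotonicity of [V] is convexity of [W] in
    the coordinate [Z]. The last two conclusions are the three-point convexity inequality with its
    denominators cleared. *)
Lemma chord_lemma W V Z z b m a : b < m -> m < a ->
  {in `]b, a[, forall x, is_derive x 1 W (z x * V x)} ->
  {in `]b, a[, forall x, is_derive x 1 Z (z x)} ->
  {in `]b, a[, forall x, 0 < z x} ->
  {within `[b, a], continuous W} -> {within `[b, a], continuous Z} ->
  [/\ Z b < Z m, Z m < Z a,
   {in `]b, a[ &, {homo V : x y / x <= y}} ->
   W m * (Z a - Z b) <= W a * (Z m - Z b) + W b * (Z a - Z m) &
   {in `]b, a[ &, {homo V : x y / x < y}} ->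
   W m * (Z a - Z b) < W a * (Z m - Z b) + W b * (Z a - Z m)].
Proof.
move=> bm ma dW dZ z0 cW cZ.
have sub1 : {subset `]m, a[ <= `]b, a[}.
  by move=> x; rewrite !in_itv/= => /andP[mx ->]; rewrite (lt_trans bm mx).
have sub2 : {subset `]b, m[ <= `]b, a[}.
  by move=> x; rewrite !in_itv/= => /andP[-> mx]; rewrite (lt_trans mx ma).
have mba : m \in `]b, a[ by rewrite in_itv/= bm ma.
have cs1 (F : R -> R) : {within `[b, a], continuous F} -> {within `[m, a], continuous F}.
  by apply: continuous_subspaceW; apply: subset_itv; rewrite bnd_simp// ltW.
have cs2 (F : R -> R) : {within `[b, a], continuous F} -> {within `[b, m], continuous F}.
  by apply: continuous_subspaceW; apply: subset_itv; rewrite bnd_simp// ltW.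
have [x xma Zma] := MVT ma (fun x h => dZ _ (sub1 _ h)) (cs1 _ cZ).
have [y ybm Zbm] := MVT bm (fun x h => dZ _ (sub2 _ h)) (cs2 _ cZ).
have Z1 : 0 < Z a - Z m by rewrite Zma mulr_gt0 ?subr_gt0 ?z0 ?sub1.
have Z2 : 0 < Z m - Z b by rewrite Zbm mulr_gt0 ?subr_gt0 ?z0 ?sub2.
(* [W] minus its tangent at [m] in the coordinate [Z]. Its derivative is [z * (V - V m)], so the
   mean value theorem on either side of [m] gives its sign. *)
pose U := W - (V m) \*: Z.
have dU t : t \in `]b, a[ -> is_derive t 1 U (z t * (V t - V m)).
  move=> tI; have wt := dW _ tI; have zt := dZ _ tI.
  by apply: is_derive_eq; rewrite /GRing.scale/=; ring.
have cU : {within `[b, a], continuous U}.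
  move=> t; apply: cvgB; first exact: cW.
  by apply: cvgM; [exact: cvg_cst|exact: cZ].
have [s sma] := MVT ma (fun x h => dU _ (sub1 _ h)) (cs1 _ cU).
have [t tbm] := MVT bm (fun x h => dU _ (sub2 _ h)) (cs2 _ cU).
have UE r : U r = W r - V m * Z r by [].
rewrite !UE => e2 e1.
have sI := sub1 _ sma; have tI := sub2 _ tbm.
have [ms tm] : m < s /\ t < m.
  by move: sma tbm; rewrite !in_itv/= => /andP[-> _] /andP[_ ->].
have a1 : 0 < z s * (a - m) by rewrite mulr_gt0 ?z0 ?subr_gt0.
have a2 : 0 < z t * (m - b) by rewrite mulr_gt0 ?z0 ?subr_gt0.
have {}e1 : W a - W m - V m * (Z a - Z m) = z s * (a - m) * (V s - V m).
  by move: e1; lra.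
have {}e2 : W m - W b - V m * (Z m - Z b) = z t * (m - b) * (V t - V m).
  by move: e2; lra.
rewrite -!(subr_gt0 (Z _)); split => // V_mono.
- have h1 : 0 <= W a - W m - V m * (Z a - Z m).
    by rewrite e1 mulr_ge0 ?subr_ge0 ?(ltW a1)//; apply: (V_mono m s) => //; exact: ltW.
  have h2 : W m - W b - V m * (Z m - Z b) <= 0.
    by rewrite e2 pmulr_rle0// subr_le0; apply: (V_mono t m) => //; exact: ltW.
  by nra.
- have h1 : 0 < W a - W m - V m * (Z a - Z m).
    by rewrite e1 mulr_gt0 ?subr_gt0//; apply: (V_mono m s).
  have h2 : W m - W b - V m * (Z m - Z b) < 0.
    by rewrite e2 pmulr_rlt0// subr_lt0; apply: (V_mono t m).
  by nra.
Qed.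
End chord.

(** * Real powers: continuity, primitives, monotonicity from the derivative *)

Section powR_extra.
Context {R : realType}.
Implicit Types (a b c k p x y : R).

Lemma powR_subr1 x p : 0 < x -> x `^ (p - 1) = x `^ p / x.
Proof.
move=> x0; rewrite powRB ?powRr1 ?(ltW x0)//.
by apply/implyP => _; rewrite gt_eqF.
Qed.

(** The absolute values avoid the default value of [powR] at negative bases, which would break
    continuity at base 0. *)
Lemma cvg_powR (T : Type) (F : set_system T) (f g : T -> R) x p :
  Filter F -> f @ F --> x -> g @ F --> p -> x != 0 \/ 0 < p ->
  (fun t => `|f t| `^ g t) @ F --> `|x| `^ p.
Proof.
move=> FF fx gp xp; have fx' : (fun t => `|f t|) @ F --> `|x| by exact: cvg_norm.
have [x0|x0] := eqVneq x 0.
  have {xp} p0 : 0 < p by case: xp => //; rewrite x0 eqxx.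
  rewrite x0 normr0 powR0 ?gt_eqF//; apply/cvgrPdist_lt => e e0.
  (* Near the limit the exponent is at least [p / 2]; for a base below 1 the power is then at most
     [|f t| ^ (p / 2)], which is below [e] under this threshold. *)
  have e'0 : 0 < Num.min 1 (e `^ (2 / p)) by rewrite lt_min ltr01 powR_gt0.
  near=> t.
  have ft : `|f t| < Num.min 1 (e `^ (2 / p)).
    near: t; move/cvgrPdist_lt : fx => /(_ _ e'0); apply: filterS => t.
    by rewrite x0 sub0r normrN.
  have gt : p / 2 <= g t.
    near: t; have p20 : 0 < p / 2 by rewrite divr_gt0.
    move/cvgrPdist_lt : gp => /(_ _ p20); apply: filterS => t.
    by rewrite ltr_norml => /andP[_]; lra.
  rewrite sub0r normrN ger0_norm ?powR_ge0//.
  move: ft; rewrite lt_min => /andP[f1 fe].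
  apply: (@le_lt_trans _ _ (`|f t| `^ (p / 2))).
    have [->|f0] := eqVneq (f t) 0.
      by rewrite normr0 !powR0 ?gt_eqF// ?(lt_le_trans _ gt) ?divr_gt0.
    by apply: ger_powR => //; rewrite normr_gt0 f0 ltW.
  have -> : e = (e `^ (2 / p)) `^ (p / 2).
    by rewrite -powRrM (_ : _ * _ = 1) ?powRr1 ?ltW//; field; rewrite gt_eqF.
  by apply: gt0_ltr_powR; rewrite ?nnegrE ?powR_ge0 ?divr_gt0.
rewrite /powR normr_eq0 (negbTE x0).
apply: (@cvg_trans _ ((fun t => expR (g t * ln `|f t|)) @ F)).
  apply: near_eq_cvg; near=> t; rewrite normr_eq0 ifF//.
  apply/negbTE; near: t.
  have nx0 : 0 < `|x| by rewrite normr_gt0.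
  move/cvgrPdist_lt : fx => /(_ _ nx0); apply: filterS => t.
  by apply: contraTneq => ->; rewrite subr0 ltxx.
apply: (@cvg_comp _ _ _ _ expR _ (nbhs (p * ln `|x|))); last exact: continuous_expR.
apply: cvgM => //; apply: (cvg_comp (fun t => `|f t|) (@ln R) (G := nbhs `|x|)) => //.
by apply: continuous_ln; rewrite normr_gt0.
Unshelve. all: by end_near. Qed.

(* A primitive of [x `^ (c - 1)] on the positive half-line. *)
Definition powR_primitive c x := if c == 0 then ln x else x `^ c / c.

Lemma is_derive_powR_primitive c x : 0 < x ->
  is_derive x 1 (powR_primitive c) (x `^ (c - 1)).
Proof.
move=> x0; rewrite /powR_primitive; have [->|c0] := eqVneq c 0.
  by rewrite sub0r powRN powRr1 ?ltW//; exact: is_derive1_ln.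
have h := is_derive1_powR c x0.
rewrite (_ : (fun y => y `^ c / c) = c^-1 \*: (@powR R ^~ c)); last first.
  by apply/funext => y /=; rewrite /GRing.scale/= mulrC.
by apply: is_derive_eq; rewrite /GRing.scale/= mulrA mulVf// mul1r.
Qed.

Lemma continuous_powR_primitive c x : 0 < x -> {for x, continuous (powR_primitive c)}.
Proof.
move=> x0; have [+ _] := is_derive_powR_primitive c x0.
by move=> /derivable1_diffP /differentiable_continuous.
Qed.

Lemma derive_ge0_incr (V v : R -> R) b a :
  {in `]b, a[, forall x, is_derive x 1 V (v x)} ->
  {in `]b, a[, forall x, 0 <= v x} ->
  {in `]b, a[ &, {homo V : x y / x <= y}}.
Proof.
move=> dV v0 x y xI yI; rewrite le_eqVlt => /predU1P[->//|xy].
have sub t : t \in `[x, y] -> t \in `]b, a[.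
  move: xI yI; rewrite !in_itv/= => /andP[bx _] /andP[_ ya] /andP[xt ty].
  by rewrite (lt_le_trans bx xt) (le_lt_trans ty ya).
have [|t|t tI] := @MVT R V v x y xy.
- by move=> t tI; apply: dV; apply: sub; apply: subset_itv_oo_cc.
- apply: continuous_in_subspaceT => {}t; rewrite inE/= => /sub tI.
  by have [/derivable1_diffP/differentiable_continuous] := dV _ tI.
- move=> e; rewrite -subr_ge0 e mulr_ge0 ?subr_ge0 ?(ltW xy)//.
  by rewrite v0// sub//; exact: subset_itv_oo_cc.
Qed.

(** If the mean value point [u] has [v u = 0], a second mean value point between [x] and [u] has a
    nonzero derivative. This form fits a quadratic with zero discriminant, which may vanish once
    along a line. *)
Lemma derive_one_zero_incr (V v : R -> R) b a :
  {in `]b, a[, forall x, is_derive x 1 V (v x)} ->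
  {in `]b, a[, forall x, 0 <= v x} ->
  {in `]b, a[ &, forall x y, x < y -> v x = 0 -> v y <> 0} ->
  {in `]b, a[ &, {homo V : x y / x < y}}.
Proof.
move=> dV v0 vN x y xI yI xy.
have V_le := derive_ge0_incr dV v0.
have sub s t : s \in `]b, a[ -> t \in `]b, a[ -> forall u, u \in `[s, t] -> u \in `]b, a[.
  move=> sI tI u.
  move: sI tI; rewrite !in_itv/= => /andP[bx _] /andP[_ ya] /andP[xt ty].
  by rewrite (lt_le_trans bx xt) (le_lt_trans ty ya).
have mvt s t : s \in `]b, a[ -> t \in `]b, a[ -> s < t ->
    exists2 u, u \in `]s, t[ & V t - V s = v u * (t - s).
  move=> sI tI st; apply: MVT => //.
    by move=> u uI; apply: dV; apply: sub (subset_itv_oo_cc uI).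
  apply: continuous_in_subspaceT => u; rewrite inE/= => /(sub _ _ sI tI) uI.
  by have [/derivable1_diffP/differentiable_continuous] := dV _ uI.
have [u uI e] := mvt _ _ xI yI xy.
have uba := sub _ _ xI yI _ (subset_itv_oo_cc uI).
have [vu|vu] := eqVneq (v u) 0; last first.
  by rewrite -subr_gt0 e mulr_gt0 ?subr_gt0// lt_neqAle eq_sym vu v0.
move: (uI); rewrite in_itv/= => /andP[xu uy].
apply: (@lt_le_trans _ _ (V u)); last by apply: V_le => //; exact: ltW.
have [w wI ew] := mvt _ _ xI uba xu.
have wba := sub _ _ xI uba _ (subset_itv_oo_cc wI).
rewrite -subr_gt0 ew mulr_gt0 ?subr_gt0// lt_neqAle eq_sym v0// andbT.
apply/eqP => vw; apply: (vN _ _ wba uba _ vw vu).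
by move: wI; rewrite in_itv/= => /andP[].
Qed.
End powR_extra.

(** * Affine families: [wpow] in the coordinate [powR_primitive c] *)

Section power_line.
Context {R : realType}.
Implicit Types (x y : R).

Definition quad (p k c r : R) : R :=
  (p - 1) * r ^+ 2 + (1 - 2 * k - c) * r + k * (1 - k).

Variables p k c al be : R.
Hypothesis p1 : 1 < p.

Let h x := al + be * x.
Definition wpow x := h x `^ p * x `^ (- (p * k)).
(** The logarithmic derivative of [h x / x ^ k], multiplied by [x]; its sign is the sign of the
    derivative of [wpow]. *)
Definition wslope x := be * x / h x - k.
(** [V] is the derivative of [wpow] with respect to [powR_primitive c], and [v] is the derivative of
    [V]: a positive factor times [quad]. *)
Let V x := p * wslope x * (wpow x * x `^ (- c)).
Let v x := p * wpow x * x `^ (- c - 1) * quad p k c (wslope x).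

Lemma is_derive_wpow x : 0 < x -> 0 < h x ->
  is_derive x 1 wpow (x `^ (c - 1) * V x).
Proof.
move=> x0 hx0.
have dh : is_derive x 1 h be.
  have -> : h = cst al + be \*: id by apply/funext.
  by apply: is_derive_eq; rewrite add0r /GRing.scale/= mulr1.
have d1 : is_derive x 1 (@powR R ^~ p \o h) (p * h x `^ (p - 1) * be).
  by apply: is_derive1_comp; exact: is_derive1_powR.
have d2 := is_derive1_powR (- (p * k)) x0.
have -> : wpow = (@powR R ^~ p \o h) * (@powR R ^~ (- (p * k))) by [].
apply: is_derive_eq; rewrite /GRing.scale/= /V /wpow /wslope !powR_subr1//.
rewrite (powRN x c); field.
by rewrite !gt_eqF// powR_gt0.
Qed.

Lemma is_derive_wslope x : 0 < x -> 0 < h x ->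
  is_derive x 1 wslope (be * al / h x ^+ 2).
Proof.
move=> x0 hx0.
have dh : is_derive x 1 h be.
  have -> : h = cst al + be \*: id by apply/funext.
  by apply: is_derive_eq; rewrite add0r /GRing.scale/= mulr1.
have hN0 : h x != 0 by rewrite gt_eqF.
have d1 := is_deriveV hN0 dh.
have -> : wslope = (be \*: id) * (fun y => (h y)^-1) + cst (- k) by apply/funext.
apply: is_derive_eq; rewrite /GRing.scale/= /h -[be *: x]/(be * x); field.
exact: hN0.
Qed.

Lemma is_derive_V x : 0 < x -> 0 < h x -> is_derive x 1 V (v x).
Proof.
move=> x0 hx0.
have d1 := is_derive_wpow x0 hx0.
have d2 := is_derive_wslope x0 hx0.
have d3 := is_derive1_powR (- c) x0.
have -> : V = (p \*: wslope) * (wpow * (@powR R ^~ (- c))) by [].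
apply: is_derive_eq; rewrite /GRing.scale/= /v /V.
rewrite !powR_subr1// (powRN x c) /quad /wslope.
have xc := powR_gt0 c x0.
have hh : h x = al + be * x by [].
rewrite hh -[p *: _]/(p * _) -[(wpow * _) x]/(wpow x * x `^ (- c)) (powRN x c); field.
by rewrite -hh !gt_eqF.
Qed.

Section wpow_chord.
Variables b m a : R.
Hypotheses (b0 : 0 < b) (bm : b < m) (ma : m < a).
Hypotheses (hb : 0 <= h b) (ha : 0 <= h a) (hba : 0 < h b + h a).

Let h_gt0 x : x \in `]b, a[ -> 0 < h x.
Proof.
rewrite in_itv/= => /andP[bx xa]; move: hb ha hba; rewrite /h => h1 h2 h3.
suff : 0 < (a - b) * (al + be * x) by rewrite pmulr_rgt0// subr_gt0 (lt_trans bm ma).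
have -> : (a - b) * (al + be * x) = (a - x) * (al + be * b) + (x - b) * (al + be * a).
  by ring.
have ax : 0 < a - x by rewrite subr_gt0.
have xb : 0 < x - b by rewrite subr_gt0.
move: h1; rewrite le_eqVlt => /predU1P[h1|h1].
  by rewrite -h1 mulr0 add0r mulr_gt0//; move: h3; rewrite -h1 add0r.
by rewrite ltr_wpDr ?mulr_gt0// mulr_ge0// ltW.
Qed.

Let gt0_itv x : x \in `]b, a[ -> 0 < x.
Proof. by rewrite in_itv/= => /andP[/(lt_trans b0)]. Qed.

Let cwpow : {within `[b, a], continuous wpow}.
Proof.
(* At an endpoint [h] may vanish, where [is_derive_wpow] does not apply; continuity there comes from
   [cvg_powR] with the positive exponent [p]. *)
apply: (@subspace_eq_continuous _ `[b, a] _
   (fun x => `|h x| `^ p * `|x| `^ (- (p * k)))).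
  move=> x; rewrite inE/= in_itv/= => /andP[bx xa].
  rewrite /wpow /from_subspace ger0_norm ?(@ger0_norm _ x)//.
    by rewrite (le_trans _ bx)// ltW.
  move: hb ha; rewrite /h => h1 h2.
  suff : 0 <= (a - b) * (al + be * x).
    by rewrite pmulr_rge0// subr_gt0 (lt_trans bm ma).
  have -> : (a - b) * (al + be * x) = (a - x) * (al + be * b) + (x - b) * (al + be * a).
    by ring.
  by rewrite addr_ge0// mulr_ge0// subr_ge0.
apply: continuous_in_subspaceT => x; rewrite inE/= in_itv/= => /andP[bx xa].
have x0 : 0 < x by exact: lt_le_trans bx.
apply: cvgM.
  apply: cvg_powR; [|exact: cvg_cst|right; exact: lt_trans p1].
  by apply: cvgD; [exact: cvg_cst|apply: cvgM; [exact: cvg_cst|exact: cvg_id]].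
apply: (@cvg_trans _ ((fun y => y `^ (- (p * k))) @ x)).
  apply: near_eq_cvg; near=> y; rewrite gtr0_norm//.
  by near: y; exact: lt_nbhsr.
rewrite gtr0_norm//.
by have [/derivable1_diffP/differentiable_continuous] := is_derive1_powR (- (p * k)) x0.
Unshelve. all: by end_near. Qed.

Let z_gt0 x : x \in `]b, a[ -> 0 < x `^ (c - 1).
Proof. by move=> /gt0_itv/powR_gt0. Qed.

Let cZ : {within `[b, a], continuous (powR_primitive c)}.
Proof.
apply: continuous_in_subspaceT => x; rewrite inE/= in_itv/= => /andP[bx xa].
by apply: continuous_powR_primitive; exact: lt_le_trans bx.
Qed.

Let dZ : {in `]b, a[, forall x, is_derive x 1 (powR_primitive c) (x `^ (c - 1))}.
Proof. by move=> x /gt0_itv; exact: is_derive_powR_primitive. Qed.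

Let dW : {in `]b, a[, forall x, is_derive x 1 wpow (x `^ (c - 1) * V x)}.
Proof. by move=> x xI; apply: is_derive_wpow; [exact: gt0_itv|exact: h_gt0]. Qed.

Let dV : {in `]b, a[, forall x, is_derive x 1 V (v x)}.
Proof. by move=> x xI; apply: is_derive_V; [exact: gt0_itv|exact: h_gt0]. Qed.

Let wpow_gt0 x : x \in `]b, a[ -> 0 < wpow x.
Proof.
by move=> xI; rewrite /wpow mulr_gt0// powR_gt0 ?h_gt0// gt0_itv.
Qed.

Let pw_gt0 x : x \in `]b, a[ -> 0 < p * wpow x * x `^ (- c - 1).
Proof.
move=> xI; have p0 : 0 < p by exact: lt_trans p1.
by apply: mulr_gt0; [rewrite mulr_gt0 ?wpow_gt0|rewrite powR_gt0 ?gt0_itv].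
Qed.

Let Z := powR_primitive c.

Lemma wpow_chord_le : {in `]b, a[, forall x, 0 <= quad p k c (wslope x)} ->
  wpow m * (Z a - Z b) <= wpow a * (Z m - Z b) + wpow b * (Z a - Z m).
Proof.
move=> q0; have [_ _ + _] := chord_lemma bm ma dW dZ z_gt0 cwpow cZ.
apply; apply: derive_ge0_incr dV _ => x xI.
by rewrite mulr_ge0 ?q0// ltW// pw_gt0.
Qed.

Lemma wpow_chord_lt : {in `]b, a[, forall x, 0 <= quad p k c (wslope x)} ->
  {in `]b, a[ &, forall x y, x < y ->
     quad p k c (wslope x) = 0 -> quad p k c (wslope y) <> 0} ->
  wpow m * (Z a - Z b) < wpow a * (Z m - Z b) + wpow b * (Z a - Z m).
Proof.
move=> q0 qN0; have [_ _ _] := chord_lemma bm ma dW dZ z_gt0 cwpow cZ.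
apply; apply: derive_one_zero_incr dV _ _ => [x xI|x y xI yI xy].
  by rewrite mulr_ge0 ?q0// ltW// pw_gt0.
rewrite /v => /eqP; rewrite mulf_eq0 gt_eqF ?pw_gt0//= => /eqP vx.
move=> /eqP; rewrite mulf_eq0 gt_eqF ?pw_gt0//= => /eqP vy.
exact: qN0 vx vy.
Qed.

(** The chord lemma for [- wpow]. It serves on the sets where the discriminant is positive and
    [wpow] is strictly concave near 1. *)
Lemma wpow_chord_gt : {in `]b, a[, forall x, quad p k c (wslope x) < 0} ->
  wpow a * (Z m - Z b) + wpow b * (Z a - Z m) < wpow m * (Z a - Z b).
Proof.
move=> q0.
have dNW : {in `]b, a[, forall x, is_derive x 1 (- wpow) (x `^ (c - 1) * (- V) x)}.
  by move=> x xI; rewrite mulrN; apply: is_deriveN; exact: dW.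
have cNW : {within `[b, a], continuous (- wpow)}.
  by move=> x; apply: cvgN; exact: cwpow.
have dNV : {in `]b, a[, forall x, is_derive x 1 (- V) (- v x)}.
  by move=> x xI; apply: is_deriveN; exact: dV.
have vN x : x \in `]b, a[ -> 0 < - v x.
  by move=> xI; rewrite oppr_gt0 /v pmulr_rlt0 ?pw_gt0 ?q0.
have [_ _ _] := chord_lemma bm ma dNW dZ z_gt0 cNW cZ.
rewrite /= !mulNr -opprD ltrN2; apply.
apply: derive_one_zero_incr dNV _ _ => [x /vN/ltW//|x y xI yI xy v0].
by have := vN _ xI; rewrite v0 ltxx.
Qed.

Lemma powR_primitive_chord : Z b < Z m /\ Z m < Z a.
Proof. by have [] := chord_lemma bm ma dW dZ z_gt0 cwpow cZ. Qed.

Lemma wpow_decr : {in `]b, a[, forall x, wslope x < 0} -> wpow a < wpow b.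
Proof.
move=> r0; have [x xI] := MVT (lt_trans bm ma) dW cwpow.
rewrite -subr_lt0 => ->; rewrite pmulr_llt0 ?subr_gt0 ?(lt_trans bm ma)//.
rewrite pmulr_rlt0 ?z_gt0// /V pmulr_llt0.
  by rewrite pmulr_rlt0 ?r0// (lt_trans _ p1).
by rewrite mulr_gt0 ?wpow_gt0 ?powR_gt0 ?gt0_itv.
Qed.

Lemma wpow_incr : {in `]b, a[, forall x, 0 < wslope x} -> wpow b < wpow a.
Proof.
move=> r0; have [x xI] := MVT (lt_trans bm ma) dW cwpow.
rewrite -subr_gt0 => ->; rewrite pmulr_lgt0 ?subr_gt0 ?(lt_trans bm ma)//.
rewrite pmulr_rgt0 ?z_gt0// /V pmulr_lgt0.
  by rewrite pmulr_rgt0 ?r0// (lt_trans _ p1).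
by rewrite mulr_gt0 ?wpow_gt0 ?powR_gt0 ?gt0_itv.
Qed.
End wpow_chord.
End power_line.

(** * The pointwise midpoint inequality under the discriminant condition *)

Section pointwise.
Context {R : realType}.
Implicit Types (p k c a b X Y : R).

(* The discriminant of [quad p k c] is nonpositive. *)
Definition disc_le p k c := (1 - 2 * k - c) ^+ 2 <= 4 * ((p - 1) * (k * (1 - k))).

Lemma disc_le_quad_ge0 p k c r : 1 < p -> disc_le p k c -> 0 <= quad p k c r.
Proof.
rewrite /disc_le /quad => p1 dle.
(* Completing the square: [4 (p - 1)] times [quad] is a square minus the discriminant. *)
rewrite -(@pmulr_rge0 _ (4 * (p - 1))) ?mulr_gt0 ?subr_gt0//.
have := sqr_ge0 (2 * (p - 1) * r + (1 - 2 * k - c)).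
by nra.
Qed.

(** At a root the square of the derivative equals the discriminant, so here the derivative vanishes
    and every root is the vertex. *)
Lemma disc_le_quad_inj p k c r s : 1 < p -> disc_le p k c ->
  quad p k c r = 0 -> quad p k c s = 0 -> r = s.
Proof.
rewrite /disc_le /quad => p1 dle q1 q2.
have root t : (p - 1) * t ^+ 2 + (1 - 2 * k - c) * t + k * (1 - k) = 0 ->
    2 * (p - 1) * t + (1 - 2 * k - c) = 0.
  move=> qt; apply/eqP; rewrite -sqrf_eq0 eq_le sqr_ge0 andbT.
  have : 4 * (p - 1) * ((p - 1) * t ^+ 2 + (1 - 2 * k - c) * t + k * (1 - k)) = 0.
    by rewrite qt mulr0.
  by nra.
apply: (@mulfI _ (2 * (p - 1))); first by rewrite mulf_neq0 ?subr_eq0 ?gt_eqF.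
by apply: (addIr (1 - 2 * k - c)); rewrite !root.
Qed.

(* The weight of the endpoint [a] when [1] is written as a convex combination of
   [a] and [2 - a] in the coordinate [powR_primitive c].  It depends on neither
   [p] nor [k], so [midpoint_le] can be integrated over points with different
   exponents. *)
Definition theta c a : R :=
  let Z := powR_primitive c in (Z 1 - Z (2 - a)) / (Z a - Z (2 - a)).

Section line.
Variables p k c a X Y : R.
Hypotheses (p1 : 1 < p) (a1 : 1 < a) (a2 : a < 2) (X0 : 0 <= X) (Y0 : 0 <= Y).
Hypothesis dle : disc_le p k c.
Let b : R := 2 - a.
(** [X] and [Y] stand for the values of two functions dilated by their levels [a] and [b], so [f]
    and [g] are the original values. [al + be * x] interpolates them; [wpow] is then [X ^ p] at [a],
    [Y ^ p] at [b], and the power of the midpoint at 1. *)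
Let f := a `^ k * X.
Let g := b `^ k * Y.
Let al := (a * g - b * f) / (a - b).
Let be := (f - g) / (a - b).

Let b0 : 0 < b. Proof. by rewrite subr_gt0. Qed.
Let b1 : b < 1. Proof. rewrite /b. by have := a1; lra. Qed.
Let ba : b < a. Proof. rewrite /b. by have := a1; lra. Qed.
Let ab0 : a - b != 0. Proof. by rewrite subr_eq0 gt_eqF// ba. Qed.
Let a0 : 0 < a. Proof. exact: lt_trans a1. Qed.

Let ha : al + be * a = f. Proof. by rewrite /al /be; field. Qed.
Let hb : al + be * b = g. Proof. by rewrite /al /be; field. Qed.
Let h1 : al + be * 1 = (f + g) / 2.
Proof. by rewrite /al /be; move: ab0; rewrite /b => ?; field. Qed.

Let f0 : 0 <= f. Proof. by rewrite mulr_ge0 ?powR_ge0. Qed.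
Let g0 : 0 <= g. Proof. by rewrite mulr_ge0 ?powR_ge0. Qed.

Let wa : wpow p k al be a = X `^ p.
Proof.
rewrite /wpow ha /f powRM ?powR_ge0// -powRrM mulrAC -powRD; last first.
  by apply/implyP => _; rewrite gt_eqF.
by rewrite (mulrC k) subrr powRr0 mul1r.
Qed.

Let wb : wpow p k al be b = Y `^ p.
Proof.
rewrite /wpow hb /g powRM ?powR_ge0// -powRrM mulrAC -powRD; last first.
  by apply/implyP => _; rewrite gt_eqF.
by rewrite (mulrC k) subrr powRr0 mul1r.
Qed.

Let w1 : wpow p k al be 1 = ((f + g) / 2) `^ p.
Proof. by rewrite /wpow h1 powR1 mulr1. Qed.

Let Z := powR_primitive c.

Lemma theta_chord : Z b < Z 1 /\ Z 1 < Z a.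
Proof.
apply: (@powR_primitive_chord R p k c 1 0 p1 b 1 a b0 b1 a1) => //; lra.
Qed.

Lemma theta_gt0 : 0 < theta c a.
Proof.
have [z1 z2] := theta_chord.
by rewrite /theta divr_gt0 ?subr_gt0// (lt_trans z1 z2).
Qed.

Lemma theta_lt1 : theta c a < 1.
Proof.
have [z1 z2] := theta_chord.
by rewrite /theta ltr_pdivrMr ?subr_gt0 ?(lt_trans z1 z2)// mul1r ltrD2r.
Qed.

Let thE w : (theta c a * X `^ p + (1 - theta c a) * Y `^ p - w) * (Z a - Z b) =
  X `^ p * (Z 1 - Z b) + Y `^ p * (Z a - Z 1) - w * (Z a - Z b).
Proof.
have [z1 z2] := theta_chord; rewrite /theta -/Z -/b.
field; by rewrite subr_eq0 gt_eqF// (lt_trans z1 z2).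
Qed.

Let fg : 0 < X + Y -> 0 < al + be * b + (al + be * a).
Proof.
rewrite ha hb /f /g => XY.
have ak : 0 < a `^ k by rewrite powR_gt0.
have bk : 0 < b `^ k by rewrite powR_gt0.
have [x0|x0] := ltP 0 X.
  by apply: ltr_wpDl; [exact: g0|rewrite mulr_gt0].
apply: ltr_pwDl; last exact: f0.
by rewrite mulr_gt0//; have := XY; lra.
Qed.

(** Convexity of [wpow] in [Z] at [b < 1 < a]. The point 1 is the midpoint in the level variable,
    but carries the weights [theta] and [1 - theta] in [Z]. The case [X = Y = 0] is separate because
    the line must be positive inside the interval. *)
Lemma midpoint_le :
  ((a `^ k * X + (2 - a) `^ k * Y) / 2) `^ p <=
  theta c a * X `^ p + (1 - theta c a) * Y `^ p.
Proof.
have [z1 z2] := theta_chord.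
have : 0 <= X + Y by rewrite addr_ge0.
rewrite le_eqVlt => /predU1P[XY|XY].
  have [-> ->] : X = 0 /\ Y = 0.
    by split; have := X0; have := Y0; lra.
  by rewrite !mulr0 addr0 mul0r powR0 ?gt_eqF ?(lt_trans _ p1)// !mulr0 addr0.
rewrite -subr_ge0 -(@pmulr_lge0 _ (Z a - Z b)) ?subr_gt0 ?(lt_trans z1 z2)//.
rewrite thE subr_ge0 -/b -/f -/g -w1 -wa -wb.
apply: wpow_chord_le => //; rewrite ?ha ?hb//; first by rewrite -ha -hb fg.
by move=> x _; exact: disc_le_quad_ge0.
Qed.

(** Strictness can fail only if [quad] vanishes at two points of the segment. Its root is unique, so
    the slope is constant there, which means [al * be = 0]. If [be = 0] the slope is [- k] and
    [quad] is [k (p k + c)]; if [al = 0] the slope is [1 - k] and [quad] is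
    [(1 - k) (p (1 - k) - c)]. The two disjunctions exclude these cases. *)
Lemma midpoint_lt : 0 < X + Y ->
  a `^ k * X <> (2 - a) `^ k * Y \/ 0 < k * (p * k + c) ->
  a * ((2 - a) `^ k * Y) <> (2 - a) * (a `^ k * X) \/
    0 < (1 - k) * (p * (1 - k) - c) ->
  ((a `^ k * X + (2 - a) `^ k * Y) / 2) `^ p <
  theta c a * X `^ p + (1 - theta c a) * Y `^ p.
Proof.
rewrite -/b -/f -/g => XY bN aN; have [z1 z2] := theta_chord.
rewrite -subr_gt0 -(@pmulr_lgt0 _ (Z a - Z b)) ?subr_gt0 ?(lt_trans z1 z2)//.
rewrite thE subr_gt0 -w1 -wa -wb.
have h0 : 0 < al + be * b + (al + be * a) by exact: fg.
apply: wpow_chord_lt => //; rewrite ?ha ?hb//.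
  by move=> x _; exact: disc_le_quad_ge0.
move=> x y xI yI xy qx qy; have := disc_le_quad_inj p1 dle qx qy.
have hgt t : t \in `]b, a[ -> 0 < al + be * t.
  rewrite in_itv/= => /andP[bt ta].
  have e : (a - b) * (al + be * t) = (a - t) * g + (t - b) * f.
    by rewrite -ha -hb; ring.
  have : 0 < (a - b) * (al + be * t).
    have at0 : 0 < a - t by rewrite subr_gt0.
    have tb0 : 0 < t - b by rewrite subr_gt0.
    rewrite e; have [g1|g1] := ltP 0 g.
      by apply: ltr_pwDl; [rewrite mulr_gt0|rewrite mulr_ge0// ltW].
    apply: ltr_wpDl; first by rewrite mulr_ge0// ltW.
    by rewrite mulr_gt0//; move: h0; rewrite ha hb; have := g1; lra.
  by rewrite pmulr_rgt0// subr_gt0.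
have hx := hgt _ xI; have hy := hgt _ yI.
rewrite /wslope => /(congr1 (fun t => (t + k) * (al + be * x) * (al + be * y))).
rewrite !subrK divfK ?gt_eqF// [in RHS]mulrAC divfK ?gt_eqF// => e.
have : al * be * (x - y) = 0 by rewrite -[RHS](subrr (be * y * (al + be * x))) -{1}e; ring.
move/eqP; rewrite mulf_eq0 (subr_eq0 x) (lt_eqF xy) orbF mulf_eq0 => /orP[] /eqP e0.
- case: aN => [|qN].
    by apply; apply/eqP; rewrite -subr_eq0; move/eqP: e0; rewrite /al mulf_eq0 invr_eq0 (negbTE ab0) orbF.
  move: qx; rewrite /wslope e0 add0r divff; last by move: hx; rewrite e0 add0r => /gt_eqF ->.
  by rewrite /quad => qx; move: qN; lra.
- case: bN => [|qN].
    by apply; apply/eqP; rewrite -subr_eq0; move/eqP: e0; rewrite /be mulf_eq0 invr_eq0 (negbTE ab0) orbF.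
  move: qx; rewrite /wslope e0 mul0r mul0r sub0r.
  by rewrite /quad => qx; move: qN; lra.
Qed.
End line.
End pointwise.

(** * From strict inequality to a uniform gap by compactness *)

Section gap.
Context {R : realType}.
Implicit Types (p k c a X Y : R).

(** For [c >= 0] the constant line is excluded by [p k + c > 0]. A line through the origin would
    give [a ^ (1 - k) * Y = (2 - a) ^ (1 - k) * X], hence [X > Y]. *)
Lemma midpoint_lt_ge0 p k c a X Y : 1 < p -> 0 < k < 1 -> disc_le p k c ->
  1 < a -> a < 2 -> 0 <= c -> 0 <= X -> X <= Y -> 0 < X + Y ->
  ((a `^ k * X + (2 - a) `^ k * Y) / 2) `^ p <
  theta c a * X `^ p + (1 - theta c a) * Y `^ p.
Proof.
move=> p1 /andP[k0 k1] dle a1 a2 c0 X0 XY XY0.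
have Y0 : 0 < Y by lra.
have p0 : 0 < p by lra.
apply: midpoint_lt => //; first exact: ltW.
  by right; rewrite mulr_gt0// ltr_wpDr// mulr_gt0.
left => /eqP; apply/negP; rewrite gt_eqF//.
have ak : 0 < a `^ k by rewrite powR_gt0//; lra.
have b0 : 0 < 2 - a by lra.
apply: (@le_lt_trans _ _ ((2 - a) * (a `^ k * Y))).
  by rewrite ler_pM2l// ler_pM2l.
rewrite !mulrA ltr_pM2r//.
have e x : 0 < x -> x = x `^ k * x `^ (1 - k).
  move=> x0; rewrite -powRD ?(addrC k) ?subrK ?powRr1 ?(ltW x0)//.
  by apply/implyP => _; rewrite gt_eqF.
rewrite [ltLHS](_ : _ = ((2 - a) `^ k * a `^ k) * (2 - a) `^ (1 - k)); last first.
  by rewrite {1}(e (2 - a))//; ring.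
rewrite [ltRHS](_ : _ = ((2 - a) `^ k * a `^ k) * a `^ (1 - k)); last first.
  by rewrite {1}(e a); [ring|lra].
rewrite ltr_pM2l; first by apply: gt0_ltr_powR; rewrite ?nnegrE; lra.
by rewrite mulr_gt0// powR_gt0.
Qed.

(** For [c <= 0] the line through the origin is excluded by [p (1 - k) > c]. A constant line would
    give [a ^ k * X = (2 - a) ^ k * Y], hence [X < Y]. *)
Lemma midpoint_lt_le0 p k c a X Y : 1 < p -> 0 < k < 1 -> disc_le p k c ->
  1 < a -> a < 2 -> c <= 0 -> 0 <= Y -> Y <= X -> 0 < X + Y ->
  ((a `^ k * X + (2 - a) `^ k * Y) / 2) `^ p <
  theta c a * X `^ p + (1 - theta c a) * Y `^ p.
Proof.
move=> p1 /andP[k0 k1] dle a1 a2 c0 Y0 YX XY0.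
have X0 : 0 < X by lra.
have p0 : 0 < p by lra.
apply: midpoint_lt => //; first exact: ltW.
  left => /eqP; apply/negP; rewrite gt_eqF//.
  apply: (@le_lt_trans _ _ ((2 - a) `^ k * X)).
    by rewrite ler_pM2l// powR_gt0; lra.
  by rewrite ltr_pM2r// gt0_ltr_powR ?nnegrE; lra.
right; rewrite mulr_gt0 ?subr_gt0// (le_lt_trans c0)// mulr_gt0// subr_gt0//.
Qed.

(** With [k = 0] and [c = 1] the coordinate [Z] is linear and this is strict convexity of the power.
    Stated in this form, it lets the same compactness argument yield the classical uniform convexity
    of powers. *)
Lemma midpoint_lt_k0 p a X Y : 1 < p -> 1 < a -> a < 2 -> 0 <= X -> X < Y ->
  ((a `^ 0 * X + (2 - a) `^ 0 * Y) / 2) `^ p <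
  theta 1 a * X `^ p + (1 - theta 1 a) * Y `^ p.
Proof.
move=> p1 a1 a2 X0 XY; apply: midpoint_lt => //; [lra| | lra | |].
- by rewrite /disc_le; lra.
- by left; rewrite !powRr0 !mul1r => e; move: XY; rewrite e ltxx.
- by right; lra.
Qed.

(** The defect in [midpoint_le] at [Y = 1 - X]: both sides are homogeneous of degree [p] in
    [(X, Y)], so the general case reduces to [X + Y = 1]. *)
Definition gapfun c (t : (R * R) * (R * R)) : R :=
  let: ((p, k), (a, X)) := t in
  theta c a * X `^ p + (1 - theta c a) * (1 - X) `^ p
  - ((a `^ k * X + (2 - a) `^ k * (1 - X)) / 2) `^ p.

Arguments gapfun : simpl never.

Lemma continuous_theta c a : 1 < a -> a < 2 -> {for a, continuous (theta c)}.
Proof.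
move=> a1 a2; have a0 : 0 < a by lra.
have b0 : 0 < 2 - a by lra.
have cb : (fun x => powR_primitive c (2 - x)) @ a --> powR_primitive c (2 - a).
  apply: (cvg_comp (fun x => 2 - x) (powR_primitive c) (G := nbhs (2 - a))).
    by apply: cvgB; [exact: cvg_cst|exact: cvg_id].
  exact: continuous_powR_primitive.
have p2 : (1 : R) < 2 by rewrite ltr1n.
have [z1 z2] := @theta_chord R 2 0 c a p2 a1 a2.
apply: cvgM; first by apply: cvgB => //; exact: cvg_cst.
apply: cvgV; first by rewrite subr_eq0 gt_eqF// (lt_trans z1).
by apply: cvgB => //; exact: continuous_powR_primitive.
Qed.

Lemma continuous_gapfun c (t : (R * R) * (R * R)) :
  1 < t.1.1 -> 1 < t.2.1 -> t.2.1 < 2 -> 0 <= t.2.2 <= 1 ->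
  gapfun c s @[s --> within [set s | 0 < s.2.1 < 2 /\ 0 <= s.2.2 <= 1] (nbhs t)]
    --> gapfun c t.
Proof.
case: t => [[p k] [a X]] /= p1 a1 a2 /andP[X0 X1].
have a0 : 0 < a by lra.
have b0 : 0 < 2 - a by lra.
set F := within _ _.
have FF : Filter F by exact: within_filter.
have cp : (fun s : (R * R) * (R * R) => s.1.1) @ F --> p.
  apply: cvg_within_filter.
  by apply: (cvg_comp (fun s : (R * R) * (R * R) => s.1) fst (G := nbhs (p, k))); exact: cvg_fst.
have ck : (fun s : (R * R) * (R * R) => s.1.2) @ F --> k.
  apply: cvg_within_filter.
  by apply: (cvg_comp (fun s : (R * R) * (R * R) => s.1) snd (G := nbhs (p, k))); [exact: cvg_fst|exact: cvg_snd].
have ca : (fun s : (R * R) * (R * R) => s.2.1) @ F --> a.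
  apply: cvg_within_filter.
  by apply: (cvg_comp (fun s : (R * R) * (R * R) => s.2) fst (G := nbhs (a, X))); [exact: cvg_snd|exact: cvg_fst].
have cX : (fun s : (R * R) * (R * R) => s.2.2) @ F --> X.
  apply: cvg_within_filter.
  by apply: (cvg_comp (fun s : (R * R) * (R * R) => s.2) snd (G := nbhs (a, X))); exact: cvg_snd.
have cth : (fun s : (R * R) * (R * R) => theta c s.2.1) @ F --> theta c a.
  by apply: (cvg_comp (fun s : (R * R) * (R * R) => s.2.1) (theta c) ca); exact: continuous_theta.
have c1 (T : Type) (G : set_system T) (x : R) : Filter G -> (fun=> x) @ G --> x.
  by move=> GF; exact: cvg_cst.
(* [gapfun] with the absolute values required by [cvg_powR]; the two agree on the set to which the
   filter is restricted. *)
pose G (s : (R * R) * (R * R)) :=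
  theta c s.2.1 * `|s.2.2| `^ s.1.1 + (1 - theta c s.2.1) * `|1 - s.2.2| `^ s.1.1
  - `|(`|s.2.1| `^ s.1.2 * s.2.2 + `|2 - s.2.1| `^ s.1.2 * (1 - s.2.2)) / 2| `^ s.1.1.
have GE s : 0 < s.2.1 < 2 /\ 0 <= s.2.2 <= 1 -> G s = gapfun c s.
  rewrite /gapfun; case: s => [[p' k'] [a' X']] /= [/andP[a'0 a'2] /andP[X'0 X'1]].
  rewrite /G /= !ger0_norm ?subr_ge0//; try exact: ltW.
  by rewrite divr_ge0// addr_ge0// mulr_ge0 ?powR_ge0// subr_ge0.
rewrite -(GE (p, k, (a, X))); last by split; apply/andP.
apply: (@cvg_trans _ (G @ F)).
  by apply: near_eq_cvg; rewrite near_withinE; apply: nearW => s; exact: GE.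
have p0 : 0 < p by lra.
have c1X : (fun s : (R * R) * (R * R) => 1 - s.2.2) @ F --> 1 - X.
  by apply: cvgB => //; exact: cvg_cst.
have c2a : (fun s : (R * R) * (R * R) => 2 - s.2.1) @ F --> 2 - a.
  by apply: cvgB => //; exact: cvg_cst.
apply: cvgB.
  apply: cvgD; apply: cvgM => //.
  - by apply: cvg_powR => //; right.
  - by apply: cvgB => //; exact: cvg_cst.
  - by apply: cvg_powR => //; right.
apply: cvg_powR => //; last by right.
apply: cvgM; last exact: cvg_cst.
apply: cvgD; apply: cvgM => //.
- by apply: cvg_powR => //; left; rewrite gt_eqF.
- by apply: cvg_powR => //; left; rewrite gt_eqF.
Qed.

(** A positive continuous function on a compact set has a positive minimum. The discriminant
    condition is closed, so it keeps the parameter set compact. *)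
Lemma midpoint_gap (c p0 p1 k0 k1 a0 a1 x0 x1 : R) :
  1 < p0 -> 1 < a0 -> a1 < 2 -> 0 <= x0 -> x1 <= 1 ->
  (forall p k a X, p0 <= p <= p1 -> k0 <= k <= k1 -> a0 <= a <= a1 ->
    x0 <= X <= x1 -> disc_le p k c -> 0 < gapfun c ((p, k), (a, X))) ->
  exists2 del : R, 0 < del &
  forall p k a X Y, p0 <= p <= p1 -> k0 <= k <= k1 -> a0 <= a <= a1 ->
    disc_le p k c -> 0 <= X -> 0 <= Y -> x0 * (X + Y) <= X <= x1 * (X + Y) ->
  ((a `^ k * X + (2 - a) `^ k * Y) / 2) `^ p + del * (X `^ p + Y `^ p) <=
  theta c a * X `^ p + (1 - theta c a) * Y `^ p.
Proof.
move=> p01 a01 a12 x00 x11 gap0.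
pose A := ((`[p0, p1] `*` `[k0, k1]) `*` (`[a0, a1] `*` `[x0, x1])) `&`
  [set t : (R * R) * (R * R) | disc_le t.1.1 t.1.2 c].
have cA : compact A.
  apply: compact_closedI.
    by apply: compact_setX; apply: compact_setX; exact: segment_compact.
  rewrite (_ : [set t | _] = (fun t : (R * R) * (R * R) =>
     4 * ((t.1.1 - 1) * (t.1.2 * (1 - t.1.2))) - (1 - 2 * t.1.2 - c) ^+ 2) @^-1` [set x | 0 <= x]); last first.
    by apply/seteqP; split => t /=; rewrite /disc_le subr_ge0.
  apply: closed_comp; last exact: closed_ge.
  move=> t _.
  have ct1 : {for t, continuous (fun t : (R * R) * (R * R) => t.1.1)}.
    by apply: (cvg_comp (fun s : (R * R) * (R * R) => s.1) fst (G := nbhs t.1)); exact: cvg_fst.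
  have ct2 : {for t, continuous (fun t : (R * R) * (R * R) => t.1.2)}.
    by apply: (cvg_comp (fun s : (R * R) * (R * R) => s.1) snd (G := nbhs t.1)); [exact: cvg_fst|exact: cvg_snd].
  have cc (x : R) : (fun _ : (R * R) * (R * R) => x) @ t --> x by exact: cvg_cst.
  apply: cvgB.
    by apply: cvgM => //; apply: cvgM; [|apply: cvgM => //]; apply: cvgB.
  rewrite [X in X @ _ --> _](_ : _ = (fun t : (R * R) * (R * R) => (1 - 2 * t.1.2 - c) * (1 - 2 * t.1.2 - c))).
    have h : (fun t : (R * R) * (R * R) => 1 - 2 * t.1.2 - c) @ t --> 1 - 2 * t.1.2 - c.
      by apply: cvgB => //; apply: cvgB => //; apply: cvgM.
    by rewrite expr2; exact: cvgM.
  by apply/funext => s; rewrite expr2.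
have Abox t : A t -> [/\ p0 <= t.1.1 <= p1, k0 <= t.1.2 <= k1, a0 <= t.2.1 <= a1, x0 <= t.2.2 <= x1 & disc_le t.1.1 t.1.2 c].
  by case: t => [[p k] [a X]] [[[/= + +] [+ +]] +]; rewrite !in_itv/=.
have [del del0 gap] : exists2 del : R, 0 < del & forall t, A t -> del <= gapfun c t.
  have [A0|] := pselect (A !=set0); last first.
    by move=> /set0P/negP; rewrite negbK => /eqP A0; exists 1 => // t; rewrite A0.
  have cg : {within A, continuous (gapfun c)}.
    apply/subspace_continuousP => t /Abox [h1 h2 h3 h4 _].
    have := @continuous_gapfun c t.
    have -> : 1 < t.1.1 by lra.
    have -> : 1 < t.2.1 by lra.
    have -> : t.2.1 < 2 by lra.
    have -> : 0 <= t.2.2 <= 1 by lra.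
    move=> /(_ isT isT isT isT); apply: cvg_trans; apply: cvg_app.
    apply: within_subset => s /Abox [_ _ s3 s4 _].
    by split; lra.
  have [t tA tmin] := compact_EVT_min A0 cA cg.
  exists (gapfun c t) => [|s sA]; last by apply: tmin; rewrite inE.
  move: tA; rewrite inE => /Abox.
  by case: t {tmin} => [[p k] [a X]] /= [h1 h2 h3 h4 h5]; exact: gap0.
(* Half of the minimum suffices because [x ^ p + (1 - x) ^ p <= 2]. *)
exists (del / 2) => [|p k a X Y pI kI aI dle X0 Y0 XI]; first by rewrite divr_gt0.
have := addr_ge0 X0 Y0; rewrite le_eqVlt => /predU1P[XY|XY].
  have -> : X = 0 by lra.
  have -> : Y = 0 by lra.
  have pN0 : p != 0 by rewrite gt_eqF//; lra.
  by rewrite !mulr0 addr0 mul0r powR0// addr0 !mulr0 addr0.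
pose x := X / (X + Y).
have Xx : X = (X + Y) * x by rewrite /x; field; rewrite gt_eqF.
have Yx : Y = (X + Y) * (1 - x) by rewrite /x; field; rewrite gt_eqF.
have xI : x0 <= x <= x1 by rewrite /x ler_pdivlMr// ler_pdivrMr.
have := gap ((p, k), (a, x)); rewrite /gapfun => /(_ _) gapx.
have {}gapx := gapx (conj (conj (conj pI kI) (conj aI xI)) dle).
have x01 : 0 <= x <= 1 by lra.
have sp := powR_gt0 p XY.
have Xp : X `^ p = (X + Y) `^ p * x `^ p.
  by rewrite {1}Xx powRM//; lra.
have Yp : Y `^ p = (X + Y) `^ p * (1 - x) `^ p.
  by rewrite {1}Yx powRM//; lra.
have Wp : ((a `^ k * X + (2 - a) `^ k * Y) / 2) `^ p =
    (X + Y) `^ p * ((a `^ k * x + (2 - a) `^ k * (1 - x)) / 2) `^ p.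
  rewrite -powRM//; last first.
  - by rewrite divr_ge0// addr_ge0// mulr_ge0 ?powR_ge0//; lra.
  - by lra.
  congr (_ `^ _); transitivity ((a `^ k * ((X + Y) * x) + (2 - a) `^ k * ((X + Y) * (1 - x))) / 2).
    by rewrite -Xx -Yx.
  by ring.
have xp : x `^ p <= 1.
  apply: (@le_trans _ _ (1 `^ p)); last by rewrite powR1.
  by apply: ge0_ler_powR; rewrite ?nnegrE//; lra.
have yp : (1 - x) `^ p <= 1.
  apply: (@le_trans _ _ (1 `^ p)); last by rewrite powR1.
  by apply: ge0_ler_powR; rewrite ?nnegrE//; lra.
rewrite Wp Xp Yp.
rewrite -subr_ge0 [leRHS](_ : _ = (X + Y) `^ p * (theta c a * x `^ p +
  (1 - theta c a) * (1 - x) `^ p - ((a `^ k * x + (2 - a) `^ k * (1 - x)) / 2) `^ p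
  - del / 2 * (x `^ p + (1 - x) `^ p))); last by ring.
apply: mulr_ge0; first exact: ltW.
suff : del / 2 * (x `^ p + (1 - x) `^ p) <= del by move: gapx; lra.
by nra.
Qed.
End gap.

(** * Uniform convexity of powers, and gaps on a slightly enlarged region *)

Section uniform.
Context {R : realType}.
Implicit Types (p k c a X Y x y e : R).

Lemma theta1E a : 1 < a -> a < 2 -> theta 1 a = 2^-1.
Proof.
move=> a1 a2; rewrite /theta /powR_primitive oner_eq0 !powRr1; try lra.
by field; lra.
Qed.

Lemma powR_uniformly_convex (p0 p1 e : R) : 1 < p0 -> 0 < e ->
  exists2 del : R, 0 < del & forall p x y, p0 <= p <= p1 ->
    e * (`|x| + `|y|) <= `|x - y| ->
    `|(x + y) / 2| `^ p + del * (`|x| `^ p + `|y| `^ p) <=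
    (`|x| `^ p + `|y| `^ p) / 2.
Proof.
move=> p01 e0.
(* [3/2] is an arbitrary level, since for [k = 0] and [c = 1] the weights are always [1/2]. For
   [0 <= x <= y] the separation [e (x + y) <= y - x] reads [x <= (1 - e) / 2 * (x + y)]. *)
have [|||||p k a X pI kI aI XI dle|del1 del10 gap] :=
  @midpoint_gap R 1 p0 p1 0 0 (3/2) (3/2) 0 ((1 - e) / 2); try lra.
  have -> : k = 0 by lra.
  by rewrite /gapfun subr_gt0; apply: midpoint_lt_k0; lra.
have del20 : 0 < 2^-1 - 2 `^ (- p0) :> R.
  rewrite subr_gt0 powRN ltf_pV2 ?posrE ?powR_gt0//.
  rewrite -[ltLHS](@powRr1 R)// /powR gt_eqF// ltr_expR ltr_pM2r//.
  by rewrite ln_gt0// ltr1n.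
pose del := Num.min del1 (2^-1 - 2 `^ (- p0)).
have dd1 : del <= del1 by rewrite ge_min lexx.
have dd2 : del <= 2^-1 - 2 `^ (- p0) by rewrite ge_min lexx orbT.
exists del => [|p]; first by rewrite lt_min del10 del20.
have same x y : p0 <= p <= p1 -> 0 <= x -> x <= y -> e * (x + y) <= y - x ->
    ((x + y) / 2) `^ p + del * (x `^ p + y `^ p) <= (x `^ p + y `^ p) / 2.
  move=> pI x0 xy exy; have y0 : 0 <= y by exact: le_trans xy.
  have h0 : (0 : R) <= (0 : R) <= (0 : R) by rewrite lexx.
  have h1 : (3 / 2 : R) <= (3 / 2 : R) <= (3 / 2 : R) by rewrite lexx.
  have dle : disc_le p 0 1 by rewrite /disc_le; lra.
  have h2 : 0 * (x + y) <= x <= (1 - e) / 2 * (x + y) by lra.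
  have := gap p 0 (3 / 2) x y pI h0 h1 dle x0 y0 h2.
  rewrite !powRr0 !mul1r theta1E; [|lra|lra].
  have := powR_ge0 x p; have := powR_ge0 y p.
  have : del * (x `^ p + y `^ p) <= del1 * (x `^ p + y `^ p).
    by rewrite ler_wpM2r// addr_ge0 ?powR_ge0.
  by lra.
(* Opposite signs, with [x] and [y] denoting the absolute values: [|x - y|] is at most the larger
   one, and halving it gains the factor [2 ^ (- p)], which stays below [1/2] because [p0 > 1]. *)
have opp x y : p0 <= p <= p1 -> 0 <= x -> 0 <= y ->
    (`|x - y| / 2) `^ p + del * (x `^ p + y `^ p) <= (x `^ p + y `^ p) / 2.
  move=> pI x0 y0; have p_gt0 : 0 <= p by lra.
  have : (`|x - y| / 2) `^ p <= 2 `^ (- p0) * (x `^ p + y `^ p).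
    rewrite powRM ?invr_ge0// mulrC; apply: ler_pM; rewrite ?powR_ge0//.
      rewrite -powR_inv1// -powRrM mulN1r; apply: ler_powR; first by rewrite ler1n.
      by lra.
    have [xy|/ltW yx] := leP x y.
      apply: (@le_trans _ _ (y `^ p)); last by rewrite lerDr powR_ge0.
      apply: ge0_ler_powR; rewrite ?nnegrE//.
      by rewrite distrC ger0_norm ?subr_ge0// lerBlDr lerDl.
    apply: (@le_trans _ _ (x `^ p)); last by rewrite lerDl powR_ge0.
    apply: ge0_ler_powR; rewrite ?nnegrE//.
    by rewrite ger0_norm ?subr_ge0// lerBlDr lerDl.
  have : del * (x `^ p + y `^ p) <= (2^-1 - 2 `^ (- p0)) * (x `^ p + y `^ p).
    by rewrite ler_wpM2r// addr_ge0 ?powR_ge0.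
  by lra.
have main x y : p0 <= p <= p1 -> `|x| <= `|y| -> e * (`|x| + `|y|) <= `|x - y| ->
    `|(x + y) / 2| `^ p + del * (`|x| `^ p + `|y| `^ p) <=
    (`|x| `^ p + `|y| `^ p) / 2.
  move=> pI xy; rewrite normrM [`|2^-1|]ger0_norm ?invr_ge0//.
  have [x0|x0] := leP 0 x; have [y0|y0] := leP 0 y.
  - move: xy; rewrite (ger0_norm x0) (ger0_norm y0) (ger0_norm (addr_ge0 x0 y0)) => xy.
    by rewrite distrC ger0_norm ?subr_ge0//; exact: same.
  - move=> _; have := opp _ _ pI (normr_ge0 x) (normr_ge0 y).
    by rewrite (ger0_norm x0) (ltr0_norm y0) opprK.
  - move=> _; have := opp _ _ pI (normr_ge0 x) (normr_ge0 y).
    by rewrite (ger0_norm y0) (ltr0_norm x0) -opprD normrN.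
  - have xy0 : x + y < 0 by lra.
    move: xy; rewrite (ltr0_norm x0) (ltr0_norm y0) (ltr0_norm xy0) opprD => xy exy.
    apply: same => //; first by lra.
    by move: exy; rewrite ger0_norm; lra.
move=> x y pI; have [xy|/ltW yx] := leP `|x| `|y|; first exact: main.
by rewrite (addrC x y) distrC (addrC `|x|) (addrC (`|x| `^ p)); exact: main.
Qed.

(** The region [X <= Y] is enlarged so that the failure of its condition is a quantitative
    inequality, [X ^ p > (1 + del) * Y ^ p]. That inequality can be added to the integrand to treat
    all points at once. *)
Lemma midpoint_gap_ge0 (c p0 p1 k0 k1 a0 a1 : R) :
  1 < p0 -> 0 < k0 -> k1 < 1 -> 1 < a0 -> a1 < 2 -> 0 <= c -> exists2 del : R, 0 < del &
  forall p k a X Y, p0 <= p <= p1 -> k0 <= k <= k1 -> a0 <= a <= a1 ->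
    disc_le p k c -> 0 <= X -> 0 <= Y -> X `^ p <= (1 + del) * Y `^ p ->
  ((a `^ k * X + (2 - a) `^ k * Y) / 2) `^ p + del * Y `^ p <=
  theta c a * X `^ p + (1 - theta c a) * Y `^ p.
Proof.
move=> p01 k00 k11 a01 a12 c0.
have [|||||p k a X pI kI aI XI dle|del del0 gap] :=
  @midpoint_gap R c p0 p1 k0 k1 a0 a1 0 2^-1; try lra.
  by rewrite /gapfun subr_gt0; apply: midpoint_lt_ge0 => //; lra.
exists del => // p k a X Y pI kI aI dle X0 Y0 XY.
have Yp := powR_ge0 Y p; have Xp := powR_ge0 X p.
have [XleY|YX] := leP X Y.
  have := gap p k a X Y pI kI aI dle X0 Y0.
  have -> : 0 * (X + Y) <= X <= 2^-1 * (X + Y) by lra.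
  move=> /(_ isT); suff : del * Y `^ p <= del * (X `^ p + Y `^ p) by lra.
  by rewrite ler_pM2l// lerDr.
(* For [Y < X] the comparison is with the pair [(Y, Y)], which gains [2 * del * Y ^ p]. Replacing
   the first [Y] by [X] costs at most the factor [1 + del], and
   [(1 + del) (1 - 2 del) <= 1 - del]. *)
have := gap p k a Y Y pI kI aI dle Y0 Y0.
have -> : 0 * (Y + Y) <= Y <= 2^-1 * (Y + Y) by lra.
move=> /(_ isT) gapY.
have p_gt0 : 0 < p by lra.
have ak0 : 0 <= a `^ k by exact: powR_ge0.
have bk0 : 0 <= (2 - a) `^ k by exact: powR_ge0.
pose s := (1 + del) `^ p^-1.
have sp : s `^ p = 1 + del.
  by rewrite /s -powRrM mulVf ?gt_eqF// powRr1//; lra.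
have s1 : 1 <= s.

  apply: (@le_trans _ _ (1 `^ p^-1)); first by rewrite powR1.
  by apply: ge0_ler_powR; rewrite ?nnegrE ?invr_ge0; lra.
have s0 : 0 <= s by lra.
have XsY : X <= s * Y.
  rewrite leNgt; apply/negP => sYX.
  have : (s * Y) `^ p < X `^ p by apply: gt0_ltr_powR; rewrite ?nnegrE ?mulr_ge0.
  by rewrite powRM// sp ltNge XY.
have : ((a `^ k * X + (2 - a) `^ k * Y) / 2) `^ p <=
    (1 + del) * ((a `^ k * Y + (2 - a) `^ k * Y) / 2) `^ p.
  rewrite -sp -powRM//; last by rewrite divr_ge0// addr_ge0// mulr_ge0.
  apply: ge0_ler_powR; rewrite ?nnegrE ?(ltW p_gt0)//.
  - by rewrite divr_ge0// addr_ge0// mulr_ge0.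
  - by rewrite mulr_ge0// divr_ge0// addr_ge0// mulr_ge0.
  rewrite mulrA ler_pM2r ?invr_gt0// mulrDr; apply: lerD.
    by rewrite mulrCA ler_wpM2l.
  by rewrite mulrCA ler_wpM2l// ler_peMl.
have : Y `^ p <= theta c a * X `^ p + (1 - theta c a) * Y `^ p.
  have th0 : 0 <= theta c a.
    by apply/ltW/(@theta_gt0 R p k c a) => //; lra.
  have : Y `^ p <= X `^ p.
    by apply: ge0_ler_powR; rewrite ?nnegrE//; exact: ltW.
  by nra.
by nra.
Qed.

Lemma midpoint_gap_le0 (c p0 p1 k0 k1 a0 a1 : R) :
  1 < p0 -> 0 < k0 -> k1 < 1 -> 1 < a0 -> a1 < 2 -> c <= 0 -> exists2 del : R, 0 < del &
  forall p k a X Y, p0 <= p <= p1 -> k0 <= k <= k1 -> a0 <= a <= a1 ->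
    disc_le p k c -> 0 <= X -> 0 <= Y -> Y `^ p <= (1 + del) * X `^ p ->
  ((a `^ k * X + (2 - a) `^ k * Y) / 2) `^ p + del * X `^ p <=
  theta c a * X `^ p + (1 - theta c a) * Y `^ p.
Proof.
move=> p01 k00 k11 a01 a12 c0.
have [|||||p k a X pI kI aI XI dle|del del0 gap] :=
  @midpoint_gap R c p0 p1 k0 k1 a0 a1 2^-1 1; try lra.
  by rewrite /gapfun subr_gt0; apply: midpoint_lt_le0 => //; lra.
exists del => // p k a X Y pI kI aI dle X0 Y0 YX.
have Yp := powR_ge0 Y p; have Xp := powR_ge0 X p.
have [YleX|XY] := leP Y X.
  have := gap p k a X Y pI kI aI dle X0 Y0.
  have -> : 2^-1 * (X + Y) <= X <= 1 * (X + Y) by lra.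
  move=> /(_ isT); suff : del * X `^ p <= del * (X `^ p + Y `^ p) by lra.
  by rewrite ler_pM2l// lerDl.
have := gap p k a X X pI kI aI dle X0 X0.
have -> : 2^-1 * (X + X) <= X <= 1 * (X + X) by lra.
move=> /(_ isT) gapX.
have p_gt0 : 0 < p by lra.
have ak0 : 0 <= a `^ k by exact: powR_ge0.
have bk0 : 0 <= (2 - a) `^ k by exact: powR_ge0.
pose s := (1 + del) `^ p^-1.
have sp : s `^ p = 1 + del.
  by rewrite /s -powRrM mulVf ?gt_eqF// powRr1//; lra.
have s1 : 1 <= s.
  apply: (@le_trans _ _ (1 `^ p^-1)); first by rewrite powR1.
  by apply: ge0_ler_powR; rewrite ?nnegrE ?invr_ge0; lra.
have s0 : 0 <= s by lra.
have YsX : Y <= s * X.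
  rewrite leNgt; apply/negP => sXY.
  have : (s * X) `^ p < Y `^ p by apply: gt0_ltr_powR; rewrite ?nnegrE ?mulr_ge0.
  by rewrite powRM// sp ltNge YX.
have : ((a `^ k * X + (2 - a) `^ k * Y) / 2) `^ p <=
    (1 + del) * ((a `^ k * X + (2 - a) `^ k * X) / 2) `^ p.
  rewrite -sp -powRM//; last by rewrite divr_ge0// addr_ge0// mulr_ge0.
  apply: ge0_ler_powR; rewrite ?nnegrE ?(ltW p_gt0)//.
  - by rewrite divr_ge0// addr_ge0// mulr_ge0.
  - by rewrite mulr_ge0// divr_ge0// addr_ge0// mulr_ge0.
  rewrite mulrA ler_pM2r ?invr_gt0// mulrDr; apply: lerD.
    by rewrite mulrCA ler_wpM2l// ler_peMl.
  by rewrite mulrCA ler_wpM2l.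
have : X `^ p <= theta c a * X `^ p + (1 - theta c a) * Y `^ p.
  have th1 : theta c a <= 1.
    by apply/ltW/(@theta_lt1 R p k c a) => //; lra.
  have : X `^ p <= Y `^ p.
    by apply: ge0_ler_powR; rewrite ?nnegrE//; exact: ltW.
  by nra.
by nra.
Qed.
End uniform.

(** * Integrals of nonnegative real functions *)

Section nonneg_integral.
Local Open Scope ereal_scope.
Context d (T : measurableType d) (R : realType) (mu : {measure set T -> \bar R}).
Implicit Types F G : T -> R.

Definition nonneg_mfun F := measurable_fun [set: T] F /\ forall x, (0 <= F x)%R.

Lemma nonneg_integral_ge0 F : nonneg_mfun F -> 0 <= \int[mu]_x (F x)%:E.
Proof. by move=> [_ F0]; apply: integral_ge0 => x _; rewrite lee_fin. Qed.

Lemma nonneg_integral_le F G : nonneg_mfun F -> nonneg_mfun G ->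
  {ae mu, forall x, (F x <= G x)%R} ->
  \int[mu]_x (F x)%:E <= \int[mu]_x (G x)%:E.
Proof.
move=> [mF F0] [mG G0] FG; apply: ae_ge0_le_integral => //.
- by move=> x _; rewrite lee_fin.
- exact/measurable_EFinP.
- by move=> x _; rewrite lee_fin.
- exact/measurable_EFinP.
- by apply: filterS FG => x /= + _; rewrite lee_fin.
Qed.

Lemma nonneg_integral_lin F G (a b : R) : nonneg_mfun F -> nonneg_mfun G ->
  (0 <= a)%R -> (0 <= b)%R ->
  \int[mu]_x (a * F x + b * G x)%:E =
  a%:E * \int[mu]_x (F x)%:E + b%:E * \int[mu]_x (G x)%:E.
Proof.
move=> [mF F0] [mG G0] a0 b0.
under eq_integral do rewrite EFinD !EFinM.
rewrite ge0_integralD//.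
- rewrite !ge0_integralZl_EFin//.
  + by move=> x _; rewrite lee_fin.
  + exact/measurable_EFinP.
  + by move=> x _; rewrite lee_fin.
  + exact/measurable_EFinP.
- by move=> x _; rewrite -EFinM lee_fin mulr_ge0.
- by under eq_fun do rewrite -EFinM; apply/measurable_EFinP/measurable_funM.
- by move=> x _; rewrite -EFinM lee_fin mulr_ge0.
- by under eq_fun do rewrite -EFinM; apply/measurable_EFinP/measurable_funM.
Qed.

Lemma nonneg_integralZ F (a : R) : nonneg_mfun F -> (0 <= a)%R ->
  \int[mu]_x (a * F x)%:E = a%:E * \int[mu]_x (F x)%:E.
Proof.
move=> [mF F0] a0; under eq_integral do rewrite EFinM.
rewrite ge0_integralZl_EFin//; last exact/measurable_EFinP.
by move=> x _; rewrite lee_fin.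
Qed.

Lemma nonneg_mfun_lin F G (a b : R) : nonneg_mfun F -> nonneg_mfun G ->
  (0 <= a)%R -> (0 <= b)%R -> nonneg_mfun (fun x => a * F x + b * G x)%R.
Proof.
move=> [mF F0] [mG G0] a0 b0; split.
  by apply: measurable_funD; exact: measurable_funM.
by move=> x; rewrite addr_ge0 ?mulr_ge0.
Qed.

Lemma nonneg_mfunZ F (a : R) : nonneg_mfun F -> (0 <= a)%R ->
  nonneg_mfun (fun x => a * F x)%R.
Proof.
by move=> [mF F0] a0; split=> [|x]; [exact: measurable_funM|rewrite mulr_ge0].
Qed.

Lemma nonneg_integral_eq0 F : nonneg_mfun F ->
  \int[mu]_x (F x)%:E = 0 -> {ae mu, forall x, F x = 0%R}.
Proof.
move=> [mF F0] IF0.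
have := ae_eq_integral_abs mu measurableT (proj2 (measurable_EFinP _ _) mF).
move=> [+ _]; rewrite (_ : \int[mu]_x _ = \int[mu]_x (F x)%:E); last first.
  by apply: eq_integral => x _ /=; rewrite ger0_norm.
by move=> /(_ IF0); apply: filterS => x /= /(_ I) [].
Qed.

Lemma measurable_fun_powR (f p : T -> R) : measurable_fun [set: T] f ->
  measurable_fun [set: T] p -> measurable_fun [set: T] (fun x => (f x `^ p x)%R).
Proof.
move=> mf mp; rewrite /powR; apply: measurable_fun_ifT => /=.
- by apply: measurable_fun_eqr.
- rewrite (_ : (fun x => _) = (fun b : bool => b%:R : R) \o (fun x => p x == 0%R))//.
  by apply: measurableT_comp => //; apply: measurable_fun_eqr.
- apply: measurableT_comp => //; apply: measurable_funM => //.
  exact: measurableT_comp.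
Qed.

Lemma nonneg_mfun_powR (f p : T -> R) : measurable_fun [set: T] f ->
  measurable_fun [set: T] p -> nonneg_mfun (fun x => (`|f x| `^ p x)%R).
Proof.
move=> mf mp; split=> [|x]; last exact: powR_ge0.
by apply: measurable_fun_powR => //; exact: measurableT_comp.
Qed.
End nonneg_integral.

(** * The level functional: scaling, attainment, quasi-triangle inequality *)

Section modular.
Local Open Scope ereal_scope.
Context d (T : measurableType d) (R : realType) (mu : {measure set T -> \bar R}).
Implicit Types (f g : T -> R) (P K : T -> R).

(** [K] stands for [1 / q]. The bounds hold at every point: essentially bounded exponents are first
    modified on a null set by [clip]. *)
Record exponents P K (p0 p1 k0 k1 : R) : Prop := Exponents {
  exponents_mP : measurable_fun [set: T] P ;
  exponents_mK : measurable_fun [set: T] K ;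
  exponents_p0 : (1 < p0)%R ;
  exponents_k0 : (0 < k0)%R ;
  exponents_k1 : (k1 < 1)%R ;
  exponents_P : forall x, (p0 <= P x <= p1)%R ;
  exponents_K : forall x, (k0 <= K x <= k1)%R }.

(* [power_int], [dilate] and [level] are sealed: conversion checks that fail
   would otherwise unfold them down to the Lebesgue integral. *)
Fact power_int_sealed : {J : (T -> R) -> (T -> R) -> \bar R |
  forall P f, J P f = \int[mu]_x (`|f x| `^ P x)%:E}.
Proof. by eexists. Qed.

Definition power_int P f : \bar R := sval power_int_sealed P f.

Lemma power_intE P f : power_int P f = \int[mu]_x (`|f x| `^ P x)%:E.
Proof. exact: (svalP power_int_sealed). Qed.

Fact dilate_sealed : {D : (T -> R) -> R -> (T -> R) -> T -> R |
  forall K l f x, D K l f x = (f x / l `^ K x)%R}.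
Proof. by eexists. Qed.

Definition dilate K (l : R) f : T -> R := sval dilate_sealed K l f.

Lemma dilateE K l f x : dilate K l f x = (f x / l `^ K x)%R.
Proof. exact: (svalP dilate_sealed). Qed.

Definition power_finite P f := measurable_fun [set: T] f /\ power_int P f < +oo.

Fact level_sealed : {L : (T -> R) -> (T -> R) -> (T -> R) -> \bar R |
  forall P K f, L P K f = ereal_inf
    [set l%:E | l in [set l : R | (0 < l)%R /\ power_int P (dilate K l f) <= 1]]}.
Proof. by eexists. Qed.

Definition level P K f : \bar R := sval level_sealed P K f.

Lemma levelE P K f : level P K f = ereal_inf
  [set l%:E | l in [set l : R | (0 < l)%R /\ power_int P (dilate K l f) <= 1]].
Proof. exact: (svalP level_sealed). Qed.

Variables (P K : T -> R) (p0 p1 k0 k1 : R).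
Hypothesis PK : exponents P K p0 p1 k0 k1.

Let mP := exponents_mP PK.
Let mK := exponents_mK PK.

Lemma P_gt1 x : (1 < P x)%R.
Proof. by have := exponents_P PK x; have := exponents_p0 PK; lra. Qed.

Lemma P_gt0 x : (0 < P x)%R.
Proof. by have := P_gt1 x; lra. Qed.

Lemma K_gt0 x : (0 < K x)%R.
Proof. by have := exponents_K PK x; have := exponents_k0 PK; lra. Qed.

Lemma K_lt1 x : (K x < 1)%R.
Proof. by have := exponents_K PK x; have := exponents_k1 PK; lra. Qed.

Lemma KP_ge x : (k0 <= K x * P x)%R.
Proof.
have /andP[kK _] := exponents_K PK x; apply: (le_trans kK).
by rewrite ler_peMr ?(ltW (K_gt0 x))// ltW// P_gt1.
Qed.

Lemma KP_le x : (K x * P x <= p1)%R.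
Proof.
have /andP[_ pP] := exponents_P PK x; apply: le_trans pP.
by rewrite ger_pMl ?P_gt0// ltW// K_lt1.
Qed.

Lemma measurable_dilate l f : measurable_fun [set: T] f ->
  measurable_fun [set: T] (dilate K l f).
Proof.
move=> mf.
have -> : dilate K l f = (fun x => f x * (l `^ K x)^-1)%R by apply/funext => x; rewrite dilateE.
apply: measurable_funM => //.
under eq_fun do rewrite -powRN.
apply: measurable_fun_powR => //.
exact: measurableT_comp.
Qed.

Lemma powR_dilate l f x : (0 < l)%R ->
  (`|dilate K l f x| `^ P x = l `^ (- (K x * P x)) * `|f x| `^ P x)%R.
Proof.
move=> l0; rewrite dilateE normrM powRM// mulrC; congr (_ * _)%R.
by rewrite -powRN ger0_norm ?powR_ge0// -powRrM mulNr.
Qed.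

Lemma dilateM l s f : (0 < l)%R -> (0 < s)%R ->
  dilate K (s * l) f = dilate K s (dilate K l f).
Proof.
move=> l0 s0; apply/funext => x; rewrite !dilateE powRM ?ltW//.
by rewrite invfM [(_^-1 * _)%R]mulrC mulrA.
Qed.

Lemma dilate1 f : dilate K 1 f = f.
Proof. by apply/funext => x; rewrite dilateE powR1 divr1. Qed.

Lemma power_int_ge0 f : measurable_fun [set: T] f -> 0 <= power_int P f.
Proof. by move=> mf; rewrite power_intE; apply: nonneg_integral_ge0; exact: nonneg_mfun_powR. Qed.

Lemma power_int_dilate_ge1 s f : measurable_fun [set: T] f -> (1 <= s)%R ->
  power_int P (dilate K s f) <= (s `^ (- k0))%:E * power_int P f.
Proof.
move=> mf s1; have s0 : (0 < s)%R by lra.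
rewrite !power_intE -nonneg_integralZ; [|exact: nonneg_mfun_powR|exact: powR_ge0].
apply: nonneg_integral_le.
- by apply: nonneg_mfun_powR => //; exact: measurable_dilate.
- by apply: nonneg_mfunZ; [exact: nonneg_mfun_powR|exact: powR_ge0].
- apply: aeW => x; rewrite powR_dilate// ler_wpM2r ?powR_ge0//.
  by apply: ler_powR => //; rewrite lerN2 KP_ge.
Qed.

Lemma power_int_dilate_le1 s f : measurable_fun [set: T] f -> (0 < s <= 1)%R ->
  power_int P (dilate K s f) <= (s `^ (- p1))%:E * power_int P f.
Proof.
move=> mf /andP[s0 s1].
rewrite !power_intE -nonneg_integralZ; [|exact: nonneg_mfun_powR|exact: powR_ge0].
apply: nonneg_integral_le.
- by apply: nonneg_mfun_powR => //; exact: measurable_dilate.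
- by apply: nonneg_mfunZ; [exact: nonneg_mfun_powR|exact: powR_ge0].
- apply: aeW => x; rewrite powR_dilate// ler_wpM2r ?powR_ge0//.
  by apply: ger_powR; rewrite ?s0// lerN2 KP_le.
Qed.

Lemma power_int_dilate_le s f : measurable_fun [set: T] f -> (1 <= s)%R ->
  power_int P (dilate K s f) <= power_int P f.
Proof.
move=> mf s1; apply: (le_trans (power_int_dilate_ge1 mf s1)).
rewrite -[leRHS]mul1e lee_wpmul2r ?power_int_ge0// lee_fin.
rewrite powRN invf_le1 ?powR_gt0//; last lra.
by rewrite -(powRr0 s) ler_powR// ltW// (exponents_k0 PK).
Qed.

Lemma level_ge0 f : 0 <= level P K f.
Proof.
by rewrite levelE; apply: le_ereal_inf_tmp => _ [l [l0 _] <-]; rewrite lee_fin ltW.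
Qed.

Lemma level_le f l : (0 < l)%R -> power_int P (dilate K l f) <= 1 ->
  level P K f <= l%:E.
Proof. by move=> l0 Jl; rewrite levelE; apply: ereal_inf_lbound; exists l. Qed.

(** Enlarging [l] decreases the integral, so the admissible [l] form an up-set and everything
    strictly above the infimum is admissible. *)
Lemma level_lt f l : measurable_fun [set: T] f -> level P K f < l%:E ->
  (0 < l)%R /\ power_int P (dilate K l f) <= 1.
Proof.
rewrite levelE => mf lf; have l0 : (0 < l)%R.
  by rewrite -lte_fin (le_lt_trans _ lf)// -levelE level_ge0.
split => //.
have [_ [s [s0 Js] <-]] := ereal_inf_lt lf; rewrite lte_fin => sl.
have lE : l = (l / s * s)%R by rewrite divfK// gt_eqF.
rewrite lE.
rewrite (@dilateM s (l / s)%R); [|by []|by rewrite divr_gt0].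
apply: le_trans Js.
apply: power_int_dilate_le; first exact: measurable_dilate.
by rewrite ler_pdivlMr// mul1r ltW.
Qed.

Lemma level_fin f : power_finite P f -> level P K f < +oo.
Proof.
move=> [mf]; have J0 := power_int_ge0 mf.
have := fun s => @power_int_dilate_ge1 s f mf.
case: (power_int P f) J0 => [r||]// r0 Hs _.
have k0' := exponents_k0 PK.
pose s := (Num.max 1 r `^ k0^-1)%R.
have s1 : (1 <= s)%R.
  rewrite /s; apply: (@le_trans _ _ (1 `^ k0^-1)%R); first by rewrite powR1.
  apply: ge0_ler_powR; rewrite ?nnegrE ?invr_ge0 ?(ltW k0')// ?le_max ?lexx//.
  by rewrite ler01.
apply: (@le_lt_trans _ _ s%:E); last exact: ltry.
apply: level_le; first by lra.
apply: (le_trans (Hs _ s1)); rewrite -EFinM lee_fin powRN /s -powRrM mulVf ?gt_eqF//.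
have m1 : (1 <= Num.max 1 r)%R by rewrite le_max lexx.
rewrite powRr1 ?(le_trans ler01)// ler_pdivrMl ?mulr1 ?le_max ?lexx ?orbT//.
by lra.
Qed.

(** Dividing the level by [s >= 1] multiplies the integral by at most [s ^ p1], which replaces
    continuity in the level. Letting [s] tend to 1 gives [<= 1]; an integral below 1 would leave
    room for a smaller admissible level. *)
Lemma level_attained f (a : R) : power_finite P f -> level P K f = a%:E -> (0 < a)%R ->
  power_int P (dilate K a f) = 1.
Proof.
move=> [mf ffin] fa a0; have mda := measurable_dilate a mf.
have J0 := power_int_ge0 mda.
have up s : (1 < s)%R -> power_int P (dilate K s (dilate K a f)) <= 1.
  move=> s1; have s0 : (0 < s)%R by lra.
  rewrite -(dilateM _ a0 s0); apply: (proj2 (@level_lt _ (s * a)%R mf _)).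
  by rewrite fa lte_fin ltr_pMl.
have back s : (1 < s)%R -> power_int P (dilate K a f) <=
    (s `^ p1)%:E * power_int P (dilate K s (dilate K a f)).
  move=> s1; have s0 : (0 < s)%R by lra.
  rewrite -{1}(dilate1 (dilate K a f)) -(mulVf (lt0r_neq0 s0)) dilateM; [|by []|by rewrite invr_gt0].
  have -> : (s `^ p1 = s^-1 `^ (- p1))%R.
    by rewrite -(powR_inv1 (ltW s0)) -powRrM mulN1r opprK.
  apply: power_int_dilate_le1; first exact: measurable_dilate.
  by rewrite invr_gt0 s0 invf_le1// ltW.
have p1_gt0 : (0 < p1)%R.
  by have := exponents_p0 PK; have := exponents_P PK point; lra.
have root (y : R) : (1 < y)%R -> (1 < y `^ p1^-1)%R /\ ((y `^ p1^-1) `^ p1 = y)%R.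
  move=> y1; rewrite -powRrM mulVf ?gt_eqF// powRr1; last by lra.
  split => //; rewrite /powR gt_eqF; last by lra.
  by rewrite -expR0 ltr_expR mulr_gt0 ?invr_gt0 ?ln_gt0.
apply/eqP; rewrite eq_le; apply/andP; split.
  apply/lee_addgt0Pr => e e0; rewrite -EFinD.
  have [|s1 sp] := root (1 + e)%R; first by lra.
  apply: (le_trans (back _ s1)); rewrite sp -[leRHS]mule1.
  by rewrite lee_wpmul2l ?lee_fin ?up//; lra.
rewrite leNgt; apply/negP => J1.
have [r Jr] : exists r : R, power_int P (dilate K a f) = r%:E.
  by case: (power_int P (dilate K a f)) J0 J1 => [r||]//; exists r.
move: J0 J1; rewrite Jr lee_fin lte_fin => r0 r1.
(* For [r < 1] the number [2 / (1 + r)] exceeds 1, and its product with [r] is at most 1. *)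
pose y := (Num.min 2 ((1 + r)^-1 * 2))%R.
have y1 : (1 < y)%R.
  rewrite lt_min ltr1n /= ltr_pdivlMl; lra.
have yr : (y * r <= 1)%R.
  apply: (@le_trans _ _ ((1 + r)^-1 * 2 * r)%R).
    by rewrite ler_wpM2r// ge_min lexx orbT.
  by rewrite -mulrA ler_pdivrMl; lra.
have [s1 sp] := root _ y1; set s := (y `^ p1^-1)%R in s1 sp.
have s0 : (0 < s)%R by lra.
have : level P K f <= (s^-1 * a)%:E.
  apply: level_le; first by rewrite mulr_gt0 ?invr_gt0.
  rewrite dilateM; [|by []|by rewrite invr_gt0].
  apply: (@le_trans _ _ ((s^-1 `^ (- p1))%:E * power_int P (dilate K a f))).
    apply: power_int_dilate_le1; first exact: measurable_dilate.
    by rewrite invr_gt0 s0 invf_le1// ltW.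
  rewrite -(powR_inv1 (ltW s0)) -powRrM mulN1r opprK sp Jr.
  by rewrite -EFinM lee_fin.
rewrite fa lee_fin ler_pdivlMl// ger_pMl//; lra.
Qed.

(** One inequality suffices, applied to [l] and to its inverse. This exact homogeneity is why
    dilations are preferred to scalar multiples, which only give the two power bounds below. *)
Lemma level_dilate l f : (0 < l)%R ->
  level P K f = l%:E * level P K (dilate K l f).
Proof.
have le s g : (0 < s)%R -> s%:E * level P K (dilate K s g) <= level P K g.
  move=> s0; rewrite (levelE _ _ g); apply: le_ereal_inf_tmp => _ [r [r0 Jr] <-].
  rewrite -lee_pdivlMl//; rewrite -EFinM; apply: level_le.
    by rewrite mulr_gt0 ?invr_gt0.
  have sr0 : (0 < s^-1 * r)%R by rewrite mulr_gt0 ?invr_gt0.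
  have e : (s^-1 * r * s = r)%R by field; rewrite gt_eqF.
  by rewrite -(dilateM _ s0 sr0) e; exact: Jr.
move=> l0; apply/eqP; rewrite eq_le le// andbT.
have lV0 : (0 < l^-1)%R by rewrite invr_gt0.
have := @le l^-1%R (dilate K l f) lV0.
rewrite -(dilateM _ l0 lV0) mulVf ?lt0r_neq0// dilate1.
by rewrite muleC -lee_pdivlMr ?invr_gt0// invrK muleC.
Qed.

(** Dilating [s * f] by [s ^ q * l] gives [s / s ^ (q K)] times the dilation of [f] by [l], and the
    hypothesis bounds this factor by 1. The choices of [q] are [1 / k1] for [s <= 1] and [1 / k0]
    for [s >= 1]. *)
Lemma level_scale (s q : R) f : (0 < s)%R -> (forall x, s <= s `^ (q * K x))%R ->
  measurable_fun [set: T] f ->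
  level P K (fun x => s * f x)%R <= (s `^ q)%:E * level P K f.
Proof.
move=> s0 sq mf; have sq0 : (0 < s `^ q)%R by rewrite powR_gt0.
rewrite -lee_pdivrMl// (levelE _ _ f); apply: le_ereal_inf_tmp => _ [l [l0 Jl] <-].
rewrite lee_pdivrMl// -EFinM; apply: level_le; first by rewrite mulr_gt0.
apply: le_trans Jl; rewrite !power_intE; apply: nonneg_integral_le.
- by apply: nonneg_mfun_powR => //; apply: measurable_dilate; exact: measurable_funM.
- by apply: nonneg_mfun_powR => //; exact: measurable_dilate.
apply: aeW => x; apply: ge0_ler_powR; rewrite ?nnegrE ?(ltW (P_gt0 x))//.
rewrite !dilateE powRM ?(ltW sq0) ?(ltW l0)// -powRrM invfM.
have sk := powR_gt0 (q * K x) s0.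
rewrite (_ : s * f x * _ = (s / s `^ (q * K x)) * (f x / l `^ K x))%R; last by ring.
rewrite normrM ler_piMl// ger0_norm; first by rewrite ler_pdivrMr// mul1r.
by rewrite divr_ge0 ?ltW.
Qed.

Lemma level_scale_le1 s f : (0 < s <= 1)%R -> measurable_fun [set: T] f ->
  level P K (fun x => s * f x)%R <= (s `^ k1^-1)%:E * level P K f.
Proof.
move=> /andP[s0 s1] mf; apply: level_scale => // x.
rewrite -[leLHS]powRr1 ?(ltW s0)//; apply: ger_powR; first by rewrite s0.
have /andP[_ Kk] := exponents_K PK x.
by rewrite ler_pdivrMl ?mulr1// (lt_le_trans _ Kk)// K_gt0.
Qed.

Lemma level_scale_ge1 s f : (1 <= s)%R -> measurable_fun [set: T] f ->
  level P K (fun x => s * f x)%R <= (s `^ k0^-1)%:E * level P K f.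
Proof.
move=> s1 mf; have s0 : (0 < s)%R by lra.
apply: level_scale => // x.
rewrite -[leLHS]powRr1 ?(ltW s0)//; apply: ler_powR => //.
have /andP[kK _] := exponents_K PK x.
by rewrite ler_pdivlMl ?mulr1// (exponents_k0 PK).
Qed.

Lemma power_finite_lin f g (a b : R) : power_finite P f -> power_finite P g ->
  power_finite P (fun x => a * f x + b * g x)%R.
Proof.
move=> [mf Jf] [mg Jg].
have mfg : measurable_fun [set: T] (fun x => a * f x + b * g x)%R.
  by apply: measurable_funD; exact: measurable_funM.
split; first exact: mfg.
pose C := (Num.max 1 (2 * (`|a| + `|b|)) `^ p1)%R.
have C0 : (0 <= C)%R by exact: powR_ge0.
apply: (@le_lt_trans _ _ (C%:E * power_int P f + C%:E * power_int P g)).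
  rewrite !power_intE -nonneg_integral_lin//; try exact: nonneg_mfun_powR.
  apply: nonneg_integral_le; first exact: nonneg_mfun_powR.
    by apply: nonneg_mfun_lin => //; exact: nonneg_mfun_powR.
  apply: aeW => x; rewrite -mulrDr.
  have P0 := P_gt0 x; have /andP[_ Pp] := exponents_P PK x.
  set u := (`|f x|)%R; set v := (`|g x|)%R.
  set w := (Num.max u v).
  have w0 : (0 <= w)%R by rewrite le_max normr_ge0.
  set D := (Num.max 1 _)%R in C C0 *.
  have D1 : (1 <= D)%R by rewrite le_max lexx.
  have fgw : (`|a * f x + b * g x| <= D * w)%R.
    apply: (@le_trans _ _ ((2 * (`|a| + `|b|)) * w)%R); last first.
      by rewrite ler_wpM2r// le_max lexx orbT.
    apply: (le_trans (ler_normD _ _)); rewrite !normrM.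
    have uw : (u <= w)%R by rewrite le_max lexx.
    have vw : (v <= w)%R by rewrite le_max lexx orbT.
    have := ler_wpM2l (normr_ge0 a) uw; have := ler_wpM2l (normr_ge0 b) vw.
    have := mulr_ge0 (normr_ge0 a) w0; have := mulr_ge0 (normr_ge0 b) w0.
    by rewrite -/u -/v; lra.
  apply: (@le_trans _ _ ((D * w) `^ P x)%R).
    by apply: ge0_ler_powR; rewrite ?nnegrE ?(ltW P0)// mulr_ge0//; lra.
  rewrite powRM//; last by lra.
  apply: ler_pM; rewrite ?powR_ge0//; first by rewrite ler_powR.
  by rewrite /w; case: (leP u v) => _; rewrite ?lerDr ?lerDl powR_ge0.
have fin h : measurable_fun [set: T] h -> power_int P h < +oo -> C%:E * power_int P h < +oo.
  by move=> mh Jh; rewrite lte_mul_pinfty// lee_fin.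
by rewrite lte_add_pinfty// fin.
Qed.

Lemma power_finite_dilate l f : (0 < l)%R -> power_finite P f ->
  power_finite P (dilate K l f).
Proof.
move=> l0 [mf Jf]; split; first exact: measurable_dilate.
have [l1|/ltW l1] := leP 1%R l.
  by apply: le_lt_trans Jf; exact: power_int_dilate_le.
apply: le_lt_trans (power_int_dilate_le1 mf _) _; first by rewrite l0.
by rewrite lte_mul_pinfty// lee_fin powR_ge0.
Qed.

(** The solution of [C ^ k0 = 2 ^ (p1 + 1)]: the factor [2 ^ p1] comes from the power of a
    difference, and one more factor 2 makes the two resulting terms share the unit integral
    equally. *)
Definition level_const : R := ((2 `^ (p1 + 1)) `^ k0^-1)%R.

Lemma level_const_ge1 : (1 <= level_const)%R.
Proof.
have := exponents_p0 PK; have := exponents_k0 PK; have := exponents_P PK point.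
move=> pp k00 p01; rewrite /level_const.
apply: (@le_trans _ _ (1 `^ k0^-1)%R); first by rewrite powR1.
apply: ge0_ler_powR; rewrite ?nnegrE ?powR_ge0// ?invr_ge0 ?(ltW k00)//.
apply: (@le_trans _ _ (2 `^ 0)%R); first by rewrite powRr0.
by apply: ler_powR; [rewrite ler1n|lra].
Qed.

Lemma level_sub_le f g : power_finite P f -> power_finite P g ->
  level P K (fun x => f x - g x)%R <=
  level_const%:E * (level P K f + level P K g).
Proof.
move=> Ff Fg; have mf := Ff.1; have mg := Fg.1.
have k00 := exponents_k0 PK.
have : (level_const `^ k0 = 2 `^ (p1 + 1))%R.
  by rewrite /level_const -powRrM mulVf ?gt_eqF// powRr1 ?powR_ge0.
move: level_const level_const_ge1 => C C1 Cl.
have [a fa] : exists a : R, level P K f = a%:E.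
  by case: (level P K f) (level_ge0 f) (level_fin Ff) => [r||]//; exists r.
have [b gb] : exists b : R, level P K g = b%:E.
  by case: (level P K g) (level_ge0 g) (level_fin Fg) => [r||]//; exists r.
rewrite fa gb -EFinD -EFinM; apply/lee_addgt0Pr => e e0; rewrite -EFinD.
pose h := (e / C / 2)%R.
have C0 : (0 < C)%R by lra.
have h0 : (0 < h)%R by rewrite !divr_gt0.
have [|l0 Jl] := @level_lt f (a + h)%R mf; first by rewrite fa lte_fin ltrDl.
have [|s0 Js] := @level_lt g (b + h)%R mg; first by rewrite gb lte_fin ltrDl.
have -> : (C * (a + b) + e = C * ((a + h) + (b + h)))%R.
  by rewrite /h; field; rewrite gt_eqF.
move: (a + h)%R (b + h)%R l0 Jl s0 Js => l s l0 Jl s0 Js.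
have mfg : measurable_fun [set: T] (fun x => f x - g x)%R by exact: measurable_funB.
have ls0 : (0 < C * (l + s))%R by apply: mulr_gt0; [exact: C0|exact: addr_gt0].
apply: (level_le ls0).
pose D := (2 `^ p1 * C `^ (- k0))%R.
have D0 : (0 <= D)%R by rewrite mulr_ge0 ?powR_ge0.
have DE : (D + D = 1)%R.
  rewrite /D powRN Cl powRD; last by apply/implyP => _; rewrite gt_eqF.
  by rewrite powRr1//; field; rewrite gt_eqF ?powR_gt0.
apply: (@le_trans _ _ (D%:E * power_int P (dilate K l f) + D%:E * power_int P (dilate K s g))).
  have mlf := measurable_dilate l mf; have msg := measurable_dilate s mg.
  rewrite !power_intE -nonneg_integral_lin//; try exact: nonneg_mfun_powR.
  apply: nonneg_integral_le.
  - by apply: nonneg_mfun_powR => //; exact: measurable_dilate.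
  - by apply: nonneg_mfun_lin => //; exact: nonneg_mfun_powR.
  apply: aeW => x; rewrite !powR_dilate//.
  have P0 := P_gt0 x; have /andP[_ Pp] := exponents_P PK x.
  set u := (`|f x|)%R; set v := (`|g x|)%R.
  have fg : (`|f x - g x| `^ P x <= 2 `^ p1 * (u `^ P x + v `^ P x))%R.
    set w := (Num.max u v).
    have w0 : (0 <= w)%R by rewrite le_max normr_ge0.
    apply: (@le_trans _ _ ((2 * w) `^ P x)%R).
      apply: ge0_ler_powR; rewrite ?nnegrE ?(ltW P0)// ?mulr_ge0//.
      apply: (le_trans (ler_normB _ _)); rewrite -/u -/v.
      have uw : (u <= w)%R by rewrite le_max lexx.
      have vw : (v <= w)%R by rewrite le_max lexx orbT.
      by lra.
    rewrite powRM//; apply: ler_pM; rewrite ?powR_ge0//.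
      by rewrite ler_powR// ler1n.
    by rewrite /w; case: (leP u v) => _; rewrite ?lerDr ?lerDl powR_ge0.
  have scal t : (0 < t)%R -> (t <= l + s)%R ->
      ((C * (l + s)) `^ (- (K x * P x)) <= C `^ (- k0) * t `^ (- (K x * P x)))%R.
    move=> t0 tl; rewrite powRM ?addr_ge0 ?(ltW l0) ?(ltW s0) ?(ltW C0)//.
    apply: ler_pM; rewrite ?powR_ge0//.
      by apply: ler_powR => //; rewrite lerN2; exact: KP_ge.
    rewrite !powRN lef_pV2 ?posrE ?powR_gt0//; last exact: lt_le_trans tl.
    apply: ge0_ler_powR; rewrite ?nnegrE ?(ltW t0) ?addr_ge0 ?(ltW l0) ?(ltW s0)//.
    by rewrite (le_trans (ltW k00)) ?KP_ge.
  apply: (@le_trans _ _ ((C * (l + s)) `^ (- (K x * P x)) * (2 `^ p1 * (u `^ P x + v `^ P x)))%R).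
    by rewrite ler_wpM2l ?powR_ge0.
  rewrite [leLHS](_ : _ = 2 `^ p1 * ((C * (l + s)) `^ (- (K x * P x)) * u `^ P x) +
    2 `^ p1 * ((C * (l + s)) `^ (- (K x * P x)) * v `^ P x))%R; last by ring.
  rewrite /D -!mulrA; apply: lerD.
    rewrite ler_wpM2l ?powR_ge0// mulrA ler_wpM2r ?powR_ge0//.
    by apply: scal => //; rewrite lerDl ltW.
  rewrite ler_wpM2l ?powR_ge0// mulrA ler_wpM2r ?powR_ge0//.
  by apply: scal => //; rewrite lerDr ltW.
have DJ (t : \bar R) : t <= 1 -> D%:E * t <= D%:E.
  by move=> t1; rewrite -[leRHS]mule1 lee_wpmul2l// lee_fin.
by rewrite -[leRHS]/(1%:E) -DE EFinD; exact: leeD (DJ _ Jl) (DJ _ Js).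
Qed.
End modular.

(** * Convexity inequalities for powers in a form that can be integrated *)

Section convexity.
Context {R : realType}.
Implicit Types (p t x y : R).

Lemma powR_convex p t x y : 1 <= p -> 0 <= t <= 1 -> 0 <= x -> 0 <= y ->
  (t * x + (1 - t) * y) `^ p <= t * x `^ p + (1 - t) * y `^ p.
Proof.
move=> p1 /andP[t0 t1] x0 y0.
by apply: (convex_powR p1 (Itv01 t0 t1)); rewrite ?inE/= in_itv/= andbT.
Qed.

Lemma powR_mid_le p x y : 1 <= p ->
  `|(x + y) / 2| `^ p <= (`|x| `^ p + `|y| `^ p) / 2.
Proof.
move=> p1.
have t01 : 0 <= (2^-1 : R) <= 1 by lra.
have := powR_convex p1 t01 (normr_ge0 x) (normr_ge0 y).
have -> : 1 - 2^-1 = 2^-1 :> R by lra.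
rewrite -!mulrDr mulrC [leRHS]mulrC; apply: le_trans.
apply: ge0_ler_powR; rewrite ?nnegrE ?mulr_ge0 ?addr_ge0//; first by lra.
by rewrite normrM ler_pM ?ler_normD// ger0_norm.
Qed.

Lemma powR_normD_le p x y : 0 < p ->
  (`|x| + `|y|) `^ p <= 2 `^ p * (`|x| `^ p + `|y| `^ p).
Proof.
move=> p0; set w := Num.max `|x| `|y|.
have w0 : 0 <= w by rewrite le_max normr_ge0.
apply: (@le_trans _ _ ((2 * w) `^ p)).
  apply: ge0_ler_powR; rewrite ?nnegrE ?(ltW p0) ?mulr_ge0 ?addr_ge0//.
  have xw : `|x| <= w by rewrite le_max lexx.
  have yw : `|y| <= w by rewrite le_max lexx orbT.
  by lra.
rewrite powRM// ler_wpM2l ?powR_ge0//.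
by rewrite /w; case: (leP `|x| `|y|) => _; rewrite ?lerDr ?lerDl powR_ge0.
Qed.

Lemma powR_gt1 (x p : R) : 1 < x -> 0 < p -> 1 < x `^ p.
Proof.
move=> x1 p0; rewrite /powR gt_eqF; last by lra.
by rewrite -expR0 ltr_expR mulr_gt0 ?ln_gt0.
Qed.
(** Uniform convexity without a separation hypothesis: if [|x - y|] is small against [|x| + |y|],
    then [|x - y| ^ p] is absorbed by the terms with [del * e], and plain convexity is enough. *)
Lemma powR_mid_sub_le (p0 p1 e : R) : 1 < p0 -> 0 < e ->
  exists2 del : R, 0 < del <= 1 & forall p x y, p0 <= p <= p1 ->
    `|(x + y) / 2| `^ p + del * `|x - y| `^ p <=
    (2^-1 + del * e) * `|x| `^ p + (2^-1 + del * e) * `|y| `^ p.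
Proof.
move=> p01 e0.
have [tp tp1 tpP] : exists2 tp : R, 1 <= tp & forall p, p <= p1 -> 2 `^ p <= tp.
  exists (Num.max 1 (2 `^ p1)) => [|p pp]; first by rewrite le_max lexx.
  by rewrite le_max; apply/orP; right; apply: ler_powR; rewrite ?ler1n.
(* [tp] bounds [2 ^ p]; since [e2 <= 1] gives [e2 ^ p <= e2], the condition [e2 * tp <= e] makes
   close pairs satisfy [|x - y| ^ p <= e (|x| ^ p + |y| ^ p)]. *)
have [e2 e20 e21] : exists2 e2 : R, 0 < e2 <= 1 & e2 * tp <= e.
  exists (Num.min 1 (e / tp)); last by rewrite -ler_pdivlMr ?ge_min ?lexx ?orbT//; lra.
  by rewrite lt_min ltr01 ge_min lexx /= divr_gt0//; lra.
have e2_gt0 : 0 < e2 by lra.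
have [del1 del10 uc] := @powR_uniformly_convex R p0 p1 e2 p01 e2_gt0.
have [de de0 ded] : exists2 de : R, 0 < de <= 1 & de * tp <= del1.
  exists (Num.min 1 (del1 / tp)); last by rewrite -ler_pdivlMr ?ge_min ?lexx ?orbT//; lra.
  by rewrite lt_min ltr01 ge_min lexx /= divr_gt0//; lra.
have de_gt0 : 0 < de by lra.
exists de => // p x y pI; have Px0 : 0 < p by lra.
have fp := powR_ge0 `|x| p; have gp := powR_ge0 `|y| p.
have tP : 2 `^ p <= tp by apply: tpP; lra.
have S : (`|x| + `|y|) `^ p <= tp * (`|x| `^ p + `|y| `^ p).
  apply: (le_trans (powR_normD_le x y Px0)).
  by rewrite ler_wpM2r// addr_ge0.
have s0 := addr_ge0 fp gp.
have [bad|good] := leP (e2 * (`|x| + `|y|)) `|x - y|.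
  have := uc _ _ _ pI bad.
  have : `|x - y| `^ p <= tp * (`|x| `^ p + `|y| `^ p).
    apply: le_trans S; apply: ge0_ler_powR; rewrite ?nnegrE ?(ltW Px0)// ?addr_ge0//.
    exact: ler_normB.
  move=> /(ler_wpM2l (ltW de_gt0)).
  have : de * (tp * (`|x| `^ p + `|y| `^ p)) <= del1 * (`|x| `^ p + `|y| `^ p).
    by rewrite mulrA ler_wpM2r.
  have : 0 <= de * e * (`|x| `^ p + `|y| `^ p).
    by rewrite !mulr_ge0// ltW.
  move: (`|x| `^ p) (`|y| `^ p) (`|x - y| `^ p) (`|(x + y) / 2| `^ p) => u v w z.
  by lra.
have := powR_mid_le x y (_ : 1 <= p).
have : `|x - y| `^ p <= e * (`|x| `^ p + `|y| `^ p).
  apply: (@le_trans _ _ ((e2 * (`|x| + `|y|)) `^ p)).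
    by apply: ge0_ler_powR; rewrite ?nnegrE ?(ltW Px0) ?mulr_ge0 ?addr_ge0 ?(ltW e2_gt0) ?(ltW good).
  rewrite powRM ?addr_ge0 ?(ltW e2_gt0)//.
  apply: (@le_trans _ _ (e2 * (tp * (`|x| `^ p + `|y| `^ p)))); last first.
    by rewrite mulrA ler_wpM2r.
  apply: ler_pM; rewrite ?powR_ge0//.
  rewrite -[leRHS]powRr1 ?(ltW e2_gt0)//; apply: ger_powR => //.
  by lra.
move=> /(ler_wpM2l (ltW de_gt0)) h1 /(_ _) h2.
have {}h2 := h2 ltac:(lra).
move: h1 h2.
move: (`|x| `^ p) (`|y| `^ p) (`|x - y| `^ p) (`|(x + y) / 2| `^ p) => u v w z.
by lra.
Qed.

Lemma powR_near1 (p y : R) : 0 < p -> 1 < y ->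
  exists2 eta : R, 0 < eta <= 2^-1 & forall a, 1 <= a <= 1 + eta -> a `^ p <= y.
Proof.
move=> p0 y1.
have y2 : 1 < y `^ p^-1 by rewrite powR_gt1// invr_gt0.
exists (Num.min 2^-1 (y `^ p^-1 - 1)).
  by rewrite lt_min invr_gt0 ltr0n ge_min lexx /= subr_gt0 y2.
move=> a /andP[a1 ay].
have {}ay : a <= y `^ p^-1.
  have : Num.min 2^-1 (y `^ p^-1 - 1) <= y `^ p^-1 - 1 by rewrite ge_min lexx orbT.
  by move: ay; move: (Num.min 2^-1 (y `^ p^-1 - 1)) (y `^ p^-1) => u v; lra.
apply: (@le_trans _ _ ((y `^ p^-1) `^ p)).
  by apply: ge0_ler_powR; rewrite ?nnegrE ?powR_ge0 ?(ltW p0)//; lra.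
by rewrite -powRrM mulVf ?gt_eqF// powRr1//; lra.
Qed.
End convexity.

Section vals.
Context d (T : measurableType d) (R : realType) (mu : {measure set T -> \bar R}).

(** Meaningful for functions in [power_finite]: [fine] sends [+oo] to 0. *)
Definition power_val (P f : T -> R) : R := fine (power_int mu P f).
Definition level_val (P K f : T -> R) : R := fine (level mu P K f).

Lemma power_valE P f : power_val P f = fine (power_int mu P f). Proof. by []. Qed.
Lemma level_valE P K f : level_val P K f = fine (level mu P K f). Proof. by []. Qed.
End vals.

(** * Levels of a sum and a difference: nearly equal levels *)

Section levels.
Context d (T : measurableType d) (R : realType) (mu : {measure set T -> \bar R}).
Variables (P K : T -> R) (p0 p1 k0 k1 : R).
Hypothesis PK : exponents P K p0 p1 k0 k1.
Implicit Types (f g h F G : T -> R).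

Local Notation J := (power_val mu P).
Local Notation lev := (level_val mu P K).
Let PF h := power_finite mu P h.

Lemma power_int_fineK h : PF h -> power_int mu P h = (J h)%:E.
Proof.
move=> [mh Jh]; rewrite power_valE; have := power_int_ge0 mu PK mh.
by case: (power_int mu P h) Jh.
Qed.

Lemma level_fineK h : PF h -> level mu P K h = (lev h)%:E.
Proof.
move=> Fh; rewrite level_valE; have := level_ge0 mu P K h; have := level_fin PK Fh.
by case: (level mu P K h).
Qed.

Lemma level_val_ge0 h : 0 <= lev h.
Proof.
by rewrite level_valE; have := level_ge0 mu P K h; case: (level mu P K h).
Qed.

(** The gate through which pointwise convexity estimates reach the integrals; the coefficients have
    to be constant in [x]. *)
Lemma power_comb h h' F G (al be ga : R) : PF h -> PF h' -> PF F -> PF G ->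
  0 <= al -> 0 <= be -> 0 <= ga ->
  {ae mu, forall x, `|h x| `^ P x + al * `|h' x| `^ P x <=
                    be * `|F x| `^ P x + ga * `|G x| `^ P x} ->
  J h + al * J h' <= be * J F + ga * J G.
Proof.
move=> Fh Fh' FF FG al0 be0 ga0 ae_le.
have mP := exponents_mP PK.
have nn u : PF u -> nonneg_mfun (fun x => `|u x| `^ P x).
  by move=> [mu' _]; exact: nonneg_mfun_powR.
have h1 := nonneg_integral_lin mu (nn _ Fh) (nn _ Fh') ler01 al0.
have h2 := nonneg_integral_lin mu (nn _ FF) (nn _ FG) be0 ga0.
have : (1%:E * power_int mu P h + al%:E * power_int mu P h' <=
    be%:E * power_int mu P F + ga%:E * power_int mu P G)%E.
  rewrite !power_intE -h1 -h2; apply: nonneg_integral_le.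
  - by apply: nonneg_mfun_lin; [exact: nn|exact: nn|exact: ler01|exact: al0].
  - by apply: nonneg_mfun_lin; [exact: nn|exact: nn|exact: be0|exact: ga0].
  - by apply: filterS ae_le => x; rewrite mul1r.
rewrite (power_int_fineK Fh) (power_int_fineK Fh') (power_int_fineK FF) (power_int_fineK FG).
by rewrite -!EFinM -!EFinD lee_fin mul1r.
Qed.

Lemma power_finite_mid f g : PF f -> PF g -> PF (fun x => (f x + g x) / 2).
Proof.
move=> Ff Fg; have := power_finite_lin PK 2^-1 2^-1 Ff Fg.
congr (power_finite mu P); apply/funext => x; lra.
Qed.

Lemma power_finite_sub f g : PF f -> PF g -> PF (fun x => f x - g x).
Proof.
move=> Ff Fg; have := power_finite_lin PK 1 (- 1) Ff Fg.
congr (power_finite mu P); apply/funext => x; lra.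
Qed.

Lemma p1_gt1 : 1 < p1.
Proof. by have := exponents_p0 PK; have := exponents_P PK point; lra. Qed.

Lemma dilate_level_fine f a : PF f -> 0 < a -> lev f = a -> J (dilate K a f) = 1.
Proof.
move=> Ff a0 fa; rewrite power_valE (@level_attained _ _ _ mu _ _ _ _ _ _ PK f a)//.
by rewrite -fa; exact: (level_fineK Ff).
Qed.

Lemma level_val_lt f l : PF f -> lev f < l -> 0 < l /\ J (dilate K l f) <= 1.
Proof.
move=> Ff fl; have [|l0 Jl] := @level_lt _ _ _ mu _ _ _ _ _ _ PK f l Ff.1.
  by rewrite (level_fineK Ff) lte_fin.
split; first exact: l0.
by move: Jl; rewrite (power_int_fineK (power_finite_dilate PK l0 Ff)) lee_fin.
Qed.

Lemma dilateVK l f : 0 < l -> dilate K l^-1 (dilate K l f) = f.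
Proof.
move=> l0; have lV0 : 0 < l^-1 by rewrite invr_gt0.
by rewrite -(dilateM K f l0 lV0) mulVf ?lt0r_neq0// dilate1.
Qed.

Lemma power_dilate_le1 s f : PF f -> 0 < s <= 1 -> J (dilate K s f) <= s `^ (- p1) * J f.
Proof.
move=> Ff s01; have s0 : 0 < s by case/andP: s01.
have := power_int_dilate_le1 mu PK Ff.1 s01.
by rewrite (power_int_fineK Ff) (power_int_fineK (power_finite_dilate PK s0 Ff)) -EFinM lee_fin.
Qed.

Lemma power_dilate_ge1 s f : PF f -> 1 <= s -> J (dilate K s f) <= J f.
Proof.
move=> Ff s1; have s0 : 0 < s by lra.
have := power_int_dilate_le mu PK Ff.1 s1.
by rewrite (power_int_fineK Ff) (power_int_fineK (power_finite_dilate PK s0 Ff)) lee_fin.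
Qed.

Lemma power_level_ge1 f a : PF f -> 1 <= a -> lev f = a -> J f <= a `^ p1.
Proof.
move=> Ff a1 fa; have a0 : 0 < a by lra.
rewrite -{1}(dilateVK f a0).
apply: (le_trans (power_dilate_le1 (power_finite_dilate PK a0 Ff) _)).
  by rewrite invr_gt0 a0 invf_le1.
rewrite (dilate_level_fine Ff a0 fa) mulr1 -(powR_inv1 (ltW a0)) -powRrM mulN1r.
by rewrite opprK.
Qed.

Lemma power_level_le1 f b : PF f -> 0 < b <= 1 -> lev f = b -> J f <= 1.
Proof.
move=> Ff /andP[b0 b1] fb; rewrite -{1}(dilateVK f b0).
apply: (le_trans (power_dilate_ge1 (power_finite_dilate PK b0 Ff) _)).
  by rewrite invf_ge1.
by rewrite (dilate_level_fine Ff b0 fb).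
Qed.

Lemma power_level_gt f l : PF f -> 0 < l <= 1 -> l < lev f -> l `^ p1 <= J f.
Proof.
move=> Ff /andP[l0 l1] lf; rewrite leNgt; apply/negP => Jf.
move: lf; rewrite ltNge => /negP; apply.
have := @level_le _ _ _ mu P K f l l0.
rewrite (level_fineK Ff) (power_int_fineK (power_finite_dilate PK l0 Ff)) !lee_fin.
apply; apply: (le_trans (power_dilate_le1 Ff _)); first by rewrite l0.
by rewrite powRN ler_pdivrMl ?powR_gt0// mulr1 ltW.
Qed.

(* Nearly equal levels: only the uniform convexity of the powers is needed. *)
Lemma power_mid_near (e : R) : 0 < e < 1 -> exists2 eta, 0 < eta < 1 & exists2 del, 0 < del < 1 &
  forall f g a b, PF f -> PF g -> lev f = a -> lev g = b -> a + b = 2 ->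
    1 <= a <= 1 + eta -> e < lev (fun x => f x - g x) ->
    J (fun x => (f x + g x) / 2) <= 1 - del.
Proof.
move=> /andP[e0 e1]; have p1_1 := p1_gt1; have p01 := exponents_p0 PK.
have p1_0 : 0 < p1 by lra.
have [ep ep0 epP] : exists2 ep : R, 0 < ep <= 1 &
    forall f, PF f -> e < lev f -> ep <= J f.
  exists (e `^ p1) => [|f Ff ef]; last by apply: power_level_gt; rewrite ?e0 ?ltW.
  rewrite powR_gt0//=; apply: (@le_trans _ _ (1 `^ p1)); last by rewrite powR1.
  by apply: ge0_ler_powR; rewrite ?nnegrE ?(ltW p1_0)// ltW.
(* With [w = de * ep <= 1], the excesses [w / 12] in the coefficients and [w / 2] in the integral of
   [f] cost at most [w / 4 + w / 6 + w / 24], that is [11 w / 24]. More than half of the gain [w]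
   remains. *)
have [|de de0 pw] := @powR_mid_sub_le R p0 p1 (ep / 12) p01; first by lra.
have dep0 : 0 < de * ep by rewrite mulr_gt0//; lra.
have dep1 : de * ep <= 1 by rewrite mulr_ile1//; lra.
have [|eta eta0 etaP] := @powR_near1 R p1 (1 + de * ep / 2) p1_0; first by lra.
exists eta; first by lra.
exists (de * ep / 2); first by lra.
have ble a b : a + b = 2 -> 1 <= a <= 1 + eta -> 0 < b <= 1 by lra.
have de_ge0 : 0 <= de by lra.
have c0 : 0 <= 2^-1 + de * (ep / 12) by lra.
have dep2 : (de * ep) * (de * ep) <= de * ep by rewrite ler_piMl// ltW.
have fin u v w z : ep <= w -> u <= 1 + de * ep / 2 -> v <= 1 ->
    z + de * w <= (2^-1 + de * (ep / 12)) * u + (2^-1 + de * (ep / 12)) * v ->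
    z <= 1 - de * ep / 2.
  move=> /(ler_wpM2l de_ge0) + /(ler_wpM2l c0) + /(ler_wpM2l c0).
  by move=> h1 h2 h3 h4; lra.
move=> f g a b Ff Fg fa gb ab aeta fge.
have b0 := ble _ _ ab aeta.
have a1 : 1 <= a by case/andP: aeta.
have Jf := le_trans (power_level_ge1 Ff a1 fa) (etaP _ aeta).
have Jg := power_level_le1 Fg b0 gb.
have Ffg := power_finite_sub Ff Fg; have Fm := power_finite_mid Ff Fg.
have Jd := epP _ Ffg fge.
have := power_comb Fm Ffg Ff Fg de_ge0 c0 c0 _.
move=> /(_ (aeW mu (fun x => pw _ _ _ (exponents_P PK x)))).
exact: (fin _ _ _ _ Jd Jf Jg).
Qed.
End levels.

(** * Levels away from 1 and from 0, and levels close to 0 *)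

Section far.
Context d (T : measurableType d) (R : realType) (mu : {measure set T -> \bar R}).
Variables (P K : T -> R) (p0 p1 k0 k1 c : R).
Hypothesis PK : exponents P K p0 p1 k0 k1.
Implicit Types (f g h F G : T -> R) (a b : R).

Local Notation J := (power_val mu P).
Local Notation lev := (level_val mu P K).
Local Notation PF := (power_finite mu P).

Hypothesis disc_ok : forall f, PF f ->
  {ae mu, forall x, ~ disc_le (P x) (K x) c -> f x = 0}.

Lemma mid_dilate_le f g a b x : 0 < a -> 0 < b ->
  `|(f x + g x) / 2| `^ P x <=
  ((a `^ K x * `|dilate K a f x| + b `^ K x * `|dilate K b g x|) / 2) `^ P x.
Proof.
move=> a0 b0; have Px := P_gt0 PK x.
have e h l : 0 < l -> `|h x| = l `^ K x * `|dilate K l h x|.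
  move=> l0; rewrite dilateE normrM mulrC normfV (ger0_norm (powR_ge0 _ _)) divfK//.
  by rewrite gt_eqF// powR_gt0.
rewrite -(e _ _ a0) -(e _ _ b0).
apply: ge0_ler_powR; rewrite ?nnegrE ?(ltW Px) ?divr_ge0 ?addr_ge0//.
by rewrite normrM ler_pM ?ler_normD// ger0_norm.
Qed.

(** Both dilations have integral 1, so a pointwise inequality with constant weights turns into one
    between numbers. The boolean selects the dilation that carries the gain. Where the discriminant
    condition fails, [f] and [g] vanish almost everywhere. *)
Lemma power_mid_comb (i : bool) f g a b (al be ga : R) : PF f -> PF g -> 0 < a -> 0 < b ->
  lev f = a -> lev g = b -> 0 <= al -> 0 <= be -> 0 <= ga ->
  (forall x, disc_le (P x) (K x) c ->
    ((a `^ K x * `|dilate K a f x| + b `^ K x * `|dilate K b g x|) / 2) `^ P x +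
    al * `|(if i then dilate K a f else dilate K b g) x| `^ P x <=
    be * `|dilate K a f x| `^ P x + ga * `|dilate K b g x| `^ P x) ->
  J (fun x => (f x + g x) / 2) + al <= be + ga.
Proof.
move=> Ff Fg a0 b0 fa gb al0 be0 ga0 pw.
have FF := power_finite_dilate PK a0 Ff; have FG := power_finite_dilate PK b0 Fg.
have Fm := power_finite_mid PK Ff Fg.
have JF := dilate_level_fine PK Ff a0 fa; have JG := dilate_level_fine PK Fg b0 gb.
have Fi : PF (if i then dilate K a f else dilate K b g) by case: i {pw}.
have Ji : J (if i then dilate K a f else dilate K b g) = 1 by case: i {pw Fi}.
have := power_comb PK Fm Fi FF FG al0 be0 ga0 _.
rewrite Ji JF JG !mulr1; apply.
move: (disc_ok Ff) (disc_ok Fg); apply: filterS2 => x fx gx.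
have [dle|/[dup] /fx fx0 /gx gx0] := pselect (disc_le (P x) (K x) c).
  by apply: le_trans (pw x dle); rewrite lerD2r; exact: mid_dilate_le.
have PN0 : P x != 0 by rewrite gt_eqF// (P_gt0 PK).
have -> : (if i then dilate K a f else dilate K b g) x = 0.
  by case: i {pw Fi Ji}; rewrite dilateE ?fx0 ?gx0 mul0r.
by rewrite fx0 gx0 addr0 mul0r normr0 powR0// mulr0 addr0 addr_ge0// mulr_ge0// powR_ge0.
Qed.

Lemma power_mid_le1_gt1 f g a b : PF f -> PF g -> lev f = a -> lev g = b ->
  a + b = 2 -> 1 < a < 2 -> J (fun x => (f x + g x) / 2) <= 1.
Proof.
move=> Ff Fg fa gb ab /andP[a1 a2].
have a0 : 0 < a by exact: lt_trans a1.
have bE : b = 2 - a by rewrite -ab addrAC subrr add0r.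
have b0 : 0 < b by rewrite bE subr_gt0.
(* [theta] depends on neither exponent, so its bounds may be taken from the lemmas at [p = 2],
   [k = 0]. *)
have p2 : (1 : R) < 2 by rewrite ltr1n.
have th0 := @theta_gt0 R 2 0 c a p2 a1 a2; have th1 := @theta_lt1 R 2 0 c a p2 a1 a2.
have := @power_mid_comb true f g a b 0 (theta c a) (1 - theta c a) Ff Fg a0 b0 fa gb (lexx 0) (ltW th0).
rewrite (_ : theta c a + (1 - theta c a) = 1); last by rewrite addrC subrK.
rewrite subr_ge0 (ltW th1) addr0 => /(_ isT); apply => x dle.
by rewrite mul0r addr0 bE; apply: midpoint_le => //; exact: P_gt1 PK x.
Qed.

(* Where [u <= (1 + del) * v] fails the extra term [del * (v - u / (1 + del))]
   is negative, so the gain on that set integrates to a gain everywhere. *)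
Lemma power_mid_far (a0 a1 : R) : 1 < a0 -> a1 < 2 -> exists2 del : R, 0 < del &
  forall f g a b, PF f -> PF g -> lev f = a -> lev g = b -> a + b = 2 ->
    a0 <= a <= a1 -> J (fun x => (f x + g x) / 2) <= 1 - del.
Proof.
move=> a01 a12.
have p01 := exponents_p0 PK; have k00 := exponents_k0 PK; have k11 := exponents_k1 PK.
have p2 : (1 : R) < 2 by rewrite ltr1n.
have bound a b : a + b = 2 -> a0 <= a <= a1 -> [/\ 1 < a, a < 2, 0 < a, 0 < b & b = 2 - a].
  by move=> ab /andP[a0a aa1]; split; lra.
have gainE (del : R) : 0 < del ->
    [/\ 0 <= del / (1 + del), 0 < del - del / (1 + del) & del / (1 + del) <= del].
  move=> d0; have d1 : 0 < 1 + del by lra.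
  have e : del - del / (1 + del) = del * del / (1 + del) by field; rewrite gt_eqF.
  have d2 : 0 < del - del / (1 + del) by rewrite e divr_gt0// mulr_gt0.
  by split; [rewrite divr_ge0// ltW|exact: d2|rewrite -subr_ge0 ltW].
have key (del u v w th : R) : 0 < del -> 0 <= u -> 0 <= v ->
    (u <= (1 + del) * v -> w + del * v <= th) -> w <= th ->
    w + del * v <= th + del / (1 + del) * u.
  move=> d0 u0 v0 h1 h2; have [/h1 h|h] := leP u ((1 + del) * v).
    by rewrite (le_trans h)// lerDl mulr_ge0// divr_ge0//; lra.
  apply: lerD => //; rewrite mulrAC -mulrA ler_pM2l// ler_pdivlMr; last by lra.
  by rewrite mulrC ltW.
have fin1 (z t s del : R) : z + del <= t + s + (1 - t) -> z <= 1 - (del - s) by lra.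
have fin2 (z t s del : R) : z + del <= t + (1 - t + s) -> z <= 1 - (del - s) by lra.
(* The sign of [c] decides which function carries the gain: [g], of smaller level, for [c >= 0], and
   [f] for [c <= 0]. *)
have [c0|/ltW c0] := leP 0 c.
- have [del del0 gap0] := @midpoint_gap_ge0 R c p0 p1 k0 k1 a0 a1 p01 k00 k11 a01 a12 c0.
  have [q0 q1 q2] := gainE _ del0; exists (del - del / (1 + del)) => //.
  move=> f g a b Ff Fg fa gb ab aI; have [a1' a2' a_gt0 b_gt0 bE] := bound _ _ ab aI.
  have th0 := @theta_gt0 R 2 0 c a p2 a1' a2'; have th1 := @theta_lt1 R 2 0 c a p2 a1' a2'.
  have be0 : 0 <= theta c a + del / (1 + del) by rewrite addr_ge0// ltW.
  have ga0 : 0 <= 1 - theta c a by rewrite subr_ge0 ltW.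
  have := @power_mid_comb false f g a b del _ _ Ff Fg a_gt0 b_gt0 fa gb (ltW del0) be0 ga0.
  move=> H; apply: fin1; apply: H => x dle; rewrite bE [X in _ <= X + _]mulrDl.
  rewrite [leRHS]addrAC.
  apply: (key del (`|dilate K a f x| `^ P x) (`|dilate K (2 - a) g x| `^ P x) _ _ del0 (powR_ge0 _ _) (powR_ge0 _ _)).
    move=> h; apply: gap0 => //; [exact: exponents_P PK x|exact: exponents_K PK x].
  by apply: midpoint_le => //; exact: P_gt1 PK x.
- have [del del0 gap0] := @midpoint_gap_le0 R c p0 p1 k0 k1 a0 a1 p01 k00 k11 a01 a12 c0.
  have [q0 q1 q2] := gainE _ del0; exists (del - del / (1 + del)) => //.
  move=> f g a b Ff Fg fa gb ab aI; have [a1' a2' a_gt0 b_gt0 bE] := bound _ _ ab aI.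
  have th0 := @theta_gt0 R 2 0 c a p2 a1' a2'; have th1 := @theta_lt1 R 2 0 c a p2 a1' a2'.
  have be0 : 0 <= (1 - theta c a) + del / (1 + del) by rewrite addr_ge0// subr_ge0 ltW.
  have := @power_mid_comb true f g a b del _ _ Ff Fg a_gt0 b_gt0 fa gb (ltW del0) (ltW th0) be0.
  move=> H; apply: fin2; apply: H => x dle; rewrite bE [X in _ <= _ + X]mulrDl.
  rewrite [leRHS]addrA.
  apply: (key del (`|dilate K (2 - a) g x| `^ P x) (`|dilate K a f x| `^ P x) _ _ del0 (powR_ge0 _ _) (powR_ge0 _ _)).
    move=> h; apply: gap0 => //; [exact: exponents_P PK x|exact: exponents_K PK x].
  by apply: midpoint_le => //; exact: P_gt1 PK x.
Qed.

(** As [a] tends to 2 the compactness argument is lost. Instead, [a <= 2] bounds the contribution of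
    [f] to the midpoint by [2 ^ k1 / 2 < 1] times its dilation, and [g] contributes little because
    its level is small. *)
Lemma power_mid_small : exists2 be : R, 0 < be < 1 & exists2 del : R, 0 < del &
  forall f g a b, PF f -> PF g -> lev f = a -> lev g = b -> a + b = 2 ->
    0 <= b < be -> J (fun x => (f x + g x) / 2) <= 1 - del.
Proof.
have k00 := exponents_k0 PK; have k11 := exponents_k1 PK.
pose ka : R := 2 `^ k1 / 2.
have ka0 : 0 < ka by rewrite divr_gt0// powR_gt0.
have ka1 : ka < 1.
  rewrite ltr_pdivrMr// mul1r -[ltRHS](@powRr1 R)// /powR gt_eqF// ltr_expR.
  by rewrite ltr_pM2r ?ln_gt0 ?ltr1n.
have kaP a k : 1 <= a -> a <= 2 -> 0 <= k <= k1 -> a `^ k <= ka * 2.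
  move=> a1 a2 /andP[k_ge0 kk1]; rewrite /ka divfK//.
  apply: (@le_trans _ _ (2 `^ k)).
    by apply: ge0_ler_powR; rewrite ?nnegrE//; lra.
  by apply: ler_powR; rewrite ?ler1n.
move: ka ka0 ka1 kaP => ka ka0 ka1 kaP.
(* The weight of [f] in a convex combination: halfway between [ka] and 1, so that both [ka / s] and
   [1 - s] are below 1. *)
pose s := (1 + ka) / 2.
have s01 : 0 < s < 1 by rewrite /s; lra.
have kas : 0 < ka / s < 1.
  by rewrite divr_gt0 ?(andP s01).1//= ltr_pdivrMr ?(andP s01).1// mul1r /s; lra.
have ss1 : 0 < 1 - s < 1 by lra.
have sE : ka + (1 - s) * 2^-1 = 1 - 3 / 4 * (1 - ka) by rewrite /s; lra.
have sK : s * (ka / s) = ka by rewrite mulrC divfK// gt_eqF ?(andP s01).1.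
move: s s01 kas ss1 sE sK => s /andP[s0 s1] /andP[kas0 kas1] /andP[t0 t1] sE sK.
(* Chosen so that [be ^ K x <= 1 - s] for every [K x >= k0]. *)
pose be := (1 - s) `^ k0^-1.
have be0 : 0 < be by rewrite powR_gt0.
have be1 : be < 1.
  apply: (@lt_le_trans _ _ (1 `^ k0^-1)); last by rewrite powR1.
  by apply: gt0_ltr_powR; rewrite ?nnegrE ?invr_gt0// ltW.
have beP k : k0 <= k <= k1 -> be `^ k <= (1 - s).
  move=> /andP[k0k _]; apply: (@le_trans _ _ (be `^ k0)).
    by apply: ger_powR => //; rewrite be0 ltW.
  by rewrite /be -powRrM mulVf ?gt_eqF// powRr1// ltW.
move: be be0 be1 beP => be be0 be1 beP.
exists be; first by rewrite be0.
exists (3 / 4 * (1 - ka)); first by rewrite mulr_gt0// subr_gt0.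
have fin3 (z w ku v s' t : R) : z <= ku * 2 * t -> w <= (1 - s') * v ->
    (z + w) / 2 <= ku * t + (1 - s') * (2^-1 * v) by lra.
have a12 a b : a + b = 2 -> 0 <= b < be -> 1 <= a <= 2 by lra.
move=> f g a b Ff Fg fa gb ab bI.
have /andP[a1 a2] := a12 _ _ ab bI.
have a0 : 0 < a by exact: lt_le_trans a1.
(* The level [b] may be 0, so [g] is dilated by the bound [be] and its integral is at most 1 rather
   than equal to 1. *)
have FF := power_finite_dilate PK a0 Ff; have FG := power_finite_dilate PK be0 Fg.
have Fm := power_finite_mid PK Ff Fg.
have JF := dilate_level_fine PK Ff a0 fa.
have [_ JG] : 0 < be /\ J (dilate K be g) <= 1.
  by apply: (level_val_lt PK) => //; rewrite gb; case/andP: bI.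
have half0 : 0 <= (1 - s) * 2^-1 by rewrite mulr_ge0// ltW.
have := power_comb PK Fm Fm FF FG (lexx 0) (ltW ka0) half0 _.
rewrite JF mul0r addr0 mulr1 => H; rewrite -sE.
apply: (@le_trans _ _ (ka + (1 - s) * 2^-1 * J (dilate K be g))); last first.
  by rewrite lerD2l -[leRHS]mulr1 ler_wpM2l.
apply: H; apply: aeW => x; rewrite mul0r addr0.
apply: (le_trans (mid_dilate_le f g x a0 be0)).
have Px := P_gt0 PK x; have Px1 := ltW (P_gt1 PK x).
have Kx := exponents_K PK x.
have ak : a `^ K x <= ka * 2.
  by apply: kaP => //; rewrite (ltW (K_gt0 PK x))/=; case/andP: Kx.
have bk := beP _ Kx.
set u := `|dilate K a f x|; set v := `|dilate K be g x|.
have u0 : 0 <= u by exact: normr_ge0.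
have v0 : 0 <= v by exact: normr_ge0.
move: u v u0 v0 => u v u0 v0.
have auk := ler_wpM2r u0 ak; have bvk := ler_wpM2r v0 bk.
have ak0 := powR_ge0 a (K x); have bk0 := powR_ge0 be (K x).
have ku0 : 0 <= ka / s * u by rewrite mulr_ge0// ltW.
have hv0 : 0 <= 2^-1 * v by rewrite mulr_ge0.
apply: (@le_trans _ _ ((s * (ka / s * u) + (1 - s) * (2^-1 * v)) `^ P x)).
  apply: ge0_ler_powR; rewrite ?nnegrE ?(ltW Px)//.
  - by rewrite divr_ge0// addr_ge0// mulr_ge0.
  - by apply: addr_ge0; apply: mulr_ge0 => //; exact: ltW.
  by rewrite mulrA sK; exact: (fin3 _ _ _ _ _ _ auk bvk).
have s01 : 0 <= s <= 1 by rewrite !ltW.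
apply: (le_trans (powR_convex Px1 s01 ku0 hv0)).
have small z y : 0 < z <= 1 -> 0 <= y -> (z * y) `^ P x <= z * y `^ P x.
  move=> /[dup] zI /andP[z0 _] y0; rewrite powRM ?(ltW z0)//.
  rewrite ler_wpM2r ?powR_ge0// -[leRHS](powRr1 (ltW z0)).
  exact: ger_powR.
apply: lerD.
  rewrite -[X in _ <= X * _]sK -[leRHS]mulrA; apply: ler_wpM2l; first exact: ltW.
  by apply: small => //; rewrite kas0 ltW.
rewrite -[leRHS]mulrA; apply: ler_wpM2l; first exact: ltW.
by apply: small => //; rewrite invr_gt0 ltr0n invf_le1// ler1n.
Qed.
End far.

(** * Uniform convexity of the level *)

Section level_uniformly_convex.
Context d (T : measurableType d) (R : realType) (mu : {measure set T -> \bar R}).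
Variables (P K : T -> R) (p0 p1 k0 k1 c : R).
Hypothesis PK : exponents P K p0 p1 k0 k1.
Implicit Types (f g h F G : T -> R) (a b : R).

Local Notation J := (power_val mu P).
Local Notation lev := (level_val mu P K).
Local Notation PF := (power_finite mu P).

Hypothesis disc_ok : forall f, PF f ->
  {ae mu, forall x, ~ disc_le (P x) (K x) c -> f x = 0}.

Lemma power_intN h : power_int mu P (fun x => - h x) = power_int mu P h.
Proof. by rewrite !power_intE; apply: eq_integral => x _; rewrite normrN. Qed.

Lemma dilateN l h : dilate K l (fun x => - h x) = (fun x => - dilate K l h x).
Proof. by apply/funext => x; rewrite !dilateE mulNr. Qed.

Lemma levelN h : level mu P K (fun x => - h x) = level mu P K h.
Proof.
have le u : (level mu P K (fun x => - u x)%R <= level mu P K u)%E.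
  rewrite (levelE _ _ _ u); apply: le_ereal_inf_tmp => _ [l [l0 Jl] <-].
  by apply: (level_le l0); rewrite dilateN power_intN; exact: Jl.
have hE : (fun x => - - h x) = h by apply/funext => x; rewrite opprK.
have h1 := le h; have h2 := le (fun x => - h x); rewrite hE in h2.
by apply: le_anti; apply/andP; split; [exact: h1|exact: h2].
Qed.

Lemma level_val_subC f g : lev (fun x => f x - g x) = lev (fun x => g x - f x).
Proof.
rewrite !level_valE -[in RHS]levelN; congr (fine (level _ _ _ _)).
by apply/funext => x; rewrite opprB.
Qed.

Lemma power_mid_le1 f g : PF f -> PF g -> lev f + lev g = 2 ->
  J (fun x => (f x + g x) / 2) <= 1.
Proof.
have aux1 (u v : R) : u + v = 2 -> u = 1 -> v = 1 by lra.
have aux (u v : R) : v <= u -> u + v = 2 -> u != 1 -> 0 < v -> 1 < u < 2.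
  move=> vu uv u1 v0; have : u <> 1 by apply/eqP.
  by move=> u1'; apply/andP; split; [rewrite lt_neqAle eq_sym u1/=|]; lra.
have two : 1 = 2^-1 * 1 + 2^-1 * 1 :> R by lra.
wlog : f g / lev g <= lev f => [wl Ff Fg fg|].
  have [gf|/ltW fg'] := leP (lev g) (lev f).
    exact: (wl f g gf).
  have -> : (fun x => (f x + g x) / 2) = (fun x => (g x + f x) / 2).
    by apply/funext => x; rewrite addrC.
  by apply: (wl g f fg' Fg Ff); rewrite addrC; exact: fg.
have := level_val_ge0 mu P K g; case/boolP : (lev g == 0) => [/eqP g0 _ _ Ff Fg fg|gN0 g0 gf Ff Fg fg].
  have [be /andP[be0 _] [del del0 H]] := power_mid_small mu PK.
  apply: (le_trans (H f g _ _ Ff Fg erefl erefl fg _)); first by rewrite g0 lexx be0.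
  by rewrite gerBl ltW.
have [f1|f1] := eqVneq (lev f) 1.
  have g1 : lev g = 1 by exact: aux1 fg f1.
  have lt01 : 0 < (1 : R) <= 1 by rewrite ltr01 lexx.
  have Jf : J f <= 1 by apply: (power_level_le1 PK Ff lt01 f1).
  have Jg : J g <= 1 by apply: (power_level_le1 PK Fg lt01 g1).
  have h0 : 0 <= 2^-1 :> R by rewrite invr_ge0.
  have := power_comb PK (power_finite_mid PK Ff Fg) Ff Ff Fg (lexx 0) h0 h0 _.
  rewrite mul0r addr0 => H; apply: (@le_trans _ _ (2^-1 * J f + 2^-1 * J g)).
    apply: H; apply: aeW => x; rewrite mul0r addr0 -mulrDr [leRHS]mulrC.
    exact: (powR_mid_le (f x) (g x) (ltW (P_gt1 PK x))).
  by rewrite [leRHS]two; apply: lerD; rewrite ler_wpM2l.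
have gt0 : 0 < lev g by rewrite lt_neqAle eq_sym gN0.
apply: (power_mid_le1_gt1 PK disc_ok Ff Fg erefl erefl fg).
exact: aux gf fg f1 gt0.
Qed.

Lemma power_mid_gap (e : R) : 0 < e < 1 -> exists2 del, 0 < del < 1 &
  forall f g, PF f -> PF g -> lev f + lev g = 2 ->
    e < lev (fun x => f x - g x) -> J (fun x => (f x + g x) / 2) <= 1 - del.
Proof.
move=> e01; have [eta /andP[eta0 eta1] [d1 /andP[d10 d11] near]] := power_mid_near mu PK e01.
have [be /andP[be0 be1] [d2 d20 small]] := power_mid_small mu PK.
have [||d3 d30 far] := @power_mid_far _ _ _ mu P K p0 p1 k0 k1 c PK disc_ok (1 + eta) (2 - be).
- by lra.
- by lra.
pose de := Num.min d1 (Num.min d2 d3).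
have de1 : de <= d1 by rewrite ge_min lexx.
have de2 : de <= d2 by rewrite !ge_min lexx orbT.
have de3 : de <= d3 by rewrite !ge_min lexx !orbT.
have de0 : 0 < de by rewrite !lt_min d10 d20.
move: de de0 de1 de2 de3 => de de0 de1 de2 de3.
exists de; first by rewrite de0 (le_lt_trans de1).
(* The larger level [u] lies in [[1, 2]]; the three regimes meet at [1 + eta] and [2 - be]. *)
have cases (u v : R) : v <= u -> u + v = 2 -> 0 <= v ->
    [\/ 1 <= u <= 1 + eta, 1 + eta <= u <= 2 - be | 0 <= v < be].
  move=> vu uv v0; have [h1|h1] := leP u (1 + eta); first by apply: Or31; lra.
  by have [h2|h2] := leP u (2 - be); [apply: Or32|apply: Or33]; lra.
move=> f g; wlog : f g / lev g <= lev f => [wl Ff Fg fg efg|gf Ff Fg fg efg].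
  have [gf|/ltW fg'] := leP (lev g) (lev f).
    exact: (wl f g gf).
  have -> : (fun x => (f x + g x) / 2) = (fun x => (g x + f x) / 2).
    by apply/funext => x; rewrite addrC.
  by apply: (wl g f fg' Fg Ff); [rewrite addrC; exact: fg|rewrite level_val_subC; exact: efg].
have [h|h|h] := cases _ _ gf fg (level_val_ge0 mu P K g).
- by apply: (le_trans (near f g _ _ Ff Fg erefl erefl fg h efg)); rewrite lerB.
- by apply: (le_trans (far f g _ _ Ff Fg erefl erefl fg h)); rewrite lerB.
- by apply: (le_trans (small f g _ _ Ff Fg erefl erefl fg h)); rewrite lerB.
Qed.

Lemma level_val_le h l : PF h -> 0 < l -> J (dilate K l h) <= 1 -> lev h <= l.
Proof.
move=> Fh l0 Jl; have := @level_le _ _ _ mu P K h l l0.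
rewrite (level_fineK PK Fh) (power_int_fineK PK (power_finite_dilate PK l0 Fh)).
by rewrite !lee_fin; apply.
Qed.

Lemma level_val_sub_le f g : PF f -> PF g ->
  lev (fun x => f x - g x) <= level_const p1 k0 * (lev f + lev g).
Proof.
move=> Ff Fg; have := level_sub_le PK Ff Fg.
rewrite (level_fineK PK Ff) (level_fineK PK Fg) (level_fineK PK (power_finite_sub PK Ff Fg)).
by rewrite -EFinD -EFinM lee_fin.
Qed.

Lemma level_val_dilate l f : PF f -> 0 < l -> lev f = l * lev (dilate K l f).
Proof.
move=> Ff l0; have := @level_dilate _ _ _ mu P K l f l0.
rewrite (level_fineK PK Ff) (level_fineK PK (power_finite_dilate PK l0 Ff)).
by rewrite -EFinM => -[].
Qed.

(** With [s ^ p1 = 1 - del], a midpoint integral of at most [1 - del] lets the midpoint be dilated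
    by [s], so its level is at most [s]. The constant [kap] makes the remaining [1 - s] pay for the
    level of the difference, which the quasi-triangle inequality bounds. *)
Lemma level_uniformly_convex_sum2 (e : R) : 0 < e < 1 -> exists2 kap, 0 < kap &
  forall f g, PF f -> PF g -> lev f + lev g = 2 ->
    lev (fun x => (f x + g x) / 2) + kap * lev (fun x => f x - g x) <= 1 + kap * e.
Proof.
move=> e01; have [del /andP[del0 del1] gain] := power_mid_gap e01.
have p1_0 : 0 < p1 by have := p1_gt1 PK; lra.
have C1 := level_const_ge1 PK; have C0 : 0 < level_const p1 k0 by exact: lt_le_trans C1.
have [s [s0 s1 sP]] : exists s, [/\ 0 < s, s < 1 & s `^ p1 = 1 - del].
  exists ((1 - del) `^ p1^-1); split.
  - by rewrite powR_gt0// subr_gt0.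
  - apply: (@lt_le_trans _ _ (1 `^ p1^-1)); last by rewrite powR1.
    by apply: gt0_ltr_powR; rewrite ?nnegrE ?invr_gt0//; lra.
  - by rewrite -powRrM mulVf ?gt_eqF// powRr1//; lra.
have [C C0' subC] : exists2 C, 0 < C & forall f g, PF f -> PF g -> lev f + lev g = 2 ->
    lev (fun x => f x - g x) <= C * 2.
  exists (level_const p1 k0) => // f g Ff Fg fg.
  by apply: (le_trans (level_val_sub_le Ff Fg)); rewrite fg.
pose kap := (1 - s) / (C * 2).
have kapE : kap * (C * 2) = 1 - s by rewrite divfK// mulf_neq0// gt_eqF.
have kap0 : 0 < kap by rewrite divr_gt0 ?subr_gt0 ?mulr_gt0.
move: kap kapE kap0 => kap kapE kap0.
have e0 : 0 < e by case/andP: e01.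
exists kap => // f g Ff Fg fg; have Fm := power_finite_mid PK Ff Fg.
have [d_le|d_gt] := leP (lev (fun x => f x - g x)) e.
  apply: lerD; last by rewrite ler_pM2l.
  by apply: level_val_le => //; rewrite dilate1; exact: power_mid_le1.
have Jm := gain f g Ff Fg fg d_gt.
have lm : lev (fun x => (f x + g x) / 2) <= s.
  apply: level_val_le => //.
  have s01 : 0 < s <= 1 by rewrite s0 ltW.
  apply: (le_trans (power_dilate_le1 PK Fm s01)).
  by rewrite powRN ler_pdivrMl ?powR_gt0// mulr1 sP.
apply: (@le_trans _ _ (s + kap * (C * 2))).
  by apply: lerD => //; rewrite ler_pM2l// subC.
by rewrite kapE addrCA subrr addr0 lerDl mulr_ge0// ltW.
Qed.

(** Dilating by half the sum of the levels normalises that sum to 2. The result is linear in the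
    levels and can therefore be summed over a sequence. *)
Lemma level_uniformly_convex (e : R) : 0 < e < 1 -> exists2 kap, 0 < kap &
  forall f g, PF f -> PF g ->
    lev (fun x => (f x + g x) / 2) + kap * lev (fun x => f x - g x) <=
    (2^-1 + kap * e) * (lev f + lev g).
Proof.
move=> e01; have [kap kap0 uc] := level_uniformly_convex_sum2 e01.
have e0 : 0 < e by case/andP: e01.
have half (z w t : R) : t * (z + kap * w) <= t * (1 + kap * e) ->
   0 <= kap * e * t -> t * z + kap * (t * w) <= (2^-1 + kap * e) * (t + t) by lra.
exists kap => // f g Ff Fg.
have := addr_ge0 (level_val_ge0 mu P K f) (level_val_ge0 mu P K g).
have Fm := power_finite_mid PK Ff Fg; have Fs := power_finite_sub PK Ff Fg.
rewrite le_eqVlt => /predU1P[fg0|fg0].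
  have f0 : lev f = 0 by have := level_val_ge0 mu P K f; have := level_val_ge0 mu P K g; lra.
  have g0 : lev g = 0 by lra.
  have d0 : lev (fun x => f x - g x) <= 0.
    by apply: (le_trans (level_val_sub_le Ff Fg)); rewrite -fg0 mulr0.
  have h01 : 0 < (2^-1 : R) <= 1 by lra.
  have scale0 u : PF u -> lev u = 0 -> PF (fun x => 2^-1 * u x) /\ lev (fun x => 2^-1 * u x) <= 0.
    move=> Fu u0.
    have Fu' : PF (fun x => 2^-1 * u x).
      have := power_finite_lin PK 2^-1 0 Fu Fu; congr (power_finite mu P _).
      by apply/funext => x; rewrite mul0r addr0.
    split=> //; have := level_scale_le1 mu PK h01 Fu.1.
    by rewrite (level_fineK PK Fu) (level_fineK PK Fu') u0 mule0 lee_fin.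
  have [Ff' f0'] := scale0 _ Ff f0.
  have FNg : PF (fun x => - g x).
    have := power_finite_lin PK 0 (- 1) Fg Fg; congr (power_finite mu P _).
    by apply/funext => x; rewrite mul0r add0r mulN1r.
  have Ng0 : lev (fun x => - g x) = 0 by rewrite level_valE levelN -level_valE.
  have [Fg' g0'] := scale0 _ FNg Ng0.
  have m0 : lev (fun x => (f x + g x) / 2) <= 0.
    rewrite (_ : (fun x => _) = (fun x => 2^-1 * f x - 2^-1 * - g x)); last first.
      by apply/funext => x; lra.
    apply: (le_trans (level_val_sub_le Ff' Fg')).
    have := level_val_ge0 mu P K (fun x => 2^-1 * f x).
    have := level_val_ge0 mu P K (fun x => 2^-1 * - g x).
    have : 0 <= level_const p1 k0 by exact: powR_ge0.
    by nra.
  by rewrite -fg0 mulr0; nra.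
have t0 : 0 < (lev f + lev g) / 2 by lra.
have tE : lev f + lev g = (lev f + lev g) / 2 + (lev f + lev g) / 2 by lra.
move: {-2}((lev f + lev g) / 2) (erefl ((lev f + lev g) / 2)) t0 tE => t tdef t0 tE.
rewrite tE (level_val_dilate Fm t0) (level_val_dilate Fs t0); apply: half; last by rewrite !mulr_ge0// ltW.
rewrite ler_pM2l//.
have -> : dilate K t (fun x => (f x + g x) / 2) =
    (fun x => (dilate K t f x + dilate K t g x) / 2).
  by apply/funext => x; rewrite !dilateE; ring.
have -> : dilate K t (fun x => f x - g x) =
    (fun x => dilate K t f x - dilate K t g x).
  by apply/funext => x; rewrite !dilateE; ring.
apply: (uc _ _ (power_finite_dilate PK t0 Ff) (power_finite_dilate PK t0 Fg)).
move: tE; rewrite (level_val_dilate Ff t0) (level_val_dilate Fg t0) => tE.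
apply: (@mulfI _ t); first by rewrite gt_eqF.
by rewrite mulrDr; lra.
Qed.
End level_uniformly_convex.

Section strict.
Local Open Scope ereal_scope.
Context d (T : measurableType d) (R : realType) (mu : {measure set T -> \bar R}).
Implicit Types F G : T -> R.

Lemma nonneg_integral_lt F G (E : set T) : nonneg_mfun F -> nonneg_mfun G ->
  (forall x, (F x <= G x)%R) -> measurable E -> mu E <> 0 ->
  (forall x, E x -> (F x < G x)%R) -> \int[mu]_x (G x)%:E < +oo ->
  \int[mu]_x (F x)%:E < \int[mu]_x (G x)%:E.
Proof.
move=> nF nG FG mE E0 FGE Gfin.
have nH : nonneg_mfun (fun x => G x - F x)%R.
  split=> [|x]; last by rewrite subr_ge0.
  by apply: measurable_funB; [exact: nG.1|exact: nF.1].
have e : \int[mu]_x (G x)%:E = \int[mu]_x (F x)%:E + \int[mu]_x (G x - F x)%:E.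
  have := nonneg_integral_lin mu nF nH ler01 ler01; rewrite !mul1e => <-.
  by apply: eq_integral => x _; rewrite !mul1r addrC subrK.
have H0 := nonneg_integral_ge0 mu nH; have F0 := nonneg_integral_ge0 mu nF.
have Hgt : 0 < \int[mu]_x (G x - F x)%:E.
  rewrite lt_neqAle H0 andbT eq_sym; apply/eqP => /(nonneg_integral_eq0 nH).
  move=> [N [mN N0 sub]]; apply: E0.
  apply: (subset_measure0 mE mN _ N0) => x Ex; apply: sub => /eqP.
  by rewrite subr_eq0 gt_eqF// FGE.
move: Gfin Hgt F0; rewrite e.
case: (\int[mu]_x (F x)%:E) => [u||]; case: (\int[mu]_x (G x - F x)%:E) => [v||]//=.
by rewrite -EFinD !lte_fin ltrDl.
Qed.
End strict.

(** * Lines whose slope at 1 is the vertex of [quad] *)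

Section vertex.
Context {R : realType}.
Implicit Types p k c e t x : R.

Definition vertex p k c := - (1 - 2 * k - c) / (2 * (p - 1)).

Lemma quad_vertex p k c y : 1 < p ->
  quad p k c (vertex p k c + y) = (p - 1) * y ^+ 2 -
    ((1 - 2 * k - c) ^+ 2 - 4 * ((p - 1) * (k * (1 - k)))) / (4 * (p - 1)).
Proof.
by move=> p1; rewrite /quad /vertex; field; rewrite subr_eq0 gt_eqF.
Qed.

(** The half-width of the interval of those [c] for which [disc_le p k c] holds; its centre is
    [1 - 2 k]. *)
Definition sqrt_disc p k := Num.sqrt (4 * ((p - 1) * (k * (1 - k)))).

Lemma sqr_sqrt_disc p k : 1 < p -> 0 < k < 1 ->
  sqrt_disc p k ^+ 2 = 4 * ((p - 1) * (k * (1 - k))).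
Proof.
move=> p1 /andP[k0 k1]; rewrite sqr_sqrtr// mulr_ge0// mulr_ge0 ?subr_ge0 ?ltW//.
by rewrite mulr_gt0 ?subr_gt0.
Qed.

(** The line with value 1 and derivative [rho] at 1 has [wslope] equal to the vertex there. The
    margin [e] makes [quad] negative at the vertex and keeps the vertex away from 0, uniformly in
    [p] and [k], so one [t] serves all points. *)
Lemma vertex_near (p0 p1 c e : R) : 1 < p0 -> p0 <= p1 -> 0 < e ->
  exists2 t : R, 0 < t < 1 & forall p k x, p0 <= p <= p1 -> 0 < k < 1 ->
    sqrt_disc p k + e <= `|1 - 2 * k - c| -> 1 - t <= x <= 1 + t ->
    let rho := vertex p k c + k in
    [/\ 0 < 1 - rho + rho * x,
        quad p k c (wslope k (1 - rho) rho x) < 0,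
        0 < 1 - 2 * k - c -> wslope k (1 - rho) rho x < 0 &
        1 - 2 * k - c < 0 -> 0 < wslope k (1 - rho) rho x].
Proof.
move=> p01 p0p1 e0.
(* [C] will bound [|rho|] and [rm] bound the modulus of the vertex from below; [t] keeps the line
   above [1/2] and the slope within [rm / 2] of the vertex. *)
have p10 : 0 < p1 - 1 by lra.
have p00 : 0 < p0 - 1 by lra.
pose C := (`|c| + 1) / (2 * (p0 - 1)) + 1.
have C1 : 1 <= C by rewrite lerDr divr_ge0// ?addr_ge0// mulr_ge0// ltW.
pose rm := e / (2 * (p1 - 1)).
have rm0 : 0 < rm by rewrite divr_gt0// mulr_gt0.
pose t := Num.min (4 * C)^-1 (rm / (4 * C * (1 + C))).
have C0 : 0 < C by lra.
have C10 : 0 < 1 + C by lra.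
have t0 : 0 < t by rewrite lt_min invr_gt0 mulr_gt0//= divr_gt0// !mulr_gt0.
have tC : C * t <= 4^-1.
  have : t <= (4 * C)^-1 by rewrite ge_min lexx.
  by move=> /(ler_wpM2l (ltW C0)); rewrite invfM mulrCA divff ?mulr1 ?gt_eqF.
have tr : 2 * C * (1 + C) * t <= rm / 2.
  have : t <= rm / (4 * C * (1 + C)) by rewrite ge_min lexx orbT.
  rewrite ler_pdivlMr ?mulr_gt0//; lra.
have rm_def : rm * (2 * (p1 - 1)) = e by rewrite divfK// mulf_neq0// gt_eqF.
have C_def : (C - 1) * (2 * (p0 - 1)) = `|c| + 1.
  by rewrite /C addrK divfK// mulf_neq0// gt_eqF.
clearbody t; clearbody rm; clearbody C.
exists t; first by apply/andP; split => //; nra.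
move=> p k x pI kI sD xI rho.
have pp : 1 < p by lra.
have DE := sqr_sqrt_disc pp kI.
have sd0 : 0 <= sqrt_disc p k by exact: sqrtr_ge0.
set D := 1 - 2 * k - c in sD *.
have D2 : e ^+ 2 <= D ^+ 2 - 4 * ((p - 1) * (k * (1 - k))).
  rewrite -DE -(real_normK (num_real D)).
  have : 0 <= `|D| - (sqrt_disc p k + e) by rewrite subr_ge0.
  by move: `|D| (sqrt_disc p k) sd0 => a s s0 h; nra.
have De : e <= `|D| by lra.
have Dc : `|D| <= `|c| + 1.
  rewrite /D (le_trans (ler_normB _ _))// addrC lerD2l ler_norml; lra.
pose r := vertex p k c.
have rE : r * (2 * (p - 1)) = - D by rewrite /r /vertex divfK// mulf_neq0// subr_eq0 gt_eqF.
have nrE : `|r| * (2 * (p - 1)) = `|D|.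
  have p20 : 0 <= 2 * (p - 1) by lra.
  by rewrite -[X in _ * X](ger0_norm p20) -normrM rE normrN.
have r_lo : rm <= `|r|.
  rewrite -(ler_pM2r (_ : 0 < 2 * (p - 1))); last by lra.
  rewrite nrE (le_trans _ De)// -rm_def ler_pM2l//; lra.
have r_hi : `|r| <= C - 1.
  rewrite -(ler_pM2r (_ : 0 < 2 * (p - 1))); last by lra.
  rewrite nrE (le_trans Dc)// -C_def ler_wpM2l//; lra.
have rho_hi : `|rho| <= C.
  rewrite /rho -/r (le_trans (ler_normD _ _))// (ger0_norm (_ : 0 <= k)); lra.
pose u := x - 1.
have ut : `|u| <= t by rewrite ler_norml /u; lra.
have ru : `|rho * u| <= 4^-1.
  by rewrite normrM (le_trans _ tC)// ler_pM.
have hE : 1 - rho + rho * x = 1 + rho * u by rewrite /u; ring.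
have h2 : 2^-1 <= 1 - rho + rho * x.
  rewrite hE; move: ru; rewrite ler_norml; move: (rho * u) => z; lra.
have h0 : 0 < 1 - rho + rho * x by lra.
pose y := rho * u * (1 - rho) / (1 - rho + rho * x).
have yE : wslope k (1 - rho) rho x = r + y.
  rewrite /wslope /y /u (_ : r = rho - k); last by rewrite /rho addrK.
  by field; rewrite gt_eqF.
have y_hi : `|y| <= rm / 2.
  apply: le_trans tr; rewrite /y !normrM normfV ler_pdivrMr; last by rewrite normr_gt0 gt_eqF.
  rewrite (gtr0_norm h0).
  have r1 : `|1 - rho| <= 1 + C.
    by rewrite (le_trans (ler_normB _ _))// normr1 lerD2l.
  apply: (@le_trans _ _ (C * t * (1 + C))).
    by apply: ler_pM => //; exact: ler_pM.
  have : 0 <= C * t * (1 + C) by rewrite !mulr_ge0// ltW//; case/andP: t0.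
  rewrite (_ : 2 * C * (1 + C) * t * _ = C * t * (1 + C) * (2 * (1 - rho + rho * x))); last by ring.
  by move=> z0; rewrite ler_peMr//; move: h2; move: (1 - rho + rho * x) => w; lra.
have pN0 : 0 < 4 * (p - 1) by lra.
have y2 : (2 * (p - 1) * `|y|) <= e / 2.
  rewrite -rm_def; apply: (@le_trans _ _ (2 * (p1 - 1) * (rm / 2))).
    by apply: ler_pM => //; lra.
  lra.
have ysq : 4 * (p - 1) * ((p - 1) * y ^+ 2) <= e ^+ 2 / 4.
  rewrite -(real_normK (num_real y)).
  rewrite (_ : _ * _ = (2 * (p - 1) * `|y|) ^+ 2); last by ring.
  rewrite (_ : _ / 4 = (e / 2) ^+ 2); last by field.
  by rewrite ler_sqr// nnegrE ?divr_ge0 ?(ltW e0)// mulr_ge0// mulr_ge0//; lra.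
rewrite yE; split => //.
- rewrite quad_vertex// -/D -(pmulr_rlt0 _ pN0) mulrBr mulrCA [X in _ - X]mulrCA.
  rewrite divff ?mulr1 ?gt_eqF// mulrCA.
  have e2 : 0 < e ^+ 2 by rewrite exprn_gt0.
  move: ysq D2 e2; rewrite -mulrA mulrCA.
  lra.
- move=> D0; have r0 : r < 0.
    by rewrite -(pmulr_llt0 _ (_ : 0 < 2 * (p - 1))) ?rE ?oppr_lt0//; lra.
  by move: r_lo y_hi; rewrite (ltr0_norm r0) ler_norml; lra.
- move=> D0; have r0 : 0 < r.
    by rewrite -(pmulr_lgt0 _ (_ : 0 < 2 * (p - 1))) ?rE ?oppr_gt0//; lra.
  by move: r_lo y_hi; rewrite (gtr0_norm r0) ler_norml; lra.
Qed.
End vertex.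

(** * Sets that integrable functions cannot see *)

Section invisible.
Local Open Scope ereal_scope.
Context d (T : measurableType d) (R : realType) (mu : {measure set T -> \bar R}).
Variables (P K : T -> R) (p0 p1 k0 k1 : R).
Hypothesis PK : exponents P K p0 p1 k0 k1.

(* On a measure space without any semifiniteness assumption these are the sets
   on which every function of the space vanishes almost everywhere. *)
Definition invisible (E : set T) := measurable E /\
  forall F, measurable F -> F `<=` E -> mu F < +oo -> mu F = 0.

Lemma measure_bigcup0 (A : nat -> set T) :
  (forall n, measurable (A n)) -> (forall n, mu (A n) = 0) -> mu (\bigcup_n A n) = 0.
Proof.
move=> mA A0; apply/negligibleP; first exact: bigcup_measurable.
by apply: negligible_bigcup => n; apply/negligibleP; [exact: mA|exact: A0].
Qed.

Lemma invisible_bigcup (E : nat -> set T) :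
  (forall n, invisible (E n)) -> invisible (\bigcup_n E n).
Proof.
move=> iE; split; first by apply: bigcup_measurable => n _; exact: (iE n).1.
move=> F mF FE Ffin.
have mFE n : measurable (F `&` E n) by apply: measurableI => //; exact: (iE n).1.
apply: (subset_measure0 (B := \bigcup_n (F `&` E n))) => //.
- exact: bigcup_measurable.
- by move=> x Fx; have [n _ En] := FE x Fx; exists n.
apply: measure_bigcup0 => // n.
apply: (iE n).2 => //; apply: le_lt_trans Ffin.
by apply: le_measure; rewrite ?inE//; exact: subIsetl.
Qed.

Lemma invisibleS (E F : set T) : measurable F -> F `<=` E -> invisible E -> invisible F.
Proof.
move=> mF FE [mE iE]; split=> // G mG GF; apply: iE => //.
exact: subset_trans FE.
Qed.

(** By Chebyshev's inequality the part of [E] where [|f| ^ P >= 1 / (n + 1)] has finite measure, so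
    it is null; these parts exhaust the points of [E] where [f] is nonzero. *)
Lemma invisible_ae (E : set T) f : invisible E -> power_finite mu P f ->
  {ae mu, forall x, E x -> f x = 0%R}.
Proof.
move=> [mE iE] [mf Jf].
pose A n := E `&` [set x | (n.+1%:R^-1)%:E <= (`|f x| `^ P x)%:E].
have [mJ J0] : nonneg_mfun (fun x => (`|f x| `^ P x)%R).
  by apply: nonneg_mfun_powR => //; exact: exponents_mP PK.
have mJ' : measurable_fun [set: T] (fun x => (`|f x| `^ P x)%:E) by exact/measurable_EFinP.
have mA n : measurable (A n).
  apply: measurableI => //.
  by rewrite -[X in measurable X]setTI; exact: emeasurable_fun_c_infty.
have n0 (n : nat) : (0 < n.+1%:R^-1 :> R)%R by rewrite invr_gt0.
have A0 n : mu (A n) = 0.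
  apply: iE => //; first exact: subIsetl.
  have : (n.+1%:R^-1)%:E * mu (A n) <= power_int mu P f.
    rewrite power_intE -integral_cst//.
    apply: (@le_trans _ _ (\int[mu]_(x in A n) (`|f x| `^ P x)%:E)).
      apply: ge0_le_integral => //.
      - by move=> x _; rewrite lee_fin ltW.
      - exact: measurable_funS mJ'.
      - by move=> x [_].
    apply: ge0_subset_integral => // x _; rewrite lee_fin; exact: J0.
  rewrite -lee_pdivlMl// => /le_lt_trans; apply.
  by rewrite lte_mul_pinfty// lee_fin invr_ge0 ltW.
have UA : mu (\bigcup_n A n) = 0 by exact: measure_bigcup0.
exists (\bigcup_n A n); split => //; first exact: bigcup_measurable.
move=> x /= /not_implyP[Ex fx].
have Jx : (0 < `|f x| `^ P x)%R by rewrite powR_gt0// normr_gt0; apply/eqP.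
have [n nx] : exists n, (n.+1%:R^-1 <= `|f x| `^ P x)%R.
  exists (Num.truncn (`|f x| `^ P x)^-1); rewrite -[leRHS]invrK lef_pV2 ?posrE ?invr_gt0//.
  by apply: ltW; exact: truncnS_gt.
by exists n => //; split => //=; rewrite lee_fin.
Qed.

Lemma not_invisible (E : set T) : measurable E -> ~ invisible E ->
  exists F, [/\ measurable F, F `<=` E, mu F < +oo & mu F <> 0].
Proof.
move=> mE; apply: contra_notP => nF; split => // F mF FE Ffin.
by apply: contra_notP nF => F0; exists F.
Qed.
End invisible.

(** * Two separated sets contradict midpoint convexity of the level *)

Section two_sets.
Context d (T : measurableType d) (R : realType) (mu : {measure set T -> \bar R}).
Variables (P K : T -> R) (p0 p1 k0 k1 : R).
Hypothesis PK : exponents P K p0 p1 k0 k1.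
Implicit Types (f g h F G : T -> R) (a b c e : R) (E : set T).

Local Notation J := (power_val mu P).
Local Notation lev := (level_val mu P K).
Local Notation PF := (power_finite mu P).

(** The positive bound [s], in place of the sum of the levels, leaves a legitimate dilation factor
    when both levels vanish. *)
Definition level_midconvex := forall f g (s : R), PF f -> PF g -> 0 < s ->
  lev f + lev g <= s -> lev (fun x => (f x + g x) / 2) <= s / 2.

Let disc_coef c x := 1 - 2 * K x - c.
Let sdisc x := sqrt_disc (P x) (K x).

Lemma power_dilate_level_le1 f l : PF f -> 0 < l -> lev f <= l -> J (dilate K l f) <= 1.
Proof.
move=> Ff l0; rewrite le_eqVlt => /predU1P[fl|fl].
  by rewrite (dilate_level_fine PK Ff l0 fl).
exact: (level_val_lt PK Ff fl).2.
Qed.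

Section weights.
Variables (rho : T -> R) (t : R).
Hypothesis mrho : measurable_fun [set: T] rho.
Hypothesis t01 : 0 < t < 1.

Let W (l : R) x := wpow (P x) (K x) (1 - rho x) (rho x) l.
Let line (l : R) x := 1 - rho x + rho x * l.

Lemma nonneg_W l : nonneg_mfun (W l).
Proof.
have mP := exponents_mP PK; have mK := exponents_mK PK.
split=> [|x]; last by rewrite /W /wpow mulr_ge0 ?powR_ge0.
rewrite /W /wpow; apply: measurable_funM; apply: measurable_fun_powR => //.
  apply: measurable_funD; last exact: measurable_funM.
  exact: measurable_funB.
by apply: measurableT_comp => //; exact: measurable_funM.
Qed.

Definition indic_W E l x := (\1_E x * W l x)%R.

Lemma nonneg_indic_W E l : measurable E -> nonneg_mfun (indic_W E l).
Proof.
move=> mE; have [mW W0] := nonneg_W l; split=> [|x]; last by rewrite mulr_ge0.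
by apply: measurable_funM.
Qed.

(** The exponent [(P x)^-1] cancels against the power [P x], so [w1] and [w2] enter the integral
    linearly. For fixed weights the function is affine in [l]. *)
Definition weighted E1 E2 (w1 w2 l : R) x :=
  (w1 * \1_E1 x + w2 * \1_E2 x) `^ (P x)^-1 * line l x.

Lemma weighted_mid E1 E2 w1 w2 x :
  weighted E1 E2 w1 w2 1 x =
  (weighted E1 E2 w1 w2 (1 + t) x + weighted E1 E2 w1 w2 (1 - t) x) / 2.
Proof. by rewrite /weighted /line; field. Qed.

Lemma measurable_weighted E1 E2 w1 w2 l : measurable E1 -> measurable E2 ->
  measurable_fun [set: T] (weighted E1 E2 w1 w2 l).
Proof.
move=> mE1 mE2; have mP := exponents_mP PK.
apply: measurable_funM; last first.
  apply: measurable_funD; last exact: measurable_funM.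
  exact: measurable_funB.
apply: measurable_fun_powR.
  by apply: measurable_funD; apply: measurable_funM => //; exact: measurable_indic.
rewrite (_ : (fun x => _) = (fun x => P x `^ (-1))); last first.
  by apply/funext => x; rewrite powR_inv1// ltW// (P_gt0 PK).
by apply: measurable_fun_powR.
Qed.

Lemma power_int_weighted E1 E2 w1 w2 l : measurable E1 -> measurable E2 ->
  0 <= w1 -> 0 <= w2 -> 0 < l -> (forall x, (E1 `|` E2) x -> 0 < line l x) ->
  power_int mu P (dilate K l (weighted E1 E2 w1 w2 l)) =
  (w1%:E * \int[mu]_x (indic_W E1 l x)%:E + w2%:E * \int[mu]_x (indic_W E2 l x)%:E)%E.
Proof.
move=> mE1 mE2 w10 w20 l0 lin0; rewrite power_intE.
rewrite -(nonneg_integral_lin mu (nonneg_indic_W l mE1) (nonneg_indic_W l mE2) w10 w20).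
apply: eq_integral => x _; congr (_%:E); rewrite powR_dilate//.
have Px := P_gt0 PK x.
have v0 : 0 <= w1 * \1_E1 x + w2 * \1_E2 x by rewrite addr_ge0// mulr_ge0.
rewrite /weighted normrM (ger0_norm (powR_ge0 _ _)) powRM ?powR_ge0//.
rewrite -powRrM mulVf ?gt_eqF// powRr1//.
rewrite /indic_W /W /wpow !indicE (mulrC (P x)).
have [xE|xE] := pselect ((E1 `|` E2) x).
  by rewrite (gtr0_norm (lin0 x xE)) /line; ring.
have [x1 x2] : x \notin E1 /\ x \notin E2.
  by rewrite !notin_setE; split => h; apply: xE; [left|right].
by rewrite (negbTE x1) (negbTE x2) /=; ring.
Qed.

End weights.

(* For [rho] as in the proof, [wslope] at [1] is the vertex of [quad], so [W] is
   strictly concave in [Z] near [1] on both sets; it decreases on [E1] and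
   increases on [E2].  The weights make its integral [1] at [1 + t] and [1 - t],
   hence larger than [1] at [1]. *)
Lemma level_midconvex_two_sets c e E1 E2 : level_midconvex -> 0 < e ->
  measurable E1 -> measurable E2 -> (mu E1 < +oo)%E -> (mu E2 < +oo)%E ->
  mu E1 <> 0%E -> mu E2 <> 0%E ->
  (forall x, E1 x -> sdisc x + e <= disc_coef c x) ->
  (forall x, E2 x -> sdisc x + e <= - disc_coef c x) -> False.
Proof.
move=> conv e0 mE1 mE2 E1fin E2fin E10 E20 D1 D2.
have mP := exponents_mP PK; have mK := exponents_mK PK.
have p01 := exponents_p0 PK.
have p0p1 : p0 <= p1 by have := exponents_P PK point; lra.
have [t /andP[t0 t1] vnear] := vertex_near c p01 p0p1 e0.
have sd0 x : 0 <= sdisc x by exact: sqrtr_ge0.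
pose rho x := vertex (P x) (K x) c + K x.
have mrho : measurable_fun [set: T] rho.
  apply: measurable_funD => //; rewrite /vertex.
  apply: measurable_funM.
    apply: measurableT_comp => //; apply: measurable_funB => //.
    by apply: measurable_funB => //; exact: measurable_funM.
  rewrite (_ : (fun x => _) = (fun x => (2 * (P x - 1)) `^ (-1))); last first.
    apply/funext => x; rewrite powR_inv1// mulr_ge0// subr_ge0 ltW//.
    exact: P_gt1 PK x.
  apply: measurable_fun_powR => //; apply: measurable_funM => //.
  exact: measurable_funB.
have a0 : 0 < 1 + t by lra.
have b0 : 0 < 1 - t by lra.
have b1 : 1 - t < 1 by lra.
have a1 : 1 < 1 + t by lra.
have good x y : E1 x \/ E2 x -> 1 - t <= y <= 1 + t ->
    [/\ 0 < 1 - rho x + rho x * y,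
        quad (P x) (K x) c (wslope (K x) (1 - rho x) (rho x) y) < 0,
        0 < disc_coef c x -> wslope (K x) (1 - rho x) (rho x) y < 0 &
        disc_coef c x < 0 -> 0 < wslope (K x) (1 - rho x) (rho x) y].
  move=> xE yI; apply: vnear => //.
  - exact: exponents_P PK x.
  - by rewrite (K_gt0 PK) (K_lt1 PK).
  - rewrite -/(sdisc x) -/(disc_coef c x); case: xE => [/D1|/D2] h.
      by apply: (le_trans h); exact: ler_norm.
    by apply: (le_trans h); rewrite -normrN; exact: ler_norm.
have inI y : y \in `](1 - t), (1 + t)[ -> 1 - t <= y <= 1 + t.
  by rewrite in_itv/= => /andP[/ltW -> /ltW ->].
have aI : 1 - t <= 1 + t <= 1 + t by lra.
have bI : 1 - t <= 1 - t <= 1 + t by lra.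
have oI : 1 - t <= 1 <= 1 + t by lra.
pose W l x := wpow (P x) (K x) (1 - rho x) (rho x) l.
have W0 l x : 0 <= W l x by exact: (nonneg_W mrho l).2.
have W1 x : W 1 x = 1.
  by rewrite /W /wpow mulr1 subrK powR1 mulr1.
pose Z := powR_primitive c.
have p2 : (1 : R) < 2 by rewrite ltr1n.
have [zb za] : Z (1 - t) < Z 1 /\ Z 1 < Z (1 + t).
  by apply: (@powR_primitive_chord R 2 0 c 1 0) => //; lra.
pose z1 := Z 1 - Z (1 - t); pose z2 := Z (1 + t) - Z 1.
have z10 : 0 < z1 by rewrite subr_gt0.
have z20 : 0 < z2 by rewrite subr_gt0.
have ZE : Z (1 + t) - Z (1 - t) = z1 + z2 by rewrite /z1 /z2; ring.
have chord x : E1 x \/ E2 x -> W (1 + t) x * z1 + W (1 - t) x * z2 < z1 + z2.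
  move=> xE; have [ha _ _ _] := good _ _ xE aI; have [hb _ _ _] := good _ _ xE bI.
  have := @wpow_chord_gt R (P x) (K x) c (1 - rho x) (rho x) (P_gt1 PK x) _ _ _ b0 b1 a1 (ltW hb) (ltW ha) (addr_gt0 hb ha).
  rewrite -/(W (1 + t) x) -/(W (1 - t) x) -/(W 1 x) W1 mul1r -/Z ZE; apply.
  by move=> y /inI yI; have [] := good _ _ xE yI.
have decr x : E1 x -> W (1 + t) x < W (1 - t) x.
  move=> x1; have xE : E1 x \/ E2 x by left.
  have [ha _ _ _] := good _ _ xE aI; have [hb _ _ _] := good _ _ xE bI.
  apply: (@wpow_decr R (P x) (K x) c (1 - rho x) (rho x) (P_gt1 PK x) _ 1 _ b0 b1 a1 (ltW hb) (ltW ha) (addr_gt0 hb ha)).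
  move=> y /inI yI; have [_ _ + _] := good _ _ xE yI; apply.
  by have := D1 x x1; have := sd0 x; lra.
have incr x : E2 x -> W (1 - t) x < W (1 + t) x.
  move=> x2; have xE : E1 x \/ E2 x by right.
  have [ha _ _ _] := good _ _ xE aI; have [hb _ _ _] := good _ _ xE bI.
  apply: (@wpow_incr R (P x) (K x) c (1 - rho x) (rho x) (P_gt1 PK x) _ 1 _ b0 b1 a1 (ltW hb) (ltW ha) (addr_gt0 hb ha)).
  move=> y /inI yI; have [_ _ _] := good _ _ xE yI; apply.
  by have := D2 x x2; have := sd0 x; lra.
(* The chord inequality itself bounds [W] at [1 + t] and [1 - t], which makes the integrals over the
   sets of finite measure finite. *)
pose M := Num.max 1 (Num.max ((z1 + z2) / z1) ((z1 + z2) / z2)).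
have M0 : 0 <= M by rewrite le_max ler01.
have WM l x : E1 x \/ E2 x -> [\/ l = 1, l = 1 + t | l = 1 - t] -> W l x <= M.
  move=> xE; have := chord x xE => ch [] ->.
  - by rewrite W1 le_max lexx.
  - rewrite !le_max; apply/orP; right; apply/orP; left; rewrite ler_pdivlMr//.
    by apply: le_trans (ltW ch); rewrite lerDl mulr_ge0// ltW.
  - rewrite !le_max; apply/orP; right; apply/orP; right; rewrite ler_pdivlMr//.
    by apply: le_trans (ltW ch); rewrite lerDr mulr_ge0// ltW.
have nnW E l (mE : measurable E) := nonneg_indic_W mrho l mE.
have Ifin E l : measurable E -> (mu E < +oo)%E -> (forall x, E x -> E1 x \/ E2 x) ->
    [\/ l = 1, l = 1 + t | l = 1 - t] ->
    (\int[mu]_x (indic_W rho E l x)%:E < +oo)%E.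
  move=> mE Efin EE lI.
  have nnE : nonneg_mfun (\1_E : T -> R).
    by split=> [|x]; [exact: measurable_indic|rewrite indicE].
  apply: (@le_lt_trans _ _ (\int[mu]_x (M * \1_E x)%:E)%E).
    apply: nonneg_integral_le; [exact: nnW|exact: nonneg_mfunZ|].
    apply: aeW => x; rewrite /indic_W indicE.
    have [xE|xE] := boolP (x \in E); last by rewrite mul0r mulr0.
    by rewrite mul1r mulr1; apply: WM => //; apply: EE; rewrite inE in xE.
  rewrite nonneg_integralZ// integral_indic// setIT.
  by rewrite lte_mul_pinfty// lee_fin.
have Ival E l : measurable E -> (mu E < +oo)%E -> (forall x, E x -> E1 x \/ E2 x) ->
    [\/ l = 1, l = 1 + t | l = 1 - t] ->
    exists2 r : R, 0 <= r & (\int[mu]_x (indic_W rho E l x)%:E)%E = r%:E.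
  move=> mE Efin EE lI; have := Ifin E l mE Efin EE lI.
  have := nonneg_integral_ge0 mu (nnW E l mE).
  case: (\int[mu]_x (indic_W rho E l x)%:E)%E => [r||]// r0 _.
  by exists r => //; rewrite -lee_fin.
have EE1 x : E1 x -> E1 x \/ E2 x by left.
have EE2 x : E2 x -> E1 x \/ E2 x by right.
have [n1 n10 n1E] := Ival E1 1 mE1 E1fin EE1 (Or31 _ _ erefl).
have [n2 n20 n2E] := Ival E2 1 mE2 E2fin EE2 (Or31 _ _ erefl).
have [u1 u10 u1E] := Ival E1 (1 + t) mE1 E1fin EE1 (Or32 _ _ erefl).
have [u2 u20 u2E] := Ival E2 (1 + t) mE2 E2fin EE2 (Or32 _ _ erefl).
have [v1 v10 v1E] := Ival E1 (1 - t) mE1 E1fin EE1 (Or33 _ _ erefl).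
have [v2 v20 v2E] := Ival E2 (1 - t) mE2 E2fin EE2 (Or33 _ _ erefl).
have lt_indic E l l' x : E x -> W l x < W l' x -> indic_W rho E l x < indic_W rho E l' x.
  by move=> xE h; rewrite /indic_W indicE mem_set// !mul1r.
have le_indic E l l' x : (E x -> W l x < W l' x) -> indic_W rho E l x <= indic_W rho E l' x.
  move=> h; rewrite /indic_W indicE; have [xE|xE] := boolP (x \in E); last by rewrite !mul0r.
  by rewrite !mul1r ltW// h//; rewrite inE in xE.
have uv1 : u1 < v1.
  rewrite -lte_fin -u1E -v1E; apply: (nonneg_integral_lt (nnW _ _ mE1) (nnW _ _ mE1) _ mE1 E10).
  - by move=> x; apply: le_indic; exact: decr.
  - by move=> x x1; apply: lt_indic => //; exact: decr.
  - by rewrite v1E ltry.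
have uv2 : v2 < u2.
  rewrite -lte_fin -u2E -v2E; apply: (nonneg_integral_lt (nnW _ _ mE2) (nnW _ _ mE2) _ mE2 E20).
  - by move=> x; apply: le_indic; exact: incr.
  - by move=> x x1; apply: lt_indic => //; exact: incr.
  - by rewrite u2E ltry.
have comb E n u v : measurable E -> mu E <> 0%E -> (forall x, E x -> E1 x \/ E2 x) ->
    (\int[mu]_x (indic_W rho E 1 x)%:E)%E = n%:E ->
    (\int[mu]_x (indic_W rho E (1 + t) x)%:E)%E = u%:E ->
    (\int[mu]_x (indic_W rho E (1 - t) x)%:E)%E = v%:E ->
    u * z1 + v * z2 < n * (z1 + z2).
  move=> mE E_0 EE nE uE vE.
  have zz0 : 0 <= z1 + z2 by rewrite addr_ge0// ltW.
  rewrite -lte_fin (mulrC u) (mulrC v) (mulrC n) EFinD !EFinM -nE -uE -vE.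
  rewrite -(nonneg_integral_lin mu (nnW E (1 + t) mE) (nnW E (1 - t) mE) (ltW z10) (ltW z20)).
  rewrite -(nonneg_integralZ mu (nnW E 1 mE) zz0).
  apply: (nonneg_integral_lt _ _ _ mE E_0).
  - by apply: nonneg_mfun_lin; [exact: nnW|exact: nnW|exact: ltW|exact: ltW].
  - by apply: nonneg_mfunZ => //; exact: nnW.
  - move=> x; rewrite /indic_W indicE; have [xE|xE] := boolP (x \in E).
      rewrite !mul1r -!/(W _ _) W1 mulr1 mulrC [X in _ + X]mulrC ltW//.
      by apply: chord; apply: EE; rewrite inE in xE.
    by rewrite !mul0r !mulr0 addr0.
  - move=> x xE; rewrite /indic_W indicE mem_set//.
    rewrite !mul1r -!/(W _ _) W1 mulr1 mulrC [X in _ + X]mulrC.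
    by apply: chord; apply: EE.
  - by rewrite nonneg_integralZ// ?nE -?EFinM ?ltry//; exact: nnW.
have c1 := comb _ _ _ _ mE1 E10 EE1 n1E u1E v1E.
have c2 := comb _ _ _ _ mE2 E20 EE2 n2E u2E v2E.
(* Cramer's rule for the two normalisations. Determinant and solutions are positive because [W]
   decreases on [E1] ([u1 < v1]) and increases on [E2] ([v2 < u2]). *)
have [w1 [w2 [w10 w20 wu wv wn]]] : exists w1 w2, [/\ 0 <= w1, 0 <= w2,
    w1 * u1 + w2 * u2 = 1, w1 * v1 + w2 * v2 = 1 & 1 < w1 * n1 + w2 * n2].
  have B0 : 0 < v1 * u2 - v2 * u1 by nra.
  exists ((u2 - v2) / (v1 * u2 - v2 * u1)), ((v1 - u1) / (v1 * u2 - v2 * u1)).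
  have BN0 : v1 * u2 - v2 * u1 != 0 by rewrite gt_eqF.
  have wu : (u2 - v2) / (v1 * u2 - v2 * u1) * u1 + (v1 - u1) / (v1 * u2 - v2 * u1) * u2 = 1.
    by field.
  have wv : (u2 - v2) / (v1 * u2 - v2 * u1) * v1 + (v1 - u1) / (v1 * u2 - v2 * u1) * v2 = 1.
    by field.
  have w10 : 0 < (u2 - v2) / (v1 * u2 - v2 * u1) by apply: divr_gt0 => //; rewrite subr_gt0.
  have w20 : 0 < (v1 - u1) / (v1 * u2 - v2 * u1) by apply: divr_gt0 => //; rewrite subr_gt0.
  split => //; try exact: ltW.
  move: wu wv w10 w20; move: (_ / _) (_ / _) => w2 w1 wu wv w10 w20.
  have zz : 0 < z1 + z2 by rewrite addr_gt0.
  rewrite -(ltr_pM2r zz) mul1r.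
  have : (w1 * u1 + w2 * u2) * z1 + (w1 * v1 + w2 * v2) * z2 < (w1 * n1 + w2 * n2) * (z1 + z2).
    have h1 : w1 * (u1 * z1 + v1 * z2) < w1 * (n1 * (z1 + z2)) by rewrite ltr_pM2l.
    have h2 : w2 * (u2 * z1 + v2 * z2) < w2 * (n2 * (z1 + z2)) by rewrite ltr_pM2l.
    by lra.
  by rewrite wu wv !mul1r.
pose f l := weighted rho E1 E2 w1 w2 l.
have mf l : measurable_fun [set: T] (f l) by exact: measurable_weighted.
have lineP l x : 1 - t <= l <= 1 + t -> (E1 `|` E2) x -> 0 < 1 - rho x + rho x * l.
  by move=> lI xE; have [] := good x l xE lI.
have Jf l : 0 < l -> 1 - t <= l <= 1 + t -> power_int mu P (dilate K l (f l)) =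
    (w1%:E * \int[mu]_x (indic_W rho E1 l x)%:E + w2%:E * \int[mu]_x (indic_W rho E2 l x)%:E)%E.
  by move=> l0 lI; apply: power_int_weighted => // x; exact: lineP.
have PFf l (r : R) : 0 < l -> power_int mu P (dilate K l (f l)) = r%:E -> PF (f l).
  move=> l0 Jl; rewrite -(dilateVK K (f l) l0); apply: (power_finite_dilate PK).
    by rewrite invr_gt0.
  by split; [exact: measurable_dilate PK _ _ (mf l)|rewrite Jl ltry].
have Ja := Jf _ a0 aI; rewrite u1E u2E -!EFinM -EFinD wu in Ja.
have Jb := Jf _ b0 bI; rewrite v1E v2E -!EFinM -EFinD wv in Jb.
have J1 := Jf _ ltr01 oI; rewrite n1E n2E -!EFinM -EFinD in J1.
have Fa := PFf _ _ a0 Ja; have Fb := PFf _ _ b0 Jb; have F1 := PFf _ _ ltr01 J1.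
have la : lev (f (1 + t)) <= 1 + t.
  by apply: (level_val_le PK Fa a0); rewrite power_valE Ja.
have lb : lev (f (1 - t)) <= 1 - t.
  by apply: (level_val_le PK Fb b0); rewrite power_valE Jb.
have fE : f 1 = (fun x => (f (1 + t) x + f (1 - t) x) / 2).
  by apply/funext => x; rewrite /f -weighted_mid.
have s2 : 0 < 1 + t + (1 - t) by rewrite addr_gt0.
(* The levels at the two ends add up to at most 2, so the midpoint would have level at most 1,
   against its integral exceeding 1. *)
have := conv _ _ _ Fa Fb s2 (lerD la lb); rewrite -fE.
have -> : (1 + t + (1 - t)) / 2 = 1 by field.
move=> /(power_dilate_level_le1 F1 ltr01); rewrite power_valE J1 /=.
by rewrite leNgt wn.
Qed.
End two_sets.

(** * A common constant [c] *)

Section separating_constant.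
Context d (T : measurableType d) (R : realType) (mu : {measure set T -> \bar R}).
Variables (P K : T -> R) (p0 p1 k0 k1 : R).
Hypothesis PK : exponents P K p0 p1 k0 k1.

Lemma positive_part_nonnull (F : set T) (g : T -> R) : measurable F ->
  measurable_fun [set: T] g -> (forall x, F x -> 0 < g x) -> mu F <> 0%E ->
  exists2 e : R, 0 < e & mu (F `&` [set x | e <= g x]) <> 0%E.
Proof.
move=> mF mg g0 F0; apply: contra_notP F0 => nE.
have mA (e : R) : measurable (F `&` [set x | e <= g x]).
  apply: measurableI => //; rewrite -[X in measurable X]setTI.
  have -> : [set x | e <= g x] = g @^-1` `[e, +oo[.
    by apply/seteqP; split => x /=; rewrite in_itv/= andbT.
  exact: mg.
have A0 n : mu (F `&` [set x | n.+1%:R^-1 <= g x]) = 0%E.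
  by apply: contra_notP nE => nA; exists n.+1%:R^-1; rewrite ?invr_gt0.
apply: (subset_measure0 (B := \bigcup_n (F `&` [set x | n.+1%:R^-1 <= g x]))) => //.
- exact: bigcup_measurable.
- move=> x Fx; have gx := g0 x Fx; exists (Num.truncn (g x)^-1) => //; split => //=.
  by rewrite -[leRHS]invrK lef_pV2 ?posrE ?invr_gt0// ltW// truncnS_gt.
- exact: measure_bigcup0.
Qed.

(** [lo x] and [hi x] are the ends of the interval of the [c] admissible at [x]. *)
Let lo x := 1 - 2 * K x - sqrt_disc (P x) (K x).
Let hi x := 1 - 2 * K x + sqrt_disc (P x) (K x).

Let m_sqrt_disc : measurable_fun [set: T] (fun x => sqrt_disc (P x) (K x)).
Proof.
have mP := exponents_mP PK; have mK := exponents_mK PK.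
rewrite /sqrt_disc.
rewrite (_ : (fun x => _) = (fun x => (4 * ((P x - 1) * (K x * (1 - K x)))) `^ 2^-1)).
  apply: measurable_fun_powR => //; apply: measurable_funM => //.
  apply: measurable_funM; first exact: measurable_funB.
  by apply: measurable_funM => //; exact: measurable_funB.
apply/funext => x; rewrite powR12_sqrt// mulr_ge0// mulr_ge0//.
  by rewrite subr_ge0 ltW// (P_gt1 PK).
by rewrite mulr_ge0 ?subr_ge0 ?ltW ?(K_gt0 PK) ?(K_lt1 PK).
Qed.

Let m_mid : measurable_fun [set: T] (fun x => 1 - 2 * K x).
Proof.
by apply: measurable_funB => //; apply: measurable_funM => //; exact: exponents_mK PK.
Qed.

Let m_lo c : measurable [set x | c < lo x].
Proof.
have ml : measurable_fun [set: T] lo by apply: measurable_funB.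
rewrite -[X in measurable X]setTI (_ : [set x | _] = lo @^-1` `]c, +oo[); first exact: ml.
by apply/seteqP; split => x /=; rewrite in_itv/= andbT.
Qed.

Let m_hi c : measurable [set x | hi x < c].
Proof.
have mh : measurable_fun [set: T] hi by apply: measurable_funD.
rewrite -[X in measurable X]setTI (_ : [set x | _] = hi @^-1` `]-oo, c[); first exact: mh.
by apply/seteqP; split => x /=; rewrite in_itv/=.
Qed.

(** [c < lo] and [hi < c] are the two ways to have a positive discriminant, told apart by the sign
    of [1 - 2 K - c]. If neither set is invisible, subsets of finite positive measure with a uniform
    margin give the situation excluded by [level_midconvex_two_sets]. *)
Lemma lo_hi_dichotomy c : level_midconvex mu P K ->
  invisible mu [set x | c < lo x] \/ invisible mu [set x | hi x < c].
Proof.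
move=> conv; apply: contrapT => /not_orP[n1 n2].
have [F1 [mF1 F1s F1fin F10]] := not_invisible (m_lo c) n1.
have [F2 [mF2 F2s F2fin F20]] := not_invisible (m_hi c) n2.
have ml : measurable_fun [set: T] (fun x => lo x - c).
  by apply: measurable_funB => //; apply: measurable_funB.
have mh : measurable_fun [set: T] (fun x => c - hi x).
  by apply: measurable_funB => //; apply: measurable_funD.
have [e1 e10 E10] := positive_part_nonnull mF1 ml (fun x x1 => ltac:(rewrite subr_gt0; exact: F1s)) F10.
have [e2 e20 E20] := positive_part_nonnull mF2 mh (fun x x2 => ltac:(rewrite subr_gt0; exact: F2s)) F20.
have mS (g : T -> R) (e : R) : measurable_fun [set: T] g -> measurable [set x | e <= g x].
  move=> mg; rewrite -[X in measurable X]setTI.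
  have -> : [set x | e <= g x] = g @^-1` `[e, +oo[.
    by apply/seteqP; split => x /=; rewrite in_itv/= andbT.
  exact: mg.
have mE1 : measurable (F1 `&` [set x | e1 <= lo x - c]) by apply: measurableI => //; exact: mS.
have mE2 : measurable (F2 `&` [set x | e2 <= c - hi x]) by apply: measurableI => //; exact: mS.
have ee0 : 0 < Num.min e1 e2 by rewrite lt_min e10.
have ee1 : Num.min e1 e2 <= e1 by rewrite ge_min lexx.
have ee2 : Num.min e1 e2 <= e2 by rewrite ge_min lexx orbT.
apply: (level_midconvex_two_sets (c := c) PK conv ee0 mE1 mE2 _ _ E10 E20).
- apply: le_lt_trans F1fin; apply: le_measure; rewrite ?inE//; exact: subIsetl.
- apply: le_lt_trans F2fin; apply: le_measure; rewrite ?inE//; exact: subIsetl.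
- by move=> x [_ /=]; move: ee1; rewrite /lo; move: (Num.min e1 e2) => e; lra.
- by move=> x [_ /=]; move: ee2; rewrite /hi; move: (Num.min e1 e2) => e; lra.
Qed.

Lemma exists_disc_le : level_midconvex mu P K -> exists c, forall f,
  power_finite mu P f -> {ae mu, forall x, ~ disc_le (P x) (K x) c -> f x = 0}.
Proof.
move=> conv.
have sd0 x : 0 <= sqrt_disc (P x) (K x) by exact: sqrtr_ge0.
have inv0 E : E = set0 -> invisible mu E.
  by move=> ->; split => // F _; rewrite subset0 => -> _; rewrite measure0.
have nV0 (n : nat) : 0 < n.+1%:R^-1 :> R by rewrite invr_gt0.
(* The supremum of [A] is the common point. [hi > -1] puts [-2] in [A]. The cap 2 keeps [A] bounded
   even if the whole space is invisible; it does no harm because [lo < 1], so only [c < 1] needs the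
   dichotomy, applied just above [c]. *)
pose A := [set c : R | c <= 2 /\ invisible mu [set x | hi x < c]].
have A2 : A (-2).
  split; first by lra.
  apply: inv0; rewrite -subset0 => x /=; rewrite /hi.
  by have := sd0 x; have := K_lt1 PK x; lra.
have supA : has_sup A.
  by split; [exists (-2)|exists 2 => c []].
pose c := sup A.
have bad2 : invisible mu [set x | hi x < c].
  have -> : [set x | hi x < c] = \bigcup_n [set x | hi x < c - n.+1%:R^-1].
    apply/seteqP; split => [x /= hx|x [n _ /= hx] /=].
      have ch : 0 < c - hi x by rewrite subr_gt0.
      exists (Num.truncn (c - hi x)^-1) => //=.
      rewrite ltrBrDl -ltrBrDr -[ltRHS]invrK ltf_pV2 ?posrE ?invr_gt0//.
      exact: truncnS_gt.
    by apply: (lt_trans hx); rewrite ltrBlDr ltrDl nV0.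
  apply: invisible_bigcup => n.
  have n0 := nV0 n.
  have [c' [_ ic'] cc'] := sup_adherent n0 supA.
  by apply: invisibleS ic' => // x /= hx; apply: (lt_trans hx); exact: cc'.
have bad1 : invisible mu [set x | c < lo x].
  have [c1|c1] := leP 1 c.
    apply: inv0; rewrite -subset0 => x /=; rewrite /lo.
    by have := sd0 x; have := K_gt0 PK x; lra.
  have -> : [set x | c < lo x] = \bigcup_n [set x | c + n.+1%:R^-1 < lo x].
    apply/seteqP; split => [x /= hx|x [n _ /= hx] /=].
      have ch : 0 < lo x - c by rewrite subr_gt0.
      exists (Num.truncn (lo x - c)^-1) => //=.
      rewrite addrC -ltrBrDr -[ltRHS]invrK ltf_pV2 ?posrE ?invr_gt0//.
      exact: truncnS_gt.
    by apply: le_lt_trans hx; rewrite lerDl ltW// nV0.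
  apply: invisible_bigcup => n.
  have n0 := nV0 n.
  have n1 : n.+1%:R^-1 <= 1 :> R by rewrite invf_le1// ler1n.
  have [//|ih] := lo_hi_dichotomy (c + n.+1%:R^-1) conv.
  have : A (c + n.+1%:R^-1).
    by split => //; rewrite (le_trans (lerD (ltW c1) n1)).
  by move=> /(sup_upper_bound supA); rewrite -/c gerDl leNgt nV0.
exists c => f Ff.
have := invisible_ae PK bad1 Ff; have := invisible_ae PK bad2 Ff.
apply: filterS2 => x h2 h1 nd.
have [l1|/h1//] := leP (lo x) c; have [l2|/h2//] := leP c (hi x).
exfalso; apply: nd; rewrite /disc_le.
have kI : 0 < K x < 1 by rewrite (K_gt0 PK) (K_lt1 PK).
rewrite -(sqr_sqrt_disc (P_gt1 PK x) kI).
have : `|1 - 2 * K x - c| <= sqrt_disc (P x) (K x).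
  by rewrite ler_norml; move: l1 l2; rewrite /lo /hi; lra.
rewrite -(real_normK (num_real (1 - 2 * K x - c))) => h.
by rewrite ler_sqr ?nnegrE ?sd0.
Qed.
End separating_constant.

(** * Modular and norm of sequences *)

Section sequences.
Local Open Scope ereal_scope.
Context d (T : measurableType d) (R : realType) (mu : {measure set T -> \bar R}).
Variables (P K : T -> R) (p0 p1 k0 k1 : R).
Hypothesis PK : exponents P K p0 p1 k0 k1.
Implicit Types f g : nat -> T -> R.

Definition level_sum f : \bar R := \sum_(nu <oo) level mu P K (f nu).

Definition level_norm f : \bar R := ereal_inf
  [set m%:E | m in
    [set m : R | (0 < m)%R /\ level_sum (fun nu x => f nu x / m)%R <= 1]].

Definition levels_finite f := forall nu, power_finite mu P (f nu).

Lemma level_sum_ge0 f : 0 <= level_sum f.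
Proof. by apply: nneseries_ge0 => nu _ _; exact: level_ge0. Qed.

Lemma level_sum_le f g (c : R) : (0 <= c)%R ->
  (forall nu, level mu P K (f nu) <= c%:E * level mu P K (g nu)) ->
  level_sum f <= c%:E * level_sum g.
Proof.
move=> c0 fg; rewrite /level_sum -nneseriesZl; last by move=> i _; exact: level_ge0.
by apply: lee_nneseries => [i _ _|i _]; [exact: level_ge0|exact: fg].
Qed.

Lemma level_sum_scale_ge1 (s : R) f : levels_finite f -> (1 <= s)%R ->
  level_sum (fun nu x => s * f nu x)%R <= (s `^ k0^-1)%:E * level_sum f.
Proof.
move=> Ff s1; apply: level_sum_le => [|nu]; first exact: powR_ge0.
exact: (level_scale_ge1 mu PK s1 (Ff nu).1).
Qed.

Lemma levels_finite_scale (s : R) f : levels_finite f ->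
  levels_finite (fun nu x => s * f nu x)%R.
Proof.
move=> Ff nu; have := power_finite_lin PK s 0 (Ff nu) (Ff nu).
by congr (power_finite mu P _); apply/funext => x; rewrite mul0r addr0.
Qed.

Lemma level_norm_le f (m : R) : (0 < m)%R ->
  level_sum (fun nu x => f nu x / m)%R <= 1 -> level_norm f <= m%:E.
Proof. by move=> m0 fm; apply: ereal_inf_lbound; exists m. Qed.

(** Dividing by an admissible [s < m] brings the modular to at most 1; multiplying back costs at
    most [m ^ (1 / k0)], where [1 / k0] is the upper bound for [q]. *)
Lemma level_sum_norm f (m : R) : levels_finite f -> (1 <= m)%R ->
  level_norm f < m%:E -> level_sum f <= (m `^ k0^-1)%:E.
Proof.
move=> Ff m1 /ereal_inf_lt[_ [s [s0 fs] <-]]; rewrite lte_fin => sm.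
have k0_0 := exponents_k0 PK.
have m0 : (0 < m)%R by lra.
have Fs : levels_finite (fun nu x => f nu x / s)%R.
  rewrite (_ : (fun nu x => _) = (fun nu x => s^-1 * f nu x)%R).
    exact: levels_finite_scale.
  by apply/funext => nu; apply/funext => x; rewrite mulrC.
have fE : f = (fun nu x => s * (f nu x / s))%R.
  by apply/funext => nu; apply/funext => x; rewrite mulrC divfK// gt_eqF.
have h (u : \bar R) : 0 <= u -> u <= 1 -> (m `^ k0^-1)%:E * u <= (m `^ k0^-1)%:E.
  by move=> u0 u1; rewrite -[leRHS]mule1 lee_wpmul2l// lee_fin powR_ge0.
apply: (@le_trans _ _ ((m `^ k0^-1)%:E * level_sum (fun nu x => f nu x / s)%R)).
  rewrite [in leLHS]fE; apply: (@le_trans _ _ (level_sum (fun nu x => m * (f nu x / s))%R)).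
    apply: lee_nneseries => [i _ _|i _]; first exact: level_ge0.
    have sm01 : (0 < s / m <= 1)%R by rewrite divr_gt0//= ler_pdivrMr// mul1r ltW.
    have := level_scale_le1 mu PK sm01 (levels_finite_scale m Fs i).1.
    rewrite (_ : (fun x => s / m * _)%R = (fun x => s * (f i x / s))%R); last first.
      by apply/funext => x; rewrite mulrA divfK// gt_eqF.
    move=> /le_trans; apply.
    rewrite -[leRHS]mul1e; apply: lee_wpmul2r; first exact: level_ge0.
    rewrite lee_fin; apply: (@le_trans _ _ (1 `^ k1^-1)%R); last by rewrite powR1.
    have k1_0 : (0 < k1)%R.
      by have := exponents_K PK point; lra.
    case/andP: sm01 => sm0 sm1.
    by apply: ge0_ler_powR; rewrite ?nnegrE ?invr_ge0 ?(ltW k1_0) ?(ltW sm0).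
  exact: level_sum_scale_ge1.
by apply: h => //; exact: level_sum_ge0.
Qed.

Lemma level_norm_le1 f : levels_finite f -> level_norm f <= 1 -> level_sum f <= 1.
Proof.
move=> Ff f1; have k0_0 := exponents_k0 PK; apply/lee_addgt0Pr => e e0.
rewrite -EFinD -[(1 + e)%R](_ : ((1 + e) `^ k0) `^ k0^-1 = 1 + e)%R; last first.
  by rewrite -powRrM mulfV ?gt_eqF// powRr1//; lra.
have m1 : (1 < (1 + e) `^ k0)%R by apply: powR_gt1 => //; lra.
apply: level_sum_norm => //; first exact: ltW.
by apply: (le_lt_trans f1); rewrite lte_fin.
Qed.

Lemma level_sum_le_norm f (del : R) : levels_finite f -> (0 < del < 1)%R ->
  level_sum f <= (1 - del)%:E -> level_norm f <= ((1 - del) `^ k0)%:E.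
Proof.
move=> Ff /andP[d0 d1] fd; have k0_0 := exponents_k0 PK.
have e0 : (0 < 1 - del)%R by lra.
have m0 : (0 < (1 - del) `^ k0)%R by rewrite powR_gt0.
apply: level_norm_le => //.
have m1 : (1 <= ((1 - del) `^ k0)^-1)%R.
  rewrite invf_ge1//; apply: (@le_trans _ _ (1 `^ k0)%R); last by rewrite powR1.
  by apply: ge0_ler_powR; rewrite ?nnegrE; lra.
rewrite (_ : (fun nu x => _) = (fun nu x => ((1 - del) `^ k0)^-1 * f nu x)%R); last first.
  by apply/funext => nu; apply/funext => x; rewrite mulrC.
apply: (le_trans (level_sum_scale_ge1 Ff m1)).
rewrite -powRN -powRrM mulNr mulfV ?gt_eqF// powR_inv1 ?(ltW e0)//.
by rewrite lee_pdivrMl// mule1.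
Qed.

Lemma level_norm_ge_sum f (m : R) : levels_finite f -> (0 < m <= 1)%R ->
  m%:E < level_norm f -> (m `^ k0^-1)%:E <= level_sum f.
Proof.
move=> Ff /andP[m0 m1] mf; rewrite leNgt; apply/negP => fm.
move: mf; rewrite ltNge => /negP; apply; apply: level_norm_le => //.
rewrite (_ : (fun nu x => _) = (fun nu x => m^-1 * f nu x)%R); last first.
  by apply/funext => nu; apply/funext => x; rewrite mulrC.
have mV1 : (1 <= m^-1)%R by rewrite invf_ge1.
apply: (le_trans (level_sum_scale_ge1 Ff mV1)).
rewrite -(powR_inv1 (ltW m0)) -powRrM mulN1r powRN lee_pdivrMl ?powR_gt0//.
by rewrite mule1 ltW.
Qed.

Lemma level_sum_uniformly_convex (c e : R) :
  (forall h : T -> R, power_finite mu P h ->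
     {ae mu, forall x, ~ disc_le (P x) (K x) c -> h x = 0%R}) ->
  (0 < e <= 1)%R -> exists2 del : R, (0 < del < 1)%R & forall f g,
  levels_finite f -> levels_finite g -> level_sum f <= 1 -> level_sum g <= 1 ->
  e%:E <= level_sum (fun nu x => f nu x - g nu x)%R ->
  level_sum (fun nu x => (f nu x + g nu x) / 2)%R <= (1 - del)%:E.
Proof.
move=> disc_ok /andP[e0 e1].
(* Summation produces the bound [1 + kap * e / 2], from which the difference subtracts [kap * e]; a
   gain of [kap * e / 2] is left. *)
have e4 : (0 < e / 4 < 1)%R by lra.
have [kap kap0 uc] := level_uniformly_convex PK disc_ok e4.
pose del := (Num.min (kap * e / 2) 2^-1)%R.
have d0 : (0 < del)%R by rewrite lt_min invr_gt0 ltr0n divr_gt0// mulr_gt0.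
have d1 : (del <= kap * e / 2)%R by rewrite ge_min lexx.
have d2 : (del <= 2^-1)%R by rewrite ge_min lexx orbT.
exists del; first by rewrite d0 (le_lt_trans d2)// invf_lt1// ltr1n.
move=> f g Ff Fg f1 g1 efg.
pose C := (2^-1 + kap * (e / 4))%R.
have C0 : (0 <= C)%R by rewrite addr_ge0 ?invr_ge0// mulr_ge0 ?ltW//; case/andP: e4.
have sum_le : level_sum (fun nu x => (f nu x + g nu x) / 2)%R +
    kap%:E * level_sum (fun nu x => f nu x - g nu x)%R <=
    C%:E * (level_sum f + level_sum g).
  have lv0 (h : T -> R) : 0 <= level mu P K h by exact: level_ge0.
  have kv0 (h : T -> R) : 0 <= kap%:E * level mu P K h.
    by rewrite mule_ge0// lee_fin ltW.
  rewrite /level_sum -nneseriesZl// -nneseriesD// -nneseriesD// -nneseriesZl; last first.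
    by move=> i _; rewrite adde_ge0.
  apply: lee_nneseries => [i _ _|i _]; first by rewrite adde_ge0.
  have := uc _ _ (Ff i) (Fg i).
  rewrite (level_fineK PK (Ff i)) (level_fineK PK (Fg i)).
  rewrite (level_fineK PK (power_finite_mid PK (Ff i) (Fg i))).
  rewrite (level_fineK PK (power_finite_sub PK (Ff i) (Fg i))).
  by rewrite -!(EFinM, EFinD) lee_fin.
have : level_sum (fun nu x => (f nu x + g nu x) / 2)%R + (kap * e)%:E <= (C * 2)%:E.
  apply: (@le_trans _ _ (C%:E * (level_sum f + level_sum g))).
    by apply: le_trans sum_le; apply: leeD => //; rewrite EFinM lee_wpmul2l// lee_fin ltW.
  rewrite EFinM lee_wpmul2l// -[2%:E]/((1 + 1)%:E) EFinD leeD//.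
have := level_sum_ge0 (fun nu x => (f nu x + g nu x) / 2)%R.
case: (level_sum (fun nu x => (f nu x + g nu x) / 2)%R) => [r||]//.
rewrite -EFinD !lee_fin /C => r0; lra.
Qed.
End sequences.

(** * Midpoint convexity of the level from the unit ball *)

Section pairs.
Local Open Scope ereal_scope.
Context d (T : measurableType d) (R : realType) (mu : {measure set T -> \bar R}).
Variables (P K : T -> R) (p0 p1 k0 k1 : R).
Hypothesis PK : exponents P K p0 p1 k0 k1.

Definition pair_seq (h1 h2 : T -> R) (nu : nat) : T -> R :=
  if nu is nu'.+1 then if nu' is _.+1 then fun=> 0%R else h2 else h1.

Lemma power_int0 : power_int mu P (fun=> 0%R) = 0.
Proof.
rewrite power_intE; apply: integral0_eq => x _.
by rewrite normr0 powR0// gt_eqF// (P_gt0 PK).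
Qed.

Lemma level0 : level mu P K (fun=> 0%R) = 0.
Proof.
have d0 (l : R) : dilate K l (fun=> 0%R) = fun=> 0%R.
  by apply/funext => x; rewrite dilateE mul0r.
apply/eqP; rewrite eq_le level_ge0 andbT; apply/lee_addgt0Pr => e e0.
by rewrite add0e; apply: level_le => //; rewrite d0 power_int0.
Qed.

Lemma level_sum_pair h1 h2 :
  level_sum mu P K (pair_seq h1 h2) = level mu P K h1 + level mu P K h2.
Proof.
have lv0 (h : T -> R) : 0 <= level mu P K h by exact: level_ge0.
rewrite /level_sum (nneseries_split 0 2)//= add0n eseries0; last first.
  by move=> [|[|i]] //= _ _; exact: level0.
by rewrite adde0 big_nat_recl// big_nat1.
Qed.

Lemma levels_finite_pair h1 h2 : power_finite mu P h1 -> power_finite mu P h2 ->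
  levels_finite mu P (pair_seq h1 h2).
Proof.
move=> F1 F2 [|[|nu]] //=; split; first exact: measurable_cst.
by rewrite power_int0 ltry.
Qed.

(* Convexity of the unit ball, applied to (f, g, 0, ..) and (g, f, 0, ..),
   makes the level functional itself midpoint convex: the dilations
   [dilate K s] rescale the level linearly. *)
Lemma unit_ball_midconvex :
  (forall f g, levels_finite mu P f -> levels_finite mu P g ->
    level_sum mu P K f <= 1 -> level_sum mu P K g <= 1 ->
    level_norm mu P K (fun nu x => (f nu x + g nu x) / 2)%R <= 1) ->
  level_midconvex mu P K.
Proof.
move=> ball f g s Ff Fg s0 fgs.
have Fsf := power_finite_dilate PK s0 Ff; have Fsg := power_finite_dilate PK s0 Fg.
have Fm := power_finite_mid PK Ff Fg.
have sum1 : (level_val mu P K (dilate K s f) + level_val mu P K (dilate K s g) <= 1)%R.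
  by rewrite -(ler_pM2l s0) mulrDr mulr1 -(level_val_dilate PK Ff s0) -(level_val_dilate PK Fg s0).
have := ball _ _ (levels_finite_pair Fsf Fsg) (levels_finite_pair Fsg Fsf).
rewrite !level_sum_pair (level_fineK PK Fsf) (level_fineK PK Fsg) -!EFinD !lee_fin.
move=> /(_ sum1); rewrite (addrC (level_val mu P K (dilate K s g))) => /(_ sum1).
pose h x := ((dilate K s f x + dilate K s g x) / 2)%R.
have hE : h = dilate K s (fun x => (f x + g x) / 2)%R.
  by apply/funext => x; rewrite /h !dilateE; ring.
have -> : (fun nu x => (pair_seq (dilate K s f) (dilate K s g) nu x +
    pair_seq (dilate K s g) (dilate K s f) nu x) / 2)%R = pair_seq h h.
  apply/funext => -[|[|nu]]; apply/funext => x //=.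
    by rewrite /h addrC.
  by rewrite addr0 mul0r.
have Fh : power_finite mu P h by rewrite hE; exact: (power_finite_dilate PK s0 Fm).
(* Both entries of the midpoint sequence are [h], so twice its level is at most 1. *)
move=> /(level_norm_le1 PK (levels_finite_pair Fh Fh)).
rewrite level_sum_pair (level_fineK PK Fh) -EFinD lee_fin => h1.
rewrite (level_val_dilate PK Fm s0) -hE; apply: ler_pM => //.
- exact: ltW.
- exact: level_val_ge0.
- by move: h1; move: (level_val mu P K h) => z; lra.
Qed.
End pairs.

(** * From extended-valued exponents to real bounded ones *)

Section transfer.
Local Open Scope ereal_scope.
Context d (T : measurableType d) (R : realType) (mu : {measure set T -> \bar R}).
Implicit Types (p q : T -> \bar R) (f g h : T -> R).

(** Gives bounds at every point and changes the exponent only on a null set when [a] and [b] are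
    essential bounds. *)
Definition clip (a b : R) p x : R := Num.max a (Num.min b (fine (p x))).

Lemma measurable_clip a b p : measurable_fun [set: T] p ->
  measurable_fun [set: T] (clip a b p).
Proof.
move=> mp; apply: measurable_maxr => //; apply: measurable_minr => //.
exact: (measurableT_comp (fine_measurable measurableT)).
Qed.

Lemma clip_itv a b p x : (a <= b)%R -> (a <= clip a b p x <= b)%R.
Proof.
by move=> ab; rewrite /clip le_max lexx/= ge_max ab ge_min lexx.
Qed.

Lemma clip_id a b p x : a%:E <= p x <= b%:E -> p x = (clip a b p x)%:E.
Proof.
rewrite /clip; case: (p x) => [r||]; rewrite ?lee_fin ?leye_eq ?leeNy_eq ?andbF//= => /andP[ar rb].
by rewrite min_r// max_r.
Qed.

Lemma ess_bounds p : [/\ 1 < ess_inf mu p, ess_inf mu p <= ess_sup mu p & ess_sup mu p < +oo] ->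
  exists a b : R, [/\ (1 < a)%R, (a <= b)%R &
    {ae mu, forall x, p x = (clip a b p x)%:E}].
Proof.
case=> h1 h2 h3; have := ess_inf_le mu p; have := ess_sup_ge mu p.
move: h1 h2 h3; case: (ess_inf mu p) => [a||]//; case: (ess_sup mu p) => [b||]// a1 ab _ pb pa.
exists a, b; split => //.
by move: pa pb; apply: filterS2 => x xa xb; apply: clip_id; rewrite xa xb.
Qed.

Lemma modular_LpE p (P : T -> R) g h : exponent p ->
  measurable_fun [set: T] P -> {ae mu, forall x, p x = (P x)%:E} ->
  measurable_fun [set: T] g -> measurable_fun [set: T] h ->
  {ae mu, forall x, g x = h x} -> modular_Lp mu p g = power_int mu P h.
Proof.
move=> [mp p1] mP pP mg mh gh; rewrite /modular_Lp power_intE.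
(* The exponent is finite almost everywhere, so the restriction to [Omega_infty p] vanishes almost
   everywhere. *)
have -> : Lnorm mu +oo (EFin \o (g \_ (Omega_infty p))) = 0.
  rewrite unlock; case: ifPn => // mu0; apply: ess_sup_ae_cst => //.
  apply: filterS pP => x px /=; rewrite patchE memNset ?normr0//.
  by rewrite /Omega_infty /= px.
have mO : measurable (Omega_0 p).
  apply: measurableC; rewrite -[X in measurable X]setTI.
  by rewrite (_ : Omega_infty p = p @^-1` [set +oo])//; exact: mp.
have mJ : measurable_fun [set: T] (fun x => (`|g x| `^ fine (p x))%:E).
  apply/measurable_EFinP; apply: measurable_fun_powR.
    exact: measurableT_comp.
  exact: (measurableT_comp (fine_measurable measurableT)).
rewrite adde0 integral_mkcond; apply: ge0_ae_eq_integral => //.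
- by apply/(measurable_restrictT _ mO); exact: measurable_funS mJ.
- by apply/measurable_EFinP; exact: (nonneg_mfun_powR mh mP).1.
- by move=> x _; rewrite patchE; case: ifP => // _; rewrite lee_fin powR_ge0.
move: pP gh; apply: filterS2 => x px gx _; rewrite patchE mem_set ?px ?gx//.
by rewrite /Omega_0 /Omega_infty /= px.
Qed.

Lemma measurable_root_exponent (l : R) q : exponent q ->
  measurable_fun [set: T] (fun x => root_exponent l (q x)).
Proof.
move=> [mq q1].
rewrite (_ : (fun x => _) = fun x => if q x == +oo then 1%R else (l `^ ((fine (q x)) `^ (-1)))%R); last first.
  apply/funext => x; have := q1 x; case: (q x) => [r||]//= r1.
  by rewrite powR_inv1// (le_trans _ (_ : 1 <= r)%R).
apply: measurable_fun_ifT => //.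
- apply: (measurable_fun_bool true).
  rewrite setTI (_ : _ @^-1` _ = q @^-1` [set +oo]); first by rewrite -[X in measurable X]setTI; exact: mq.
  by apply/seteqP; split => x /=; [move/eqP|move=> ->; rewrite eqxx].
- apply: measurable_fun_powR => //; apply: measurable_fun_powR => //.
  exact: (measurableT_comp (fine_measurable measurableT)).
Qed.

Section exponents.
Local Open Scope ereal_scope.
Variables (p q : T -> \bar R) (P Q : T -> R) (p0 p1 k0 k1 : R).
Hypotheses (ep : exponent p) (eq : exponent q).
(** The inverse is written as a power so that [measurable_fun_powR] gives its measurability. *)
Let K x := ((Q x) `^ (-1))%R.
Hypothesis PK : exponents P K p0 p1 k0 k1.
Hypotheses (pP : {ae mu, forall x, p x = (P x)%:E}) (qQ : {ae mu, forall x, q x = (Q x)%:E}).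
Hypothesis Q1 : forall x, (1 <= Q x)%R.

Lemma modular_Lp_dilate (l : R) f : measurable_fun [set: T] f ->
  modular_Lp mu p (fun x => f x / root_exponent l (q x))%R = power_int mu P (dilate K l f).
Proof.
move=> mf; have mP := exponents_mP PK.
have mr := measurable_root_exponent l eq.
have r0 x : (0 <= root_exponent l (q x))%R.
  by rewrite /root_exponent; case: (q x) => [r||]; rewrite ?powR_ge0.
apply: modular_LpE => //.
- apply: measurable_funM => //.
  rewrite (_ : (fun x => _) = fun x => (root_exponent l (q x) `^ (-1))%R); last first.
    by apply/funext => x; rewrite powR_inv1.
  exact: measurable_fun_powR.
- exact: measurable_dilate PK _ _ mf.
apply: filterS qQ => x qx; rewrite dilateE qx /= /K powR_inv1//.
exact: le_trans (Q1 x).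
Qed.

(** For bounded exponents, finiteness at one scale implies finiteness at every scale. *)
Lemma in_Lp_power_finite f : in_Lp mu p f <-> power_finite mu P f.
Proof.
have mP := exponents_mP PK; split.
  move=> [mf [l l0]].
  have mfl : measurable_fun [set: T] (fun x => f x / l)%R by exact: measurable_funM.
  rewrite (modular_LpE ep mP pP mfl mfl (aeW mu (fun x => erefl))) => fin.
  have := power_finite_lin PK l 0%R (conj mfl fin) (conj mfl fin).
  congr (power_finite mu P _); apply/funext => x; rewrite mul0r addr0.
  by rewrite mulrC divfK// gt_eqF.
move=> [mf Jf]; split => //; exists 1%R => //.
have mfl : measurable_fun [set: T] (fun x => f x / 1)%R by exact: measurable_funM.
rewrite (modular_LpE ep mP pP mfl mf)//.
by apply: aeW => x; rewrite divr1.
Qed.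

Lemma modular_lqLpE (f : nat -> T -> R) : (forall nu, measurable_fun [set: T] (f nu)) ->
  modular_lqLp mu p q f = level_sum mu P K f.
Proof.
move=> mf; rewrite /modular_lqLp /level_sum; apply: eq_eseriesr => nu _.
rewrite levelE; congr (ereal_inf (image _ _)); apply/seteqP.
by split => l /= [l0]; rewrite modular_Lp_dilate.
Qed.

Lemma norm_lqLpE (f : nat -> T -> R) : (forall nu, measurable_fun [set: T] (f nu)) ->
  norm_lqLp mu p q f = level_norm mu P K f.
Proof.
move=> mf; rewrite /norm_lqLp /level_norm; congr (ereal_inf (image _ _)).
have mfm (m : R) nu : measurable_fun [set: T] (fun x => f nu x / m)%R by exact: measurable_funM.
by apply/seteqP; split => m /= [m0]; rewrite modular_lqLpE.
Qed.
End exponents.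
End transfer.

(** * Assembly *)

Section main.
Local Open Scope ereal_scope.
Context d (T : measurableType d) (R : realType) (mu : {measure set T -> \bar R}).

Lemma exponents_clip (p q : T -> \bar R) (a b a' b' : R) : exponent p -> exponent q ->
  (1 < a)%R -> (a <= b)%R -> (1 < a')%R -> (a' <= b')%R ->
  exponents (clip a b p) (fun x => (clip a' b' q x `^ (-1))%R) a b b'^-1 a'^-1.
Proof.
move=> [mp _] [mq _] a1 ab a1' ab'.
split => //.
- exact: measurable_clip.
- by apply: measurable_fun_powR => //; exact: measurable_clip.
- by rewrite invr_gt0; lra.
- by rewrite invf_lt1//; lra.
- by move=> x; exact: clip_itv.
move=> x; have /andP[h1 h2] := clip_itv q x ab'.
by rewrite powR_inv1 ?lef_pV2 ?posrE; lra.
Qed.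

Theorem lqLp_uniformly_convex (p q : T -> \bar R) : exponent p -> exponent q ->
  [/\ 1 < ess_inf mu p, ess_inf mu p <= ess_sup mu p & ess_sup mu p < +oo] ->
  [/\ 1 < ess_inf mu q, ess_inf mu q <= ess_sup mu q & ess_sup mu q < +oo] ->
  banach_space (lqLp mu p q) (seq_ae_eq mu) (norm_lqLp mu p q) ->
  uniformly_convex (lqLp mu p q) (norm_lqLp mu p q).
Proof.
move=> ep eq /ess_bounds[a [b [a1 ab pP]]] /ess_bounds[a' [b' [a1' ab' qQ]]] ban.
pose P := clip a b p; pose Q := clip a' b' q; pose K x := (Q x `^ (-1))%R.
have PK : exponents P K a b b'^-1 a'^-1 by exact: exponents_clip.
have Q1 x : (1 <= Q x)%R by have /andP[h _] := clip_itv q x ab'; rewrite /Q; lra.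
have LpE f := in_Lp_power_finite ep PK pP f.
have SE f : lqLp mu p q f -> levels_finite mu P f by move=> [h _] nu; exact/LpE.
have mF f : levels_finite mu P f -> forall nu, measurable_fun [set: T] (f nu).
  by move=> Ff nu; exact: (Ff nu).1.
have modE f : levels_finite mu P f -> modular_lqLp mu p q f = level_sum mu P K f.
  by move=> Ff; exact: (modular_lqLpE ep eq PK pP qQ Q1 (mF _ Ff)).
have normE f : levels_finite mu P f -> norm_lqLp mu p q f = level_norm mu P K f.
  by move=> Ff; exact: (norm_lqLpE ep eq PK pP qQ Q1 (mF _ Ff)).
have midE (f g : nat -> T -> R) :
    (2^-1 *: (f + g))%R = (fun nu x => (f nu x + g nu x) / 2)%R.
  by apply/funext => nu; apply/funext => x; rewrite mulrC.
have midF f g : levels_finite mu P f -> levels_finite mu P g ->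
    levels_finite mu P (fun nu x => (f nu x + g nu x) / 2)%R.
  by move=> Ff Fg nu; exact: (power_finite_mid PK (Ff nu) (Fg nu)).
have divr1E (f : nat -> T -> R) : (fun nu x => f nu x / 1)%R = f.
  by apply/funext => nu; apply/funext => x; rewrite divr1.
have ball_mem f : levels_finite mu P f -> level_sum mu P K f <= 1 ->
    lqLp mu p q f /\ norm_lqLp mu p q f <= 1.
  move=> Ff f1; split; last by rewrite normE// level_norm_le// divr1E.
  split; first by move=> nu; exact/LpE.
  by exists 1%R => //; rewrite divr1E modE//; apply: le_lt_trans f1 _; rewrite ltry.
(* The Banach hypothesis enters here: homogeneity and the triangle inequality put the midpoint of
   two elements of the unit ball back into the ball. *)
have conv : level_midconvex mu P K.
  apply: (unit_ball_midconvex PK) => f g Ff Fg f1 g1.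
  have [Sf Nf] := ball_mem f Ff f1; have [Sg Ng] := ball_mem g Fg g1.
  rewrite -normE; last exact: midF.
  rewrite -midE (banach_normZ ban); last exact: (banach_add ban).
  rewrite ger0_norm ?invr_ge0// lee_pdivrMl// mule1.
  apply: (le_trans (banach_normD ban Sf Sg)).
  have -> : 2%:E = 1 + 1 :> \bar R by rewrite -EFinD.
  exact: (leeD Nf Ng).
have [c disc_ok] := exists_disc_le PK conv.
(* [level_norm_ge_sum] needs a strict lower bound [m <= 1] for the norm of the difference; [e / 4]
   qualifies because [e <= 2]. *)
move=> e /andP[e0 e2]; pose m := (e / 4)%R.
have m01 : (0 < m <= 1)%R by rewrite /m; lra.
have me : (m < e)%R by rewrite /m; lra.
have k0_0 := exponents_k0 PK.
have r01 : (0 < m `^ (b'^-1)^-1 <= 1)%R.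
  case/andP: (m01) => m0 m1; rewrite powR_gt0//=.
  apply: (@le_trans _ _ (1 `^ (b'^-1)^-1)%R); last by rewrite powR1.
  have r0 : (0 <= (b'^-1)^-1)%R by rewrite invr_ge0 ltW.
  by apply: ge0_ler_powR; rewrite ?nnegrE// ltW.
have [del d01 uc] := level_sum_uniformly_convex PK disc_ok r01.
(* With [k0 = 1 / b'], a modular of at most [1 - del] means a norm of at most [(1 - del) ^ k0]. *)
exists (1 - (1 - del) `^ b'^-1)%R.
  have /andP[d0 d1] := d01.
  have h1 : (1 `^ b'^-1 = 1 :> R)%R by rewrite powR1.
  by rewrite subr_gt0 -[ltRHS]h1 gt0_ltr_powR ?nnegrE; lra.
move=> x y /[dup] Sx /SE Fx /[dup] Sy /SE Fy Nx Ny exy.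
have Fxy : levels_finite mu P (fun nu t => x nu t - y nu t)%R.
  by move=> nu; exact: (power_finite_sub PK (Fx nu) (Fy nu)).
rewrite opprB addrCA subrr addr0 midE normE; last exact: midF.
apply: (level_sum_le_norm PK) => //; first exact: midF.
apply: uc => //.
- by apply: (level_norm_le1 PK) => //; rewrite -normE// Nx.
- by apply: (level_norm_le1 PK) => //; rewrite -normE// Ny.
apply: (level_norm_ge_sum PK) => //; rewrite -normE//.
by apply: lt_le_trans exy; rewrite lte_fin.
Qed.
End main.

Local Open Scope ereal_scope.

Theorem theorem3p6 (R : realType) (n : nat) (p q : Rn R n -> \bar R) :
  let mu : {measure set (Rn R n) -> \bar R} := @lebesgue_Rn R n in
  exponent p -> exponent q ->
  [/\ 1 < ess_inf mu p, ess_inf mu p <= ess_sup mu p & ess_sup mu p < +oo] ->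
  [/\ 1 < ess_inf mu q, ess_inf mu q <= ess_sup mu q & ess_sup mu q < +oo] ->
  banach_space (lqLp mu p q) (seq_ae_eq mu) (norm_lqLp mu p q) ->
  uniformly_convex (lqLp mu p q) (norm_lqLp mu p q).
Proof. by move=> mu; exact: lqLp_uniformly_convex. Qed.
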